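(* The complex manifolds $\mathbb{C}^{2}$ and $\mathbb{P}^{2}_{\mathbb{C}}$ admit non-trivial meromorphic line bundles, i.e. $H^{1}(\mathbb{C}^{2},\mathcal{M}^{\times})$ and $H^{1}(\mathbb{P}^{2}_{\mathbb{C}},\mathcal{M}^{\times})$ are non-trivial groups.
   Context: Cohomology is in the classical analytic topology. $\mathcal{M}^{\times}$ is the sheaf of groups of non-zero meromorphic functions. A meromorphic line bundle on $X$ is a class in $H^{1}(X,\mathcal{M}^{\times})$, non-trivial if the class is non-trivial. *)

(* Defs.v *)
From HB Require Import structures.
From mathcomp Require Import all_boot all_order all_algebra.
From mathcomp Require Import complex ring.
From mathcomp Require Import all_classical all_reals all_analysis.

Set Implicit Arguments.
Unset Strict Implicit.
Unset Printing Implicit Defensive.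

Import Order.TTheory GRing.Theory Num.Theory numFieldNormedType.Exports.
Local Open Scope classical_set_scope.
Local Open Scope ring_scope.
Local Open Scope quotient_scope.

(** A sheaf of abelian groups on [X], in its etale-space presentation:
    [stalk x] is the group of germs at [x], and [sec_at x s] says that the
    family of germs [s] is a section on some neighbourhood of [x].  The sections
    over an open set [U] are the families [s] such that [sec_at x s] for all
    [x] in [U], two families being identified when they agree on [U].  Group
    laws are written additively, also for sheaves of multiplicative groups. *)
Record absheaf (X : topologicalType) := Absheaf {
  stalk : X -> zmodType ;
  sec_at : forall x : X, (forall y : X, stalk y) -> Prop ;
  sec_at0 : forall x : X, sec_at x (fun y => 0) ;
  sec_atB : forall (x : X) (s t : forall y : X, stalk y),
    sec_at x s -> sec_at x t -> sec_at x (fun y => s y - t y) ;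
  sec_at_near : forall (x : X) (s t : forall y : X, stalk y),
    (\forall y \near x, s y = t y) -> sec_at x s -> sec_at x t
}.

Section Cech.
Variables (X : topologicalType) (F : absheaf X).

(** Open covers are indexed by the points of the space (Godement): [U x] is an
    open neighbourhood of [x].  Every open cover is refined by one of these, and
    two of them have a common refinement of the form [W x `<=` U x `&` V x]. *)
Definition pointed_cover (U : X -> set X) : Prop :=
  forall x, open (U x) /\ U x x.

Record cocycle1 := Cocycle1 {
  ccov : X -> set X ;
  cval : X -> X -> forall z : X, stalk F z ;
  ccovP : pointed_cover ccov ;
  cval_sec : forall i j z, ccov i z -> ccov j z -> sec_at z (cval i j) ;
  cvalD : forall i j k z, ccov i z -> ccov j z -> ccov k z ->
    cval i j z + cval j k z = cval i k z
}.

HB.instance Definition _ := gen_eqMixin cocycle1.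
HB.instance Definition _ := gen_choiceMixin cocycle1.

(** Equality in the direct limit, over all covers, of the groups of 1-cocycles
    modulo coboundaries. *)
Definition cohomologous (c d : cocycle1) : Prop :=
  exists (W : X -> set X) (b : X -> forall z : X, stalk F z),
    [/\ pointed_cover W,
        forall i, W i `<=` ccov c i `&` ccov d i,
        forall i z, W i z -> sec_at z (b i)
      & forall i j z, W i z -> W j z ->
          cval c i j z - cval d i j z = b i z - b j z].

Lemma sec_atN (x : X) (s : forall y, stalk F y) :
  sec_at x s -> sec_at x (fun y => - s y).
Proof.
move=> xs; apply: (sec_at_near _ (sec_atB (sec_at0 F x) xs)).
by apply: nearW => y; rewrite sub0r.
Qed.

Lemma sec_atD (x : X) (s t : forall y, stalk F y) :
  sec_at x s -> sec_at x t -> sec_at x (fun y => s y + t y).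
Proof.
move=> xs xt; apply: (sec_at_near _ (sec_atB xs (sec_atN xt))).
by apply: nearW => y; rewrite opprK.
Qed.

Lemma pointed_coverI (U V : X -> set X) : pointed_cover U -> pointed_cover V ->
  pointed_cover (fun i => U i `&` V i).
Proof.
by move=> hU hV i; have [? ?] := hU i; have [? ?] := hV i; split => //;
  exact: openI.
Qed.

Lemma cohomologous_refl c : cohomologous c c.
Proof.
exists (ccov c), (fun _ _ => 0); split; [exact: ccovP|by []| |].
  by move=> *; exact: sec_at0.
by move=> *; rewrite !subrr.
Qed.

Lemma cohomologous_sym c d : cohomologous c d -> cohomologous d c.
Proof.
move=> [W [b [hW sW hb e]]]; exists W, (fun i z => - b i z); split => //.
- by move=> i z /sW[].
- by move=> i z Wz; apply: sec_atN; exact: hb.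
- by move=> i j z Wi Wj; rewrite -opprB e// opprB opprK addrC.
Qed.

Lemma cohomologous_trans c d e :
  cohomologous c d -> cohomologous d e -> cohomologous c e.
Proof.
move=> [W [b [hW sW hb eb]]] [W' [b' [hW' sW' hb' eb']]].
exists (fun i => W i `&` W' i), (fun i z => b i z + b' i z); split.
- exact: pointed_coverI.
- by move=> i z [/sW[? _] /sW'[_ ?]].
- by move=> i z [? ?]; apply: sec_atD; [exact: hb|exact: hb'].
- move=> i j z [Wi W'i] [Wj W'j].
  by rewrite -(subrK (cval d i j z) (cval c i j z)) -addrA eb// eb'// opprD addrACA.
Qed.

Definition cohomologousb (c d : cocycle1) : bool := `[< cohomologous c d >].

Lemma cohomologousb_equiv : equiv_class_of cohomologousb.
Proof.
split=> [c|c d|d c e]; rewrite /cohomologousb.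
- exact/asboolP/cohomologous_refl.
- by apply/asboolP/asboolP; exact: cohomologous_sym.
- move=> /asboolP cd /asboolP de; apply/asboolP; exact: cohomologous_trans cd de.
Qed.

Canonical cohomologous_equiv := EquivRelPack cohomologousb_equiv.

Definition H1 : Type := {eq_quot cohomologous_equiv}.
HB.instance Definition _ := Choice.on H1.
HB.instance Definition _ := EqQuotient.on H1.

Lemma H1_eqP c d : reflect (cohomologous c d) (\pi_H1 c == \pi_H1 d).
Proof. by rewrite piE; exact: asboolP. Qed.

Program Definition cocycle0 := @Cocycle1 (fun=> setT) (fun _ _ _ => 0) _ _ _.
Next Obligation. by move=> x; split => //; exact: openT. Qed.
Next Obligation. by move=> *; exact: sec_at0. Qed.
Next Obligation. by move=> *; rewrite addr0. Qed.

Program Definition cocycleN c :=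
  @Cocycle1 (ccov c) (fun i j z => - cval c i j z) (ccovP c) _ _.
Next Obligation. by move=> *; apply: sec_atN; exact: cval_sec. Qed.
Next Obligation. by move=> * /=; rewrite -opprD cvalD. Qed.

Program Definition cocycleD c d :=
  @Cocycle1 (fun i => ccov c i `&` ccov d i)
    (fun i j z => cval c i j z + cval d i j z)
    (pointed_coverI (ccovP c) (ccovP d)) _ _.
Next Obligation.
by move=> ? ? i j z [? ?] [? ?]; apply: sec_atD; exact: cval_sec.
Qed.
Next Obligation.
by move=> ? ? i j k z [? ?] [? ?] [? ?]; rewrite /= addrACA !cvalD.
Qed.

Definition H1_zero : H1 := \pi_H1 cocycle0.
Definition H1_opp (a : H1) : H1 := \pi_H1 (cocycleN (repr a)).
Definition H1_add (a b : H1) : H1 := \pi_H1 (cocycleD (repr a) (repr b)).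

Lemma cohomologous_repr c : cohomologous (repr (\pi_H1 c)) c.
Proof. by apply/H1_eqP; rewrite reprK. Qed.

Lemma H1_oppE c : H1_opp (\pi_H1 c) = \pi_H1 (cocycleN c).
Proof.
apply/eqP/H1_eqP; have [W [b [hW sW hb e]]] := cohomologous_repr c.
exists W, (fun i z => - b i z); split => //.
- by move=> i z Wz; apply: sec_atN; exact: hb.
- by move=> i j z Wi Wj /=; rewrite -!opprD e.
Qed.

Lemma H1_addE c d : H1_add (\pi_H1 c) (\pi_H1 d) = \pi_H1 (cocycleD c d).
Proof.
apply/eqP/H1_eqP; have [W [b [hW sW hb e]]] := cohomologous_repr c.
have [W' [b' [hW' sW' hb' e']]] := cohomologous_repr d.
exists (fun i => W i `&` W' i), (fun i z => b i z + b' i z); split.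
- exact: pointed_coverI.
- by move=> i z [/sW[? ?] /sW'[? ?]].
- by move=> i z [? ?]; apply: sec_atD; [exact: hb|exact: hb'].
- move=> i j z [? ?] [? ?] /=.
  by rewrite opprD addrACA e// e'// opprD addrACA.
Qed.

Lemma cohomologous_eq c d :
  (forall i j z, ccov c i z -> ccov c j z -> ccov d i z -> ccov d j z ->
     cval c i j z = cval d i j z) -> \pi_H1 c = \pi_H1 d.
Proof.
move=> h; apply/eqP/H1_eqP.
exists (fun i => ccov c i `&` ccov d i), (fun _ _ => 0); split => //.
- by apply: pointed_coverI; exact: ccovP.
- by move=> i z.
- by move=> *; exact: sec_at0.
- by move=> i j z [? ?] [? ?]; rewrite h// !subrr.
Qed.

Lemma H1_addA : associative H1_add.
Proof.
elim/quotW => a; elim/quotW => b; elim/quotW => c.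
rewrite (H1_addE b c) (H1_addE a b) (H1_addE a) (H1_addE _ c).
by apply: cohomologous_eq => i j z * /=; rewrite addrA.
Qed.

Lemma H1_addC : commutative H1_add.
Proof.
elim/quotW => a; elim/quotW => b.
rewrite (H1_addE a b) (H1_addE b a).
by apply: cohomologous_eq => i j z * /=; rewrite addrC.
Qed.

Lemma H1_add0 : left_id H1_zero H1_add.
Proof.
elim/quotW => a; rewrite (H1_addE cocycle0 a).
by apply: cohomologous_eq => i j z * /=; rewrite add0r.
Qed.

Lemma H1_addN : left_inverse H1_zero H1_opp H1_add.
Proof.
elim/quotW => a; rewrite (H1_oppE a) (H1_addE _ a).
by apply: cohomologous_eq => i j z * /=; rewrite addNr.
Qed.

HB.instance Definition _ :=
  GRing.isZmodule.Build H1 H1_addA H1_addC H1_add0 H1_addN.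

Lemma H1_eq0P c : \pi_H1 c = 0 <->
  exists (W : X -> set X) (b : X -> forall z : X, stalk F z),
    [/\ pointed_cover W,
        forall i, W i `<=` ccov c i,
        forall i z, W i z -> sec_at z (b i)
      & forall i j z, W i z -> W j z -> cval c i j z = b i z - b j z].
Proof.
split=> [/eqP/H1_eqP|] [W [b [hW sW hb e]]]; last first.
  apply/eqP/H1_eqP; exists W, b; split => //.
  - by move=> i z /sW.
  - by move=> i j z Wi Wj; rewrite -e//= subr0.
exists W, b; split => //; first by move=> i z /sW[].
by move=> i j z Wi Wj; rewrite -e//= subr0.
Qed.

End Cech.

(** The type [R[i]], packaged so that its norm topology and its structure of
    normed space over itself are inferred. *)
Definition Cplx (R : realType) : numClosedFieldType := R[i]%C.

(** A holomorphic atlas of dimension [n] on [X].  The chart [i] is the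
    homeomorphism [chart i] from the open set [dom i] onto the open set
    [chart i @` dom i], with inverse [param i].  As [differentiable] is
    complex Frechet differentiability, a map that is differentiable at every
    point of an open set is holomorphic there. *)
Record holo_atlas (R : realType) (n : nat) (X : topologicalType) := HoloAtlas {
  chart_idx : Type ;
  dom : chart_idx -> set X ;
  chart : chart_idx -> X -> 'rV[Cplx R]_n ;
  param : chart_idx -> 'rV[Cplx R]_n -> X ;
  dom_open : forall i, open (dom i) ;
  dom_cover : forall x, exists i, dom i x ;
  chart_open : forall i, open (chart i @` dom i) ;
  chartK : forall i x, dom i x -> param i (chart i x) = x ;
  chart_continuous : forall i x, dom i x -> {for x, continuous (chart i)} ;
  param_continuous : forall i w, (chart i @` dom i) w ->
    {for w, continuous (param i)} ;
  transition_holo : forall i j w, (chart i @` dom i) w -> dom j (param i w) ->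
    differentiable (chart j \o param i) w
}.

Arguments dom {R n X} h i _ : rename.
Arguments chart {R n X} h i _ : rename.
Arguments param {R n X} h i _ : rename.

Section Meromorphic.
Variables (R : realType) (n : nat) (X : topologicalType).
Variable A : holo_atlas R n X.
Local Notation C := (Cplx R).

Definition holo_at (f : X -> C) (x : X) : Prop :=
  forall i, dom A i x ->
    \forall w \near chart A i x, differentiable (f \o param A i) w.

Definition germ_eq (x : X) (f g : X -> C) : Prop := \forall y \near x, f y = g y.

(** The germ of [f] at [x] is a non-zero-divisor of the ring O_x of germs of
    holomorphic functions.  As O_x is an integral domain on a manifold, these
    are the non-zero germs. *)
Definition regular_at (f : X -> C) (x : X) : Prop :=
  holo_at f x /\
  forall h, holo_at h x -> germ_eq x (f * h) 0 -> germ_eq x h 0.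

Lemma holo_atM f g x : holo_at f x -> holo_at g x -> holo_at (f * g) x.
Proof.
move=> hf hg i xi; near=> w.
have -> : (f * g) \o param A i = (f \o param A i) * (g \o param A i) by [].
apply: differentiableM; near: w; [exact: hf|exact: hg].
Unshelve. all: by end_near. Qed.

Lemma holo_atB f g x : holo_at f x -> holo_at g x -> holo_at (f - g) x.
Proof.
move=> hf hg i xi; near=> w.
have -> : (f - g) \o param A i = (f \o param A i) - (g \o param A i) by [].
apply: differentiableB; near: w; [exact: hf|exact: hg].
Unshelve. all: by end_near. Qed.

Lemma holo_at_cst (a : C) x : holo_at (cst a) x.
Proof.
move=> i _; near=> w; exact: (differentiable_cst a w).
Unshelve. all: by end_near. Qed.

Lemma regular_atM f g x : regular_at f x -> regular_at g x ->
  regular_at (f * g) x.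
Proof.
move=> [hf rf] [hg rg]; split=> [|h hh fgh]; first exact: holo_atM.
apply: rg => //; apply: rf; first exact: holo_atM.
by rewrite mulrA.
Qed.

Lemma regular_at1 x : regular_at 1 x.
Proof.
split=> [|h _]; first exact: holo_at_cst.
by rewrite mul1r.
Qed.

Record fraction_at (x : X) := Fraction {
  num : X -> C ;
  den : X -> C ;
  num_regular : regular_at num x ;
  den_regular : regular_at den x
}.

HB.instance Definition _ x := gen_eqMixin (fraction_at x).
HB.instance Definition _ x := gen_choiceMixin (fraction_at x).

Definition fraction_eq x (p q : fraction_at x) : bool :=
  `[< germ_eq x (num p * den q) (num q * den p) >].

Lemma fraction_eq_equiv x : equiv_class_of (@fraction_eq x).
Proof.
split=> [p|p q|q p r]; rewrite /fraction_eq.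
- by apply/asboolP; apply: nearW.
- by apply/asboolP/asboolP; apply: filterS => y /esym.
- move=> /asboolP pq /asboolP qr; apply/asboolP.
  have [_ rq] := den_regular q.
  have [hp _] := num_regular p; have [hp' _] := den_regular p.
  have [hr _] := num_regular r; have [hr' _] := den_regular r.
  have : germ_eq x (num p * den r - num r * den p) 0.
    apply: rq; first by apply: holo_atB; exact: holo_atM.
    near=> y.
    have pqy : num p y * den q y = num q y * den p y by near: y; exact: pq.
    have qry : num q y * den r y = num r y * den q y by near: y; exact: qr.
    change (den q y * (num p y * den r y - num r y * den p y) = 0).
    rewrite mulrBr [X in X - _](_ : _ = num p y * den q y * den r y); last by ring.
    rewrite pqy [X in _ - X](_ : _ = num r y * den q y * den p y); last by ring.
    by rewrite -qry; ring.
  by apply: filterS => y /eqP; rewrite subr_eq0 => /eqP.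
Unshelve. all: by end_near. Qed.

Canonical fraction_equiv x := EquivRelPack (fraction_eq_equiv x).

(** The group of units of the field M_x of fractions of O_x. *)
Definition mero_germ (x : X) : Type := {eq_quot (fraction_equiv x)}.
HB.instance Definition _ x := Choice.on (mero_germ x).
HB.instance Definition _ x := EqQuotient.on (mero_germ x).

Lemma mero_germ_eqP x (p q : fraction_at x) :
  reflect (germ_eq x (num p * den q) (num q * den p))
          (\pi_(mero_germ x) p == \pi_(mero_germ x) q).
Proof. by rewrite piE; exact: asboolP. Qed.

Definition fraction1 x := Fraction (regular_at1 x) (regular_at1 x).
Definition fractionV x (p : fraction_at x) :=
  Fraction (den_regular p) (num_regular p).
Definition fractionM x (p q : fraction_at x) :=
  Fraction (regular_atM (num_regular p) (num_regular q))
           (regular_atM (den_regular p) (den_regular q)).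

Definition mero_germ1 x : mero_germ x := \pi_(mero_germ x) (fraction1 x).
Definition mero_germV x (a : mero_germ x) : mero_germ x :=
  \pi_(mero_germ x) (fractionV (repr a)).
Definition mero_germM x (a b : mero_germ x) : mero_germ x :=
  \pi_(mero_germ x) (fractionM (repr a) (repr b)).

Lemma mero_germ_repr x (p : fraction_at x) :
  germ_eq x (num (repr (\pi_(mero_germ x) p)) * den p)
            (num p * den (repr (\pi_(mero_germ x) p))).
Proof. by apply/mero_germ_eqP; rewrite reprK. Qed.

Lemma mero_germVE x (p : fraction_at x) :
  mero_germV (\pi_(mero_germ x) p) = \pi_(mero_germ x) (fractionV p).
Proof.
apply/eqP/mero_germ_eqP => /=; have := mero_germ_repr p.
by apply: filterS => y /esym; rewrite [RHS]mulrC [LHS]mulrC.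
Qed.

Lemma mero_germME x (p q : fraction_at x) :
  mero_germM (\pi_(mero_germ x) p) (\pi_(mero_germ x) q) =
  \pi_(mero_germ x) (fractionM p q).
Proof.
apply/eqP/mero_germ_eqP => /=.
apply: filterS2 (mero_germ_repr p) (mero_germ_repr q) => y hp hq.
by rewrite mulrACA [RHS]mulrACA; congr (_ * _).
Qed.

Lemma mero_germMA x : associative (@mero_germM x).
Proof.
elim/quotW => a; elim/quotW => b; elim/quotW => c.
rewrite (mero_germME b c) (mero_germME a b) (mero_germME a) (mero_germME _ c).
by apply/eqP/mero_germ_eqP; apply: nearW => y /=; rewrite !mulrA.
Qed.

Lemma mero_germMC x : commutative (@mero_germM x).
Proof.
elim/quotW => a; elim/quotW => b.
rewrite (mero_germME a b) (mero_germME b a).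
apply/eqP/mero_germ_eqP; apply: nearW => y /=.
by rewrite [num a * _]mulrC [den a * _]mulrC.
Qed.

Lemma mero_germ1M x : left_id (@mero_germ1 x) (@mero_germM x).
Proof.
elim/quotW => a; rewrite (mero_germME (fraction1 x) a).
by apply/eqP/mero_germ_eqP; apply: nearW => y /=; rewrite !mul1r.
Qed.

Lemma mero_germVM x :
  left_inverse (@mero_germ1 x) (@mero_germV x) (@mero_germM x).
Proof.
elim/quotW => a; rewrite (mero_germVE a) (mero_germME _ a).
apply/eqP/mero_germ_eqP; apply: nearW => y /=.
by rewrite mulr1 mul1r [den a * _]mulrC.
Qed.

(** The addition of this [zmodType] is the multiplication of fractions. *)
HB.instance Definition _ x := GRing.isZmodule.Build (mero_germ x)
  (@mero_germMA x) (@mero_germMC x) (@mero_germ1M x) (@mero_germVM x).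

Lemma mero_germ_addE x (p q : fraction_at x) :
  \pi_(mero_germ x) p + \pi_(mero_germ x) q = \pi_(mero_germ x) (fractionM p q).
Proof. exact: mero_germME. Qed.

Lemma mero_germ_oppE x (p : fraction_at x) :
  - \pi_(mero_germ x) p = \pi_(mero_germ x) (fractionV p).
Proof. exact: mero_germVE. Qed.

(** Near [x], the family of germs [s] is given by a single quotient [f / g] of
    holomorphic functions. *)
Definition mero_at (x : X) (s : forall y : X, mero_germ y) : Prop :=
  exists f g : X -> C, \forall y \near x, exists p : fraction_at y,
    [/\ num p = f, den p = g & s y = \pi_(mero_germ y) p].

Lemma mero_at0 x : mero_at x (fun y => 0).
Proof. by exists 1, 1; apply: nearW => y; exists (fraction1 y). Qed.

Lemma mero_atB x (s t : forall y : X, mero_germ y) :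
  mero_at x s -> mero_at x t -> mero_at x (fun y => s y - t y).
Proof.
move=> [f [g sfg]] [f' [g' tfg]]; exists (f * g'), (g * f').
apply: filterS2 sfg tfg => y [p [<- <- ->]] [q [<- <- ->]].
exists (fractionM p (fractionV q)); split => //.
by rewrite mero_germ_oppE mero_germ_addE.
Qed.

Lemma mero_at_near x (s t : forall y : X, mero_germ y) :
  (\forall y \near x, s y = t y) -> mero_at x s -> mero_at x t.
Proof.
move=> st [f [g sfg]]; exists f, g.
by apply: filterS2 st sfg => y <-.
Qed.

(** The sheaf M^* of non-zero meromorphic functions: the sheaf of units of the
    sheaf of germs of quotients of holomorphic functions. *)
Definition mero_units : absheaf X := Absheaf mero_at0 mero_atB mero_at_near.

Definition mero_line_bundle : zmodType := H1 mero_units.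

End Meromorphic.

Section AffineSpace.
Variables (R : realType) (n : nat).

Program Definition affine_atlas : holo_atlas R n 'rV[Cplx R]_n :=
  @HoloAtlas R n 'rV[Cplx R]_n unit (fun=> setT) (fun=> id) (fun=> id)
    _ _ _ _ _ _ _.
Next Obligation. by move=> i; exact: openT. Qed.
Next Obligation. by move=> x; exists tt. Qed.
Next Obligation. by move=> i; rewrite image_id; exact: openT. Qed.
Next Obligation. by []. Qed.
Next Obligation. by move=> i x _; exact: cvg_id. Qed.
Next Obligation. by move=> i x _; exact: cvg_id. Qed.
Next Obligation. by move=> i j w _ _ /=; exact: ex_diff. Qed.

End AffineSpace.

Section ProjectiveSpace.
Variables (R : realType) (n : nat).
Local Notation C := (Cplx R).

Definition nzvec : Type := set_type [set v : 'rV[C]_n.+1 | v != 0].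
HB.instance Definition _ := Topological.on nzvec.

Definition same_line (u v : nzvec) : bool :=
  `[< exists2 c : C, c != 0 & set_val v = c *: set_val u >].

Lemma same_line_equiv : equiv_class_of same_line.
Proof.
split=> [u|u v|v u w]; rewrite /same_line.
- by apply/asboolP; exists 1; rewrite ?oner_neq0// scale1r.
- apply/asboolP/asboolP => -[c c0 e]; exists c^-1; rewrite ?invr_neq0//;
  by rewrite e scalerA mulVf// scale1r.
- move=> /asboolP[c c0 e] /asboolP[d d0 e']; apply/asboolP.
  by exists (d * c); rewrite ?mulf_neq0// e' e scalerA.
Qed.

Canonical same_line_equivRel := EquivRelPack same_line_equiv.

Definition proj_space : topologicalType :=
  quotient_topology {eq_quot same_line_equivRel}.

Definition proj_pt (u : nzvec) : proj_space :=
  \pi_({eq_quot same_line_equivRel}) u.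

Lemma proj_pt_eqP (u v : nzvec) : proj_pt u = proj_pt v <->
  exists2 c : C, c != 0 & set_val v = c *: set_val u.
Proof.
have h : proj_pt u = proj_pt v <-> same_line u v by split=> /eqmodP.
by split=> [/h/asboolP|/asboolP/h].
Qed.

Definition hcoord (x : proj_space) : 'rV[C]_n.+1 := set_val (repr x : nzvec).

Lemma hcoord_pi (u : nzvec) : exists2 c : C, c != 0 &
  hcoord (proj_pt u) = c *: set_val u.
Proof. by apply/proj_pt_eqP; exact/esym/reprK. Qed.

Definition proj_dom (i : 'I_n.+1) : set proj_space :=
  [set x | hcoord x 0 i != 0].

(** The affine coordinates v_k / v_i, for k <> i. *)
Definition dehom (i : 'I_n.+1) (v : 'rV[C]_n.+1) : 'rV[C]_n :=
  \row_j (v 0 (lift i j) / v 0 i).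

Definition proj_chart (i : 'I_n.+1) (x : proj_space) : 'rV[C]_n :=
  dehom i (hcoord x).

(** The vector with [1] in position [i] and the entries of [w] elsewhere. *)
Definition hom (i : 'I_n.+1) (w : 'rV[C]_n) : 'rV[C]_n.+1 :=
  \row_k (if unlift i k is Some j then w 0 j else 1).

Lemma hom_neq0 i w : hom i w \in [set v : 'rV[C]_n.+1 | v != 0].
Proof.
apply/mem_set => /=; apply/eqP => /rowP /(_ i).
by rewrite !mxE unlift_none => /eqP; rewrite oner_eq0.
Qed.

Definition hom_nz i w : nzvec := SigSub (hom_neq0 i w).

Lemma val_hom_nz i w : set_val (hom_nz i w) = hom i w.
Proof. by []. Qed.

Definition proj_param (i : 'I_n.+1) (w : 'rV[C]_n) : proj_space :=
  proj_pt (hom_nz i w).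

Lemma proj_dom_pi i (u : nzvec) :
  proj_dom i (proj_pt u) <-> (set_val u : 'rV[C]_n.+1) 0 i != 0.
Proof.
rewrite /proj_dom /=; have [c c0 ->] := hcoord_pi u.
by rewrite mxE mulf_eq0 negb_or c0.
Qed.

Lemma proj_chart_pi i (u : nzvec) :
  proj_chart i (proj_pt u) = dehom i (set_val u).
Proof.
rewrite /proj_chart; have [c c0 ->] := hcoord_pi u.
by apply/rowP => j; rewrite !mxE invfM mulrACA mulfV// mul1r.
Qed.

Lemma hom_i i w : hom i w 0 i = 1.
Proof. by rewrite mxE unlift_none. Qed.

Lemma homK i w : dehom i (hom i w) = w.
Proof. by apply/rowP => j; rewrite mxE hom_i divr1 mxE liftK. Qed.

Lemma dehomK i (v : 'rV[C]_n.+1) : v 0 i != 0 -> hom i (dehom i v) = (v 0 i)^-1 *: v.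
Proof.
move=> vi; apply/rowP => k; rewrite !mxE.
by case: unliftP => [j|] ->; rewrite ?mxE ?mulVf// mulrC.
Qed.

Lemma proj_chart_image i : proj_chart i @` proj_dom i = setT.
Proof.
rewrite -subTset => w _; exists (proj_param i w).
  by apply/proj_dom_pi; rewrite val_hom_nz hom_i oner_neq0.
by rewrite proj_chart_pi val_hom_nz homK.
Qed.

Lemma proj_chartK i x : proj_dom i x -> proj_param i (proj_chart i x) = x.
Proof.
move=> xi; rewrite -[RHS]reprK; apply/esym/proj_pt_eqP.
by exists (hcoord x 0 i)^-1; rewrite ?invr_neq0// val_hom_nz dehomK.
Qed.

Lemma differentiable_row m k (f : 'rV[C]_m -> 'rV[C]_k) w :
  (forall j, differentiable (fun w => f w 0 j) w) -> differentiable f w.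
Proof.
move=> df.
rewrite (_ : f = \sum_(j < k) (fun w => f w 0 j *: delta_mx 0 j)).
  by apply: differentiable_sum => j; exact: differentiableZl.
apply/funext => z; rewrite [LHS]row_sum_delta fct_sumE.
by [].
Qed.

Lemma differentiable_dehom i (v : 'rV[C]_n.+1) : v 0 i != 0 -> differentiable (dehom i) v.
Proof.
move=> vi; apply: differentiable_row => j.
rewrite (_ : (fun _ => _) =
  (fun v : 'rV[C]_n.+1 => v 0 (lift i j)) * (fun v => (v 0 i)^-1)).
  apply: differentiableM; first exact: differentiable_coord.
  by apply: differentiableV => //; exact: differentiable_coord.
by apply/funext => z; rewrite mxE.
Qed.

Lemma differentiable_hom i w : differentiable (hom i) w.
Proof.
apply: differentiable_row => k; case: (unliftP i k) => [j|] e.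
  rewrite (_ : (fun _ => _) = (fun w : 'rV[C]_n => w 0 j)).
    exact: differentiable_coord.
  by apply/funext => z; rewrite mxE e liftK.
rewrite (_ : (fun _ => _) = cst 1); first exact: differentiable_cst.
by apply/funext => z; rewrite e hom_i.
Qed.

Lemma set_val_continuous : continuous (set_val : nzvec -> 'rV[C]_n.+1).
Proof. exact: initial_continuous. Qed.

Lemma near_coord_neq0 i (v : 'rV[C]_n.+1) : v 0 i != 0 ->
  \forall u \near v, (u : 'rV[C]_n.+1) 0 i != 0.
Proof.
move=> vi.
have h : (fun u : 'rV[C]_n.+1 => u 0 i : C) @ v --> (v 0 i : C).
  exact: (differentiable_continuous (differentiable_coord v 0 i)).
exact: cvgr_neq0 h vi.
Qed.

Lemma proj_open (U : set proj_space) : open (proj_pt @^-1` U) -> open U.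
Proof. by []. Qed.

Lemma proj_dom_open i : open (proj_dom i).
Proof.
apply: proj_open; rewrite openE => u /proj_dom_pi ui.
have h : nbhs u (set_val @^-1` [set v : 'rV[C]_n.+1 | v 0 i != 0]).
  exact: set_val_continuous (near_coord_neq0 ui).
by apply: (filterS _ h) => v /= vi; apply/proj_dom_pi.
Qed.

Lemma proj_chart_continuous i x : proj_dom i x ->
  {for x, continuous (proj_chart i)}.
Proof.
move=> xi N; rewrite nbhsE => -[B [oB Bx] BN].
have oA : open (proj_dom i `&` proj_chart i @^-1` B).
  apply: proj_open; rewrite openE => u [/proj_dom_pi ui /= uB].
  rewrite proj_chart_pi in uB.
  have h : \forall v \near (set_val u : 'rV[C]_n.+1), B (dehom i v).
    apply: (differentiable_continuous (differentiable_dehom ui)).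
    exact: open_nbhs_nbhs.
  have h' : nbhs u (set_val @^-1` [set v : 'rV[C]_n.+1 | v 0 i != 0] `&`
                    set_val @^-1` [set v | B (dehom i v)]).
    apply: filterI; first exact: set_val_continuous (near_coord_neq0 ui).
    exact: set_val_continuous h.
  apply: (filterS _ h') => v /= [vi vB]; split; first exact/proj_dom_pi.
  by rewrite /= proj_chart_pi.
have : nbhs x (proj_dom i `&` proj_chart i @^-1` B).
  exact: open_nbhs_nbhs.
by apply: filterS => y [_ /BN].
Qed.

Lemma proj_param_continuous i : continuous (proj_param i).
Proof.
move=> w.
have hc : continuous (hom_nz i).
  apply/(@continuous_comp_initial _ _ _ (set_val : nzvec -> 'rV[C]_n.+1)) => z.
  exact: (differentiable_continuous (differentiable_hom i z)).
apply: (@continuous_comp _ _ _ (hom_nz i) proj_pt); first exact: hc.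
exact: pi_continuous.
Qed.

Program Definition proj_atlas : holo_atlas R n proj_space :=
  @HoloAtlas R n proj_space 'I_n.+1 proj_dom proj_chart proj_param
    proj_dom_open _ _ proj_chartK proj_chart_continuous _ _.
Next Obligation.
by move=> x; have /rV0Pn[i xi] := set_valP (repr x); exists i.
Qed.
Next Obligation. by move=> i; rewrite proj_chart_image; exact: openT. Qed.
Next Obligation. by move=> i w _; exact: proj_param_continuous. Qed.
Next Obligation.
move=> i j w _ /proj_dom_pi wj.
rewrite (_ : _ \o _ = dehom j \o hom i).
  apply: differentiable_comp; first exact: differentiable_hom.
  exact: differentiable_dehom.
by apply/funext => z; rewrite /= proj_chart_pi.
Qed.

End ProjectiveSpace.

(* Main.v *)
Require Import Defs.
From HB Require Import structures.
From mathcomp Require Import all_boot all_order all_algebra.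
From mathcomp Require Import complex ring lra.
From mathcomp Require Import all_classical all_reals all_analysis.

(**
  Let h(x) = exp(1/(x(x-8))), which has essential singularities at 0 and 8, and
  let S be its graph y = h(x).  The bundle is glued on V1 = {|x| > 3/2} and
  V2 = {|x| < 2} (and V0 = {|y| > e}, in the projective case) with transition
  function y - h(x) on the intersection of V1 and V2.  On the projective plane
  the cocycle extends to V0 because log(1 - h(x)/y), holomorphic for
  1 <= |x| <= 3 and |y| > e, is the difference of two Cauchy integrals, one
  holomorphic on |x| < 2 and the other on |x| > 3/2.

  If the bundle were trivial there would be meromorphic functions b1 on V1 and
  b2 on V2 with b1/b2 = y - h(x).  The order of b2 along S is constant on the
  part of S over the half disc {Im x > 0, |x| < 2}.  Were it not 0, then b2
  would have zeros or poles all along that part of S, which accumulates at every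
  (0, y) with y near 1 because of the essential singularity; this is impossible
  for a quotient of holomorphic functions near (0, 1).  So it is 0, and
  likewise the order of b1 is 0 because of x = 8.  Over the overlap these two
  orders differ by 1, a contradiction.
*)

Set Implicit Arguments.
Unset Strict Implicit.
Unset Printing Implicit Defensive.

Import Order.TTheory GRing.Theory Num.Theory numFieldNormedType.Exports.
Local Open Scope classical_set_scope.
Local Open Scope ring_scope.

(** The order along S is delicate at points of S where another zero or polar curve of numerator or
    denominator crosses. Such points are isolated, so the order is read off in punctured
    neighbourhoods, after factoring a power of w = y - h(x) out of numerator and denominator. Its
    constancy is propagated along segments; hence the convex regions {Im x > 0, |x| < 2} and {Im x >
    0, Re x > 3/2}, which avoid 0 and 8 and share the point 7/4 + i/4. The essential singularities
    have to be approached inside these regions, so solutions of h(x) = y are needed with a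
    prescribed sign of Im x; the symmetry h(8 - x) = h(x) carries them from 0 to 8.

    The numbers come from the contours, which are squares about 0 of half-side 1 and 2. Points of a
    square of half-side r have modulus at least r and less than 3r/2 (the corners have modulus sqrt
    2 times r). So the small square lies in |x| < 3/2, the large one surrounds |x| < 2, and both lie
    in 1 <= |x| <= 3. There |x(x - 8)| >= 1, hence |h| <= e, and |y| > e keeps 1 - h/y in the right
    half-plane, where the logarithm is defined. *)

Section Cmod.
Variable R : realType.
Local Notation C := (Cplx R).
Implicit Types z w : C.

Lemma eq_ler (x y : R) : x = y -> x <= y.
Proof. by move=> ->. Qed.

(** The norm of [Cplx R] takes its values in [Cplx R]. Estimates use this real-valued modulus
    instead, so that the total order of [R] is available. *)
Definition cmod z : R := ComplexField.Normc.normc z.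
Definition toC (x : R) : C := x%:C%C.
Definition cRe z : R := complex.Re z.
Definition cIm z : R := complex.Im z.

Lemma normCE z : `|z| = toC (cmod z).
Proof. by []. Qed.

Lemma cmodM z w : cmod (z * w) = cmod z * cmod w.
Proof. exact: ComplexField.Normc.normcM. Qed.

Lemma le_toC x y : (toC x <= toC y :> C) = (x <= y).
Proof. exact: lecR. Qed.

Lemma lt_toC x y : (toC x < toC y :> C) = (x < y).
Proof. exact: ltcR. Qed.

Lemma toCD x y : toC (x + y) = toC x + toC y.
Proof. exact: (rmorphD (real_complex R)). Qed.
Lemma toCN x : toC (- x) = - toC x.
Proof. exact: (rmorphN (real_complex R)). Qed.
Lemma toCB x y : toC (x - y) = toC x - toC y.
Proof. exact: (rmorphB (real_complex R)). Qed.
Lemma toCM x y : toC (x * y) = toC x * toC y.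
Proof. exact: (rmorphM (real_complex R)). Qed.
Lemma toCV x : toC (x^-1) = (toC x)^-1.
Proof. exact: (fmorphV (real_complex R)). Qed.
Lemma toC0 : toC 0 = 0. Proof. by []. Qed.
Lemma toC1 : toC 1 = 1. Proof. by []. Qed.
Lemma toC_nat n : toC n%:R = n%:R.
Proof. exact: (rmorph_nat (real_complex R)). Qed.
Lemma toCX x n : toC (x ^+ n) = toC x ^+ n.
Proof. exact: (rmorphXn (real_complex R)). Qed.

Lemma toCK x : cRe (toC x) = x. Proof. by []. Qed.
Lemma toC_inj : injective toC.
Proof. exact: complexI. Qed.

Lemma cmod_ge0 z : 0 <= cmod z.
Proof. by rewrite -le_toC -normCE normr_ge0. Qed.

Lemma cmodD z w : cmod (z + w) <= cmod z + cmod w.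
Proof. by rewrite -le_toC toCD -!normCE ler_normD. Qed.

Lemma cmodN z : cmod (- z) = cmod z.
Proof. by apply: toC_inj; rewrite -!normCE normrN. Qed.

Lemma cmodB z w : cmod (z - w) = cmod (w - z).
Proof. by rewrite -cmodN opprB. Qed.

Lemma cmod_sub z w : cmod z - cmod w <= cmod (z - w).
Proof. by rewrite lerBlDr -{1}(subrK w z) cmodD. Qed.

Lemma cmod0 : cmod 0 = 0.
Proof. by apply: toC_inj; rewrite -normCE normr0. Qed.

Lemma cmod1 : cmod 1 = 1.
Proof. by apply: toC_inj; rewrite -normCE normr1. Qed.

Lemma cmod_eq0 z : (cmod z == 0) = (z == 0).
Proof. by rewrite -(inj_eq toC_inj) -normCE normr_eq0. Qed.

Lemma cmod_gt0 z : (0 < cmod z) = (z != 0).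
Proof. by rewrite lt_def cmod_eq0 cmod_ge0 andbT. Qed.

Lemma cmodV z : cmod z^-1 = (cmod z)^-1.
Proof. by apply: toC_inj; rewrite toCV -!normCE normfV. Qed.

Lemma cmodX z n : cmod (z ^+ n) = cmod z ^+ n.
Proof. by apply: toC_inj; rewrite toCX -!normCE normrX. Qed.

Lemma cmod_toC x : cmod (toC x) = `|x|.
Proof. by rewrite /cmod /toC /= expr0n /= addr0 sqrtr_sqr. Qed.

Lemma cmod_sqr z : cmod z ^+ 2 = cRe z ^+ 2 + cIm z ^+ 2.
Proof.
case: z => a b; rewrite /cmod /cRe /cIm /= sqr_sqrtr//.
by rewrite addr_ge0// sqr_ge0.
Qed.

Lemma cRe_le z : `|cRe z| <= cmod z.
Proof.
rewrite -(@ler_pXn2r _ 2)// ?nnegrE ?cmod_ge0//.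
by rewrite cmod_sqr real_normK ?num_real// lerDl sqr_ge0.
Qed.

Lemma cIm_le z : `|cIm z| <= cmod z.
Proof.
rewrite -(@ler_pXn2r _ 2)// ?nnegrE ?cmod_ge0//.
by rewrite cmod_sqr real_normK ?num_real// lerDr sqr_ge0.
Qed.

Definition mkC (x y : R) : C := (x +i* y)%C.

Lemma cRe_mk x y : cRe (mkC x y) = x. Proof. by []. Qed.
Lemma cIm_mk x y : cIm (mkC x y) = y. Proof. by []. Qed.

Lemma cReD z w : cRe (z + w) = cRe z + cRe w.
Proof. by case: z; case: w. Qed.
Lemma cImD z w : cIm (z + w) = cIm z + cIm w.
Proof. by case: z; case: w. Qed.
Lemma cReN z : cRe (- z) = - cRe z. Proof. by case: z. Qed.
Lemma cImN z : cIm (- z) = - cIm z. Proof. by case: z. Qed.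
Lemma cReM z w : cRe (z * w) = cRe z * cRe w - cIm z * cIm w.
Proof. by case: z; case: w. Qed.
Lemma cImM z w : cIm (z * w) = cRe z * cIm w + cIm z * cRe w.
Proof. by case: z => a b; case: w => c d; rewrite /cIm/cRe/=; ring. Qed.

Lemma ReIm_ext z w : cRe z = cRe w -> cIm z = cIm w -> z = w.
Proof. by case: z; case: w => a b c d; rewrite /cRe /cIm /= => -> ->. Qed.

Lemma cmod_le_ReIm z : cmod z <= `|cRe z| + `|cIm z|.
Proof.
rewrite -(@ler_pXn2r _ 2)// ?nnegrE ?cmod_ge0// ?addr_ge0//.
rewrite cmod_sqr sqrrD !real_normK ?num_real// addrAC lerDl.
by rewrite mulrn_wge0// mulr_ge0.
Qed.

(** The radius of a ball is a positive element of [C]; such elements are real, so real radii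
    describe the same filter. *)
Lemma nearC (P : set C) z :
  (\forall w \near z, P w) <-> exists2 d : R, 0 < d & forall w, cmod (w - z) < d -> P w.
Proof.
split=> [/nbhs_ballP[e /= e0 h]|[d d0 h]].
  have e0' := e0; rewrite lt_def in e0'; case/andP: e0' => _ /ger0_real.
  case/complex_realP => x ex; exists x.
    by move: e0; rewrite ex -toC0 lt_toC.
  by move=> w wz; apply: h; rewrite /ball /= normCE cmodB ex lt_toC.
apply/nbhs_ballP; exists (toC d); first by rewrite /= -toC0 lt_toC.
by move=> w; rewrite /ball /= normCE lt_toC cmodB => /h.
Qed.

End Cmod.

Arguments cmod {R} z : simpl never.
Arguments toC {R} x : simpl never.
Global Opaque cmod.

(** * Integrals of complex-valued functions *)

Section Cint.
Variable R : realType.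
Local Notation C := (Cplx R).
Local Notation mu := (@lebesgue_measure R).
Implicit Types (f g : R -> C) (a b : R).

Lemma nearR (P : set R) (s : R) :
  (\forall t \near s, P t) <-> exists2 d : R, 0 < d & forall t, `|t - s| < d -> P t.
Proof.
split=> [/nbhs_ballP[e /= e0 h]|[d d0 h]].
  by exists e => // t ts; apply: h; rewrite /ball /= distrC.
by apply/nbhs_ballP; exists d => //= t; rewrite /ball /= distrC => /h.
Qed.

(** Continuity relative to the segment: values outside it have no influence, and the condition is
    one-sided at the endpoints. *)
Definition ccont f a b := forall s, a <= s <= b -> forall e, 0 < e ->
  exists2 d, 0 < d & forall t, a <= t <= b -> `|t - s| < d -> cmod (f t - f s) < e.

Definition cint f a b : C :=
  mkC (Rintegral mu `[a, b] (fun x => cRe (f x))) (Rintegral mu `[a, b] (fun x => cIm (f x))).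

Lemma ccont_within (T : C -> R) f a b :
  (forall z w, `|T z - T w| <= cmod (z - w)) -> ccont f a b ->
  {within `[a, b], continuous (T \o f)}.
Proof.
move=> hT cf; apply/subspace_continuousP => s /=; rewrite in_itv/= => sab.
apply/cvgrPdist_lt => e e0; have [d d0 h] := cf s sab e e0.
rewrite near_withinE; apply/nearR; exists d => // t ts.
rewrite /= in_itv/= => tab; rewrite distrC.
by apply: le_lt_trans (hT _ _) _; apply: h.
Qed.

Lemma cRe_lip (z w : C) : `|cRe z - cRe w| <= cmod (z - w).
Proof. by rewrite -cReN -cReD cRe_le. Qed.
Lemma cIm_lip (z w : C) : `|cIm z - cIm w| <= cmod (z - w).
Proof. by rewrite -cImN -cImD cIm_le. Qed.

Lemma integrable_Re f a b : ccont f a b ->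
  mu.-integrable `[a, b] (EFin \o (fun x => cRe (f x))).
Proof.
move=> cf; apply: continuous_compact_integrable; first exact: segment_compact.
exact: (ccont_within cRe_lip).
Qed.

Lemma integrable_Im f a b : ccont f a b ->
  mu.-integrable `[a, b] (EFin \o (fun x => cIm (f x))).
Proof.
move=> cf; apply: continuous_compact_integrable; first exact: segment_compact.
exact: (ccont_within cIm_lip).
Qed.

Lemma eq_ccont f g a b : (forall s, a <= s <= b -> f s = g s) ->
  ccont f a b -> ccont g a b.
Proof.
move=> fg cf s sab e e0; have [d d0 h] := cf s sab e e0.
by exists d => // t tab ts; rewrite -!fg//; exact: h.
Qed.

Lemma ccont_cst (c : C) a b : ccont (fun=> c) a b.
Proof. by move=> s _ e e0; exists 1 => // t _ _; rewrite subrr cmod0. Qed.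

Lemma ccont_toC a b : ccont (fun s => toC s) a b.
Proof. by move=> s _ e e0; exists e => // t _; rewrite -toCB cmod_toC. Qed.

Lemma ccontD f g a b : ccont f a b -> ccont g a b -> ccont (fun s => f s + g s) a b.
Proof.
move=> cf cg s sab e e0.
have [d d0 h] := cf s sab (e / 2) (divr_gt0 e0 (ltr0n _ 2)).
have [d' d'0 h'] := cg s sab (e / 2) (divr_gt0 e0 (ltr0n _ 2)).
exists (Num.min d d'); first by rewrite lt_min d0.
move=> t tab; rewrite lt_min => /andP[td td'].
rewrite opprD addrACA (splitr e); apply: le_lt_trans (cmodD _ _) _.
by rewrite ltrD// ?h// h'.
Qed.

Lemma ccontM f g a b : ccont f a b -> ccont g a b -> ccont (fun s => f s * g s) a b.
Proof.
move=> cf cg s sab e e0.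
pose A := cmod (f s) + cmod (g s) + 1.
have A0 : 0 < A by rewrite ltr_wpDl// addr_ge0// cmod_ge0.
pose k := Num.min 1 (e / (A + A)).
have k0 : 0 < k by rewrite lt_min ltr01 divr_gt0// addr_gt0.
have [d d0 h] := cf s sab k k0.
have [d' d'0 h'] := cg s sab k k0.
exists (Num.min d d'); first by rewrite lt_min d0.
move=> t tab; rewrite lt_min => /andP[/(h t tab) td /(h' t tab) td'].
have k1 : k <= 1 by rewrite /k ge_min lexx.
have AA0 : 0 < A + A by rewrite addr_gt0.
have kA : k * (A + A) <= e by rewrite -(ler_pdivlMr _ _ AA0) /k ge_min lexx orbT.
have -> : f t * g t - f s * g s = (f t - f s) * g t + f s * (g t - g s) by ring.
apply: le_lt_trans (cmodD _ _) _; rewrite !cmodM.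
have gt : cmod (g t) <= cmod (g s) + k.
  by rewrite -[g t](subrK (g s)); apply: le_trans (cmodD _ _) _; rewrite addrC lerD2l ltW.
have p0 := cmod_ge0 (f s); have q0 := cmod_ge0 (g s).
have u0 := cmod_ge0 (f t - f s); have v0 := cmod_ge0 (g t - g s).
have g0 := cmod_ge0 (g t).
have h1 : cmod (f t - f s) * cmod (g t) <= k * (cmod (g s) + k).
  by apply: ler_pM => //; exact: ltW.
have h2 : cmod (f s) * cmod (g t - g s) <= cmod (f s) * k.
  by apply: ler_wpM2l => //; exact: ltW.
apply: le_lt_trans (lerD h1 h2) _.
apply: lt_le_trans kA.
have : k * (cmod (g s) + k) + cmod (f s) * k < k * (A + A); last by [].
rewrite [cmod (f s) * k]mulrC -mulrDr ltr_pM2l// /A; lra.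
Qed.

Lemma ccontZ (c : C) f a b : ccont f a b -> ccont (fun s => c * f s) a b.
Proof. by move=> cf; apply: ccontM => //; exact: ccont_cst. Qed.

Lemma ccontN f a b : ccont f a b -> ccont (fun s => - f s) a b.
Proof.
by move=> /(ccontZ (-1)); apply: eq_ccont => s _; rewrite mulN1r.
Qed.

Lemma ccontB f g a b : ccont f a b -> ccont g a b -> ccont (fun s => f s - g s) a b.
Proof. by move=> cf /ccontN cg; exact: ccontD. Qed.

Lemma ccont_affine (p q : C) a b : ccont (fun s => p + toC s * q) a b.
Proof.
apply: ccontD; first exact: ccont_cst.
by apply: ccontM; [exact: ccont_toC|exact: ccont_cst].
Qed.

Lemma ccont_comp (F : C -> C) f a b : ccont f a b ->
  (forall s, a <= s <= b -> {for f s, continuous F}) -> ccont (F \o f) a b.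
Proof.
move=> cf cF s sab e e0.
have : \forall z \near f s, cmod (F z - F (f s)) < e.
  have /cvgrPdist_lt /(_ (toC e)) := cF s sab.
  rewrite -{1}toC0 lt_toC => /(_ e0); apply: filterS => z.
  by rewrite normCE lt_toC cmodB.
move=> /nearC[d d0 h]; have [d' d'0 h'] := cf s sab d d0.
by exists d' => // t tab ts; apply: h; exact: h'.
Qed.

Lemma eq_cint f g a b : (forall s, a <= s <= b -> f s = g s) -> cint f a b = cint g a b.
Proof.
move=> fg; rewrite /cint; congr mkC; apply: eq_Rintegral => x;
  by rewrite inE /= in_itv/= => /fg ->.
Qed.

Lemma cintD f g a b : ccont f a b -> ccont g a b ->
  cint (fun s => f s + g s) a b = cint f a b + cint g a b.
Proof.
move=> cf cg; apply: ReIm_ext; rewrite ?cReD ?cImD /=.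
  under eq_Rintegral do rewrite cReD.
  by rewrite RintegralD//; exact: integrable_Re.
under eq_Rintegral do rewrite cImD.
by rewrite RintegralD//; exact: integrable_Im.
Qed.

Lemma cintZ (c : C) f a b : ccont f a b ->
  cint (fun s => c * f s) a b = c * cint f a b.
Proof.
move=> cf.
have iR := integrable_Re cf; have iI := integrable_Im cf.
have iZ (g : R -> R) k : mu.-integrable `[a, b] (EFin \o g) ->
    mu.-integrable `[a, b] (EFin \o (fun x => k * g x)).
  move=> ig; have := @integrableZl _ _ _ mu _ (measurable_itv `[a, b]) k _ ig.
  by apply: eq_integrable => // x _ /=; rewrite EFinM.
apply: ReIm_ext; rewrite ?cReM ?cImM /=.
  under eq_Rintegral do rewrite cReM.
  by rewrite RintegralB ?RintegralZl//; exact: iZ.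
under eq_Rintegral do rewrite cImM.
by rewrite RintegralD ?RintegralZl//; exact: iZ.
Qed.

Lemma cintN f a b : ccont f a b -> cint (fun s => - f s) a b = - cint f a b.
Proof.
move=> cf; rewrite -mulN1r -cintZ//; apply: eq_cint => s _; by rewrite mulN1r.
Qed.

Lemma cintB f g a b : ccont f a b -> ccont g a b ->
  cint (fun s => f s - g s) a b = cint f a b - cint g a b.
Proof. by move=> cf cg; rewrite cintD ?cintN//; exact: ccontN. Qed.

Lemma cint_split f a b c : a <= c <= b -> ccont f a b ->
  cint f a b = cint f a c + cint f c b.
Proof.
move=> /andP[ac cb] cf.
have H (g : R -> R) : mu.-integrable `[a, b] (EFin \o g) ->
    Rintegral mu `[a, b] g = Rintegral mu `[a, c] g + Rintegral mu `[c, b] g.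
  move=> ig; have := @Rintegral_itvB _ g (BLeft a) (BRight b) c ig.
  rewrite !bnd_simp => /(_ ac cb) /eqP; rewrite subr_eq addrC => /eqP ->.
  congr (_ + _); rewrite Rintegral_itv_obnd_cbnd//.
  by apply: integrableS ig => //; apply: subset_itvr; rewrite bnd_simp.
by apply: ReIm_ext; rewrite ?cReD ?cImD /= -H//; [exact: integrable_Re|exact: integrable_Im].
Qed.

(** The fundamental theorem of calculus with primitive [F]. Affine integrands serve as local
    linearisations in Goursat's theorem and, with slope 0, as constant bounds. *)
Lemma Rintegral_affine (p q : R) a b : a <= b ->
  Rintegral mu `[a, b] (fun s => p + s * q) = p * (b - a) + q * (b ^+ 2 - a ^+ 2) / 2.
Proof.
rewrite le_eqVlt => /predU1P[<-|ab].
  by rewrite set_itv1 Rintegral_set1; ring.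
pose F (s : R) : R := p * s + q / 2 * s ^+ 2.
have dF (x : R) : is_derive x 1 F (p + x * q).
  rewrite /F; apply: is_derive_eq; rewrite /GRing.scale /=.
  by field.
rewrite /Rintegral (@continuous_FTC2 _ _ F)//=.
- by rewrite /F; field.
- apply: continuous_subspaceT => x.
  apply: (@cvgD _ _ _ _ _ (cst p) (fun s => s * q)); first exact: cvg_cst.
  by apply: (@cvgM _ _ _ _ id (cst q)); [exact: cvg_id|exact: cvg_cst].
- have cF : continuous F.
    move=> x; apply: differentiable_continuous; apply/derivable1_diffP.
    by have [] := dF x.
  split; first by move=> x _; have [] := dF x.
    by apply: cvg_at_right_filter; exact: cF.
  by apply: cvg_at_left_filter; exact: cF.
- by move=> x _; rewrite derive1E; have [_ ->] := dF x.
Qed.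

(** The factor 2 comes from bounding the real and the imaginary part separately. *)
Lemma cint_bound f a b (B : R) : a <= b -> ccont f a b ->
  (forall s, a <= s <= b -> cmod (f s) <= B) -> cmod (cint f a b) <= 2 * (B * (b - a)).
Proof.
move=> ab cf fB.
have H (g : R -> R) : mu.-integrable `[a, b] (EFin \o g) ->
    (forall s, a <= s <= b -> `|g s| <= B) -> `|Rintegral mu `[a, b] g| <= B * (b - a).
  move=> ig gB; apply: (@le_trans _ _ (Rintegral mu `[a, b] (fun x => `|g x|))).
    exact: le_normr_Rintegral.
  have : Rintegral mu `[a, b] (fun x => `|g x|) <= Rintegral mu `[a, b] (cst B).
    apply: le_Rintegral => //.
    - exact: integrable_norm.
    - apply: continuous_compact_integrable; first exact: segment_compact.
      by apply: continuous_subspaceT => x; exact: cvg_cst.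
  move=> /le_trans; apply; have := Rintegral_affine B 0 ab.
  rewrite mul0r mul0r addr0 => <-.
  by rewrite le_eqVlt; apply/orP; left; apply/eqP; apply: eq_Rintegral => x _; rewrite mulr0 addr0.
apply: le_trans (cmod_le_ReIm _) _; rewrite mulr_natl mulr2n lerD//=.
  apply: H; first exact: integrable_Re.
  by move=> s /fB; apply: le_trans; exact: cRe_le.
apply: H; first exact: integrable_Im.
by move=> s /fB; apply: le_trans; exact: cIm_le.
Qed.

(** Serves to show that the integral of 1/z around a square is not zero. *)
Lemma cint_Im_ge f a b (B : R) : a <= b -> ccont f a b ->
  (forall s, a <= s <= b -> B <= cIm (f s)) -> B * (b - a) <= cIm (cint f a b).
Proof.
move=> ab cf fB; rewrite /cint cIm_mk; have := Rintegral_affine B 0 ab.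
rewrite mul0r mul0r addr0 => <-.
have -> : Rintegral mu `[a, b] (fun s => B + s * 0) = Rintegral mu `[a, b] (cst B).
  by apply: eq_Rintegral => x _; rewrite mulr0 addr0.
apply: le_Rintegral => //.
- apply: continuous_compact_integrable; first exact: segment_compact.
  by apply: continuous_subspaceT => x; exact: cvg_cst.
- exact: integrable_Im.
Qed.

Lemma cint_affine (p q : C) a b : a <= b ->
  cint (fun s => p + toC s * q) a b =
  p * toC (b - a) + q * toC ((b ^+ 2 - a ^+ 2) / 2).
Proof.
move=> ab; apply: ReIm_ext; rewrite ?cReD ?cImD ?cReM ?cImM /= !(mulr0, subr0, add0r, addr0).
  under eq_Rintegral do rewrite cReD cReM /= mul0r subr0.
  by rewrite Rintegral_affine// mulrA.
under eq_Rintegral do rewrite cImD cImM /= mul0r addr0.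
by rewrite Rintegral_affine// mulrA.
Qed.

End Cint.

Arguments cint {R} f a b : simpl never.
Global Opaque cint.

(** * Real-valued norms and epsilon-delta forms of complex differentiability *)

Section VectorNorm.
Variable R : realType.
Local Notation C := (Cplx R).
Variable V : normedModType C.
Implicit Types v w : V.

Definition vmod v : R := cRe (`|v| : C).

Lemma normVE v : `|v| = toC (vmod v).
Proof.
have : (0 : C) <= `|v| by exact: normr_ge0.
by move=> /ger0_real/complex_realP[x]; rewrite -[(x%:C)%C]/(toC x) /vmod => ->.
Qed.

Lemma vmod_ge0 v : 0 <= vmod v.
Proof. by rewrite -le_toC -normVE normr_ge0. Qed.

Lemma vmodN v : vmod (- v) = vmod v.
Proof. by rewrite /vmod normrN. Qed.

Lemma vmodZ (c : C) v : vmod (c *: v) = cmod c * vmod v.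
Proof. by apply: toC_inj; rewrite toCM -normCE -!normVE normrZ. Qed.

Lemma vmod0 : vmod 0 = 0.
Proof. by rewrite /vmod normr0. Qed.

Lemma vmod_eq0 v : (vmod v == 0) = (v == 0).
Proof. by rewrite -(inj_eq (@toC_inj R)) -normVE normr_eq0. Qed.

Lemma nearV (P : set V) v :
  (\forall w \near v, P w) <-> exists2 d : R, 0 < d & forall w, vmod (w - v) < d -> P w.
Proof.
split=> [/nbhs_ballP[e /= e0 h]|[d d0 h]].
  have e0' := e0; rewrite lt_def in e0'; case/andP: e0' => _ /ger0_real.
  case/complex_realP => x; rewrite -[(x%:C)%C]/(toC x) => ex; exists x.
    by move: e0; rewrite ex -toC0 lt_toC.
  move=> w wz; apply: h; rewrite -ball_normE /ball_ /= normVE -vmodN opprB ex.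
  by rewrite lt_toC.
apply/nbhs_ballP; exists (toC d); first by rewrite /= -toC0 lt_toC.
by move=> w; rewrite -ball_normE /ball_ /= normVE lt_toC -vmodN opprB => /h.
Qed.

Lemma contVP (f : V -> C) v : {for v, continuous f} <->
  forall e : R, 0 < e -> exists2 d : R, 0 < d &
  forall w, vmod (w - v) < d -> cmod (f w - f v) < e.
Proof.
split=> [/cvgrPdist_lt cf e e0|h].
  apply/nearV; have := cf (toC e); rewrite -{1}toC0 lt_toC => /(_ e0).
  by apply: filterS => w; rewrite normCE lt_toC cmodB.
apply/cvgrPdist_lt => e e0.
have e0' := e0; rewrite lt_def in e0'; case/andP: e0' => _ /ger0_real.
case/complex_realP => x; rewrite -[(x%:C)%C]/(toC x) => ex.
have x0 : 0 < x by move: e0; rewrite ex -toC0 lt_toC.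
have /nearV := h x x0; apply: filterS => w.
by rewrite normCE ex lt_toC cmodB.
Qed.

Lemma diffV_eps (f : V -> C) v : differentiable f v -> forall e : R, 0 < e ->
  exists2 d : R, 0 < d & forall w, vmod w < d ->
  cmod (f (v + w) - f v - 'd f v w) <= e * vmod w.
Proof.
move=> /diff_locallyP[_ h] e e0.
have /eqaddoP /(_ (toC e)) := h.
rewrite -{1}toC0 lt_toC => /(_ e0) /nearV[d d0 H]; exists d => // w wd.
have := H w; rewrite subr0 => /(_ wd) /=.
rewrite normVE normCE -toCM le_toC.
rewrite -[(f \o shift v - (cst (f v) + 'd f v)) w]/(f (w + v) - (f v + 'd f v w)).
by rewrite opprD addrA [w + v]addrC.
Qed.

(** Converse of [diffV_eps]: the explicit bound [K] makes [L] continuous, and a continuous linear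
    map with a little-o error is the differential. *)
Lemma diffV_of (f : V -> C) v (L : {linear V -> C}) (K : R) :
  (forall w, cmod (L w) <= K * vmod w) ->
  (forall e : R, 0 < e -> exists2 d : R, 0 < d & forall w, vmod w < d ->
    cmod (f (v + w) - f v - L w) <= e * vmod w) -> differentiable f v.
Proof.
move=> LK h.
have cL : continuous L.
  move=> x; apply/contVP => e e0.
  have K0 : 0 < `|K| + 1 by rewrite ltr_wpDl.
  exists (e / (`|K| + 1)); first by rewrite divr_gt0.
  move=> w; rewrite ltr_pdivlMr// mulrC => we.
  rewrite -linearB; apply: le_lt_trans (LK _) _; apply: le_lt_trans we.
  apply: ler_wpM2r; first exact: vmod_ge0.
  by apply: le_trans (ler_norm _) _; rewrite lerDl.
apply/diff_locallyP.
have E : f \o shift v = cst (f v) + L +o_ (0 : V) id.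
  apply/eqaddoP => e e0.
  have e0' := e0; rewrite lt_def in e0'; case/andP: e0' => _ /ger0_real.
  case/complex_realP => x; rewrite -[(x%:C)%C]/(toC x) => ex.
  have x0 : 0 < x by move: e0; rewrite ex -toC0 lt_toC.
  have [d d0 H] := h x x0; apply/nearV; exists d => // w; rewrite subr0 => /H.
  rewrite normVE normCE ex -toCM le_toC.
  rewrite -[(f \o shift v - (cst (f v) + L)) w]/(f (w + v) - (f v + L w)).
  by rewrite opprD addrA [w + v]addrC.
by have dL := diff_unique cL E; rewrite dL.
Qed.

End VectorNorm.

Arguments vmod {R V} v : simpl never.
Global Opaque vmod.

Section PointwiseDiff.
Variable R : realType.
Local Notation C := (Cplx R).
Variable V : normedModType C.
Implicit Types (f g : V -> C) (v : V).

Lemma dcst (c : C) v : differentiable (fun _ : V => c) v.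
Proof. exact: (differentiable_cst c v). Qed.

Lemma dD f g v : differentiable f v -> differentiable g v ->
  differentiable (fun x => f x + g x) v.
Proof. exact: differentiableD. Qed.

Lemma dB f g v : differentiable f v -> differentiable g v ->
  differentiable (fun x => f x - g x) v.
Proof. exact: differentiableB. Qed.

Lemma dN f v : differentiable f v -> differentiable (fun x => - f x) v.
Proof. exact: differentiableN. Qed.

Lemma dM f g v : differentiable f v -> differentiable g v ->
  differentiable (fun x => f x * g x) v.
Proof. exact: differentiableM. Qed.

Lemma dV f v : f v != 0 -> differentiable f v -> differentiable (fun x => (f x)^-1) v.
Proof. by move=> fv df; exact: differentiableV. Qed.

Lemma dX f n v : differentiable f v -> differentiable (fun x => f x ^+ n) v.
Proof.
move=> df; elim: n => [|n IH]; first exact: dcst.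
rewrite (_ : (fun _ => _) = (fun x => f x * f x ^+ n)); first exact: dM.
by apply/funext => x; rewrite exprS.
Qed.

Lemma dcomp (F : C -> C) f v : differentiable f v -> differentiable F (f v) ->
  differentiable (fun x => F (f x)) v.
Proof. by move=> df dF; exact: (differentiable_comp df dF). Qed.

End PointwiseDiff.

Section PointwiseDiffC.
Variable R : realType.
Local Notation C := (Cplx R).

Lemma did (z : C) : differentiable (fun w : C => w) z.
Proof. exact: ex_diff. Qed.

Lemma daffine (p q z : C) : differentiable (fun w : C => p + q * w) z.
Proof. by apply: dD; [exact: dcst|apply: dM; [exact: dcst|exact: did]]. Qed.

Lemma vmodCE (z : C) : vmod z = cmod z.
Proof. by apply: (@toC_inj R); rewrite -normVE normCE. Qed.

Lemma diffC_eps (f : C -> C) a : differentiable f a -> forall e : R, 0 < e ->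
  exists2 d : R, 0 < d & forall z, cmod (z - a) < d ->
  cmod (f z - f a - (z - a) * 'd f a 1) <= e * cmod (z - a).
Proof.
move=> /diffV_eps h e /h[d d0 H]; exists d => // z; rewrite -vmodCE => /H.
rewrite subrKC; have -> : 'd f a (z - a) = (z - a) * 'd f a 1; last by [].
by rewrite -[in LHS](mulr1 (z - a)) -[(z - a) * 1]/((z - a) *: (1 : C)) linearZ.
Qed.

Lemma dquot (f : C -> C) (a z : C) : z != a -> differentiable f z ->
  differentiable (fun w : C => f w / (w - a)) z.
Proof.
move=> za df; apply: dM => //; apply: (@dV _ _ (fun w => w - a)); first by rewrite subr_eq0.
by apply: dB; [exact: did|exact: dcst].
Qed.

End PointwiseDiffC.

(** * Goursat's theorem and Cauchy's formula *)

Section Goursat.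
Variable R : realType.
Local Notation C := (Cplx R).
Variables a b d : C.
Implicit Types (f g : C -> C) (s t : R).

(** Polar-like coordinates about [a]: fixed [t] gives a segment parallel to [d], fixed [s] a segment
    on a line through [a]. Four such sectors join a square to its homothetic image with centre [a],
    so Goursat's theorem in the parameters compares the two contours directly. *)
Definition sect t s : C := a + toC t * (b + toC s * d).

Definition hedge f t s0 s1 := cint (fun s => f (sect t s) * (toC t * d)) s0 s1.
Definition vedge f s t0 t1 := cint (fun t => f (sect t s) * (b + toC s * d)) t0 t1.
Definition rect_int f t0 t1 s0 s1 :=
  hedge f t1 s0 s1 - hedge f t0 s0 s1 - vedge f s1 t0 t1 + vedge f s0 t0 t1.

Definition rect_cont f t0 t1 s0 s1 := forall t s,
  t0 <= t <= t1 -> s0 <= s <= s1 -> {for sect t s, continuous f}.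

Lemma ccont_sect_s t s0 s1 : ccont (fun s => sect t s) s0 s1.
Proof.
refine (eq_ccont _ (@ccont_affine _ (a + toC t * b) (toC t * d) _ _)) => s _.
by rewrite /sect; ring.
Qed.

Lemma ccont_sect_t s t0 t1 : ccont (fun t => sect t s) t0 t1.
Proof. by refine (eq_ccont _ (@ccont_affine _ a (b + toC s * d) _ _)). Qed.

Lemma hedge_ccont f t s0 s1 :
  (forall s, s0 <= s <= s1 -> {for sect t s, continuous f}) ->
  ccont (fun s => f (sect t s) * (toC t * d)) s0 s1.
Proof.
move=> cf; apply: ccontM; last exact: ccont_cst.
by apply: (@ccont_comp _ f); first exact: ccont_sect_s.
Qed.

Lemma vedge_ccont f s t0 t1 :
  (forall t, t0 <= t <= t1 -> {for sect t s, continuous f}) ->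
  ccont (fun t => f (sect t s) * (b + toC s * d)) t0 t1.
Proof.
move=> cf; apply: ccontM; last exact: ccont_cst.
by apply: (@ccont_comp _ f); first exact: ccont_sect_t.
Qed.

Lemma rect_intB f g t0 t1 s0 s1 : t0 <= t1 -> s0 <= s1 ->
  rect_cont f t0 t1 s0 s1 -> rect_cont g t0 t1 s0 s1 ->
  rect_int (fun z => f z - g z) t0 t1 s0 s1 =
  rect_int f t0 t1 s0 s1 - rect_int g t0 t1 s0 s1.
Proof.
move=> t01 s01 cf cg.
have t0I : t0 <= t0 <= t1 by rewrite lexx.
have t1I : t0 <= t1 <= t1 by rewrite lexx andbT.
have s0I : s0 <= s0 <= s1 by rewrite lexx.
have s1I : s0 <= s1 <= s1 by rewrite lexx andbT.
have H t : t0 <= t <= t1 ->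
    hedge (fun z => f z - g z) t s0 s1 = hedge f t s0 s1 - hedge g t s0 s1.
  move=> tI; rewrite /hedge -cintB; first by apply: eq_cint => s _; ring.
    by apply: hedge_ccont => s; exact: cf.
  by apply: hedge_ccont => s; exact: cg.
have W s : s0 <= s <= s1 ->
    vedge (fun z => f z - g z) s t0 t1 = vedge f s t0 t1 - vedge g s t0 t1.
  move=> sI; rewrite /vedge -cintB; first by apply: eq_cint => t _; ring.
    by apply: vedge_ccont => t tI; exact: cf.
  by apply: vedge_ccont => t tI; exact: cg.
rewrite /rect_int !H// !W//.
move: (hedge f t1 s0 s1) (hedge f t0 s0 s1) (hedge g t1 s0 s1) (hedge g t0 s0 s1).
move: (vedge f s1 t0 t1) (vedge f s0 t0 t1) (vedge g s1 t0 t1) (vedge g s0 t0 t1).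
by move=> *; ring.
Qed.

Lemma rect_int_split_t f t0 tm t1 s0 s1 : t0 <= tm <= t1 -> s0 <= s1 ->
  rect_cont f t0 t1 s0 s1 ->
  rect_int f t0 t1 s0 s1 = rect_int f t0 tm s0 s1 + rect_int f tm t1 s0 s1.
Proof.
move=> tm01 s01 cf; rewrite /rect_int.
have W s : s0 <= s <= s1 -> vedge f s t0 t1 = vedge f s t0 tm + vedge f s tm t1.
  move=> sI; rewrite {1}/vedge (cint_split tm01)//.
  by apply: vedge_ccont => t tI; exact: cf.
rewrite !W ?lexx ?s01//.
move: (hedge f t1 s0 s1) (hedge f t0 s0 s1) (hedge f tm s0 s1).
move: (vedge f s1 t0 tm) (vedge f s1 tm t1) (vedge f s0 t0 tm) (vedge f s0 tm t1).
by move=> *; ring.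
Qed.

Lemma rect_int_split_s f t0 t1 s0 sm s1 : s0 <= sm <= s1 -> t0 <= t1 ->
  rect_cont f t0 t1 s0 s1 ->
  rect_int f t0 t1 s0 s1 = rect_int f t0 t1 s0 sm + rect_int f t0 t1 sm s1.
Proof.
move=> sm01 t01 cf; rewrite /rect_int.
have H t : t0 <= t <= t1 -> hedge f t s0 s1 = hedge f t s0 sm + hedge f t sm s1.
  move=> tI; rewrite {1}/hedge (cint_split sm01)//.
  by apply: hedge_ccont => s sI; exact: cf.
rewrite !H ?lexx ?t01//.
move: (hedge f t1 s0 sm) (hedge f t0 s0 sm) (hedge f t1 sm s1) (hedge f t0 sm s1).
move: (vedge f s1 t0 t1) (vedge f sm t0 t1) (vedge f s0 t0 t1).
by move=> *; ring.
Qed.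

(** The primitive [P] turns each edge into a difference of endpoint values, and these cancel around
    the contour. *)
Lemma rect_int_affine (p q : C) t0 t1 s0 s1 : t0 <= t1 -> s0 <= s1 ->
  rect_int (fun z => p + q * z) t0 t1 s0 s1 = 0.
Proof.
move=> t01 s01.
pose P (z : C) := p * z + q * z ^+ 2 / 2.
have two0 : (2 : C) != 0 by rewrite pnatr_eq0.
have H t : hedge (fun z => p + q * z) t s0 s1 = P (sect t s1) - P (sect t s0).
  rewrite /hedge (@eq_cint _ _ (fun s => (p + q * (a + toC t * b)) * (toC t * d) +
     toC s * (q * (toC t * d) ^+ 2))); last by move=> s _; rewrite /sect; ring.
  by rewrite cint_affine// toCM toCV !toCB !toCX toC_nat /P /sect; field.
have W s : vedge (fun z => p + q * z) s t0 t1 = P (sect t1 s) - P (sect t0 s).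
  rewrite /vedge (@eq_cint _ _ (fun t => (p + q * a) * (b + toC s * d) +
     toC t * (q * (b + toC s * d) ^+ 2))); last by move=> t _; rewrite /sect; ring.
  by rewrite cint_affine// toCM toCV !toCB !toCX toC_nat /P /sect; field.
by rewrite /rect_int !H !W; ring.
Qed.

Lemma sect_dist t s t' s' (A D : R) :
  cmod (b + toC s * d) <= A -> cmod (toC t' * d) <= D ->
  cmod (sect t s - sect t' s') <= A * `|t - t'| + D * `|s - s'|.
Proof.
move=> hA hD.
have -> : sect t s - sect t' s' =
    (b + toC s * d) * toC (t - t') + (toC t' * d) * toC (s - s').
  by rewrite /sect !toCB; ring.
apply: le_trans (cmodD _ _) _; rewrite !cmodM !cmod_toC.
rewrite cmodM cmod_toC in hD.
by apply: lerD; apply: ler_wpM2r.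
Qed.

Lemma cmod_alt4 (x y z w : C) : cmod (x - y - z + w) <= cmod x + cmod y + cmod z + cmod w.
Proof.
apply: le_trans (cmodD _ _) _; rewrite lerD2r -(cmodN z).
apply: le_trans (cmodD _ _) _; rewrite lerD2r -(cmodN y); exact: cmodD.
Qed.

Lemma rect_int_bound f t0 t1 s0 s1 (A D B : R) : t0 <= t1 -> s0 <= s1 -> 0 <= B ->
  rect_cont f t0 t1 s0 s1 ->
  (forall s, s0 <= s <= s1 -> cmod (b + toC s * d) <= A) ->
  (forall t, t0 <= t <= t1 -> cmod (toC t * d) <= D) ->
  (forall t s, t0 <= t <= t1 -> s0 <= s <= s1 -> cmod (f (sect t s)) <= B) ->
  cmod (rect_int f t0 t1 s0 s1) <= 4 * B * (D * (s1 - s0) + A * (t1 - t0)).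
Proof.
move=> t01 s01 B0 cf hA hD hB.
have H t : t0 <= t <= t1 -> cmod (hedge f t s0 s1) <= 2 * (B * D * (s1 - s0)).
  move=> tI; apply: cint_bound => //; first by apply: hedge_ccont => s; exact: cf.
  by move=> s sI; rewrite cmodM ler_pM ?cmod_ge0 ?hB ?hD.
have W s : s0 <= s <= s1 -> cmod (vedge f s t0 t1) <= 2 * (B * A * (t1 - t0)).
  move=> sI; apply: cint_bound => //; first by apply: vedge_ccont => t tI; exact: cf.
  by move=> t tI; rewrite cmodM ler_pM ?cmod_ge0 ?hB ?hA.
rewrite /rect_int.
have t0I : t0 <= t0 <= t1 by rewrite lexx.
have t1I : t0 <= t1 <= t1 by rewrite lexx andbT.
have s0I : s0 <= s0 <= s1 by rewrite lexx.
have s1I : s0 <= s1 <= s1 by rewrite lexx andbT.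
have h1 := H _ t0I; have h2 := H _ t1I; have h3 := W _ s0I; have h4 := W _ s1I.
apply: le_trans (cmod_alt4 _ _ _ _) _.
apply: le_trans (lerD (lerD (lerD h2 h1) h4) h3) _.
by apply/eq_ler; ring.
Qed.

Lemma continuous_affine (p q : C) : continuous (fun z : C => p + q * z).
Proof.
by move=> z; exact: (differentiable_continuous (daffine p q z)).
Qed.

Definition half_pow n : R := (1 / 2) ^+ n.

Lemma half_powS n : half_pow n.+1 = half_pow n / 2.
Proof. by rewrite /half_pow exprS; field. Qed.

Lemma half_pow_gt0 n : 0 < half_pow n.
Proof. by rewrite exprn_gt0// divr_gt0. Qed.

Lemma half_pow_small (e : R) : 0 < e -> exists n, half_pow n < e.
Proof.
move=> e0; have [n hn] : exists n, e^-1 < n%:R.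
  by exists (Num.truncn e^-1).+1; rewrite truncnS_gt.
exists n; rewrite /half_pow div1r exprVn -[e]invrK ltf_pV2 ?posrE ?invr_gt0 ?exprn_gt0//.
by apply: lt_trans hn _; rewrite -natrX ltr_nat ltn_expl.
Qed.

Lemma cmod_quarter (A1 A2 A3 A4 : C) k : 4 * k <= cmod (A1 + A2 + (A3 + A4)) ->
  k <= cmod A1 \/ k <= cmod A2 \/ k <= cmod A3 \/ k <= cmod A4.
Proof.
have := cmodD (A1 + A2) (A3 + A4); have := cmodD A1 A2; have := cmodD A3 A4.
move: (cmod (A1 + A2 + _)) (cmod (A1 + A2)) (cmod (A3 + A4)) => x y z.
move: (cmod A1) (cmod A2) (cmod A3) (cmod A4) => x1 x2 x3 x4 h1 h2 h3 h4.
have [?|k1] := leP k x1; first by left.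
have [?|k2] := leP k x2; first by right; left.
have [?|k3] := leP k x3; first by right; right; left.
by right; right; right; lra.
Qed.

(** The integral is additive under both subdivisions, so the pigeonhole principle selects a
    quarter. *)
Lemma rect_quarter f t s L M k : 0 <= L -> 0 <= M ->
  rect_cont f t (t + L + L) s (s + M + M) ->
  4 * k <= cmod (rect_int f t (t + L + L) s (s + M + M)) ->
  exists u v, [/\ u = t \/ u = t + L, v = s \/ v = s + M &
    k <= cmod (rect_int f u (u + L) v (v + M))].
Proof.
move=> L0 M0 cf.
have tL : t <= t + L by rewrite lerDl.
have tLL : t + L <= t + L + L by rewrite lerDl.
have sM : s <= s + M by rewrite lerDl.
have sMM : s + M <= s + M + M by rewrite lerDl.
have cf1 : rect_cont f t (t + L) s (s + M + M).
  by move=> u v /andP[u1 u2] vI; apply: cf => //; rewrite u1 (le_trans u2).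
have cf2 : rect_cont f (t + L) (t + L + L) s (s + M + M).
  by move=> u v /andP[u1 u2] vI; apply: cf => //; rewrite u2 (le_trans tL).
rewrite (@rect_int_split_t _ _ (t + L)) ?tL ?(le_trans sM)//.
rewrite (@rect_int_split_s _ t _ _ (s + M)) ?sM//.
rewrite (@rect_int_split_s _ (t + L) _ _ (s + M)) ?sM//.
case/cmod_quarter => [h|[h|[h|h]]].
- by exists t, s; split => //; left.
- by exists t, (s + M); split => //; [left|right].
- by exists (t + L), s; split => //; [right|left].
- by exists (t + L), (s + M); split => //; right.
Qed.

(** Bisection of the parameter rectangle. If the integral had modulus [eta] > 0, nested
    subrectangles would keep at least [eta] 4^-n. Near their common point [f] is affine up to a
    small error, and the affine part integrates to 0, which leaves an upper bound with a smaller
    constant. *)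
Lemma goursat f T0 T1 S0 S1 : T0 <= T1 -> S0 <= S1 ->
  (forall t s, T0 <= t <= T1 -> S0 <= s <= S1 -> differentiable f (sect t s)) ->
  rect_int f T0 T1 S0 S1 = 0.
Proof.
move=> T01 S01 df; apply/eqP/negPn/negP; rewrite -cmod_gt0.
set eta := cmod _ => eta0.
have cf : rect_cont f T0 T1 S0 S1.
  by move=> t s tI sI; apply: differentiable_continuous; exact: df.
pose LT n := (T1 - T0) * half_pow n; pose LS n := (S1 - S0) * half_pow n.
have LT0 n : 0 <= LT n by rewrite mulr_ge0 ?subr_ge0// ltW ?half_pow_gt0.
have LS0 n : 0 <= LS n by rewrite mulr_ge0 ?subr_ge0// ltW ?half_pow_gt0.
have LTS n : LT n = LT n.+1 + LT n.+1 by rewrite /LT half_powS; field.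
have LSS n : LS n = LS n.+1 + LS n.+1 by rewrite /LS half_powS; field.
(* [q] is the lower corner of a subrectangle of level [n]; [half_pow n ^+ 2] is 4^-n. *)
pose good n (q : R * R) := [/\ T0 <= q.1, q.1 + LT n <= T1, S0 <= q.2, q.2 + LS n <= S1 &
  eta * half_pow n ^+ 2 <= cmod (rect_int f q.1 (q.1 + LT n) q.2 (q.2 + LS n))].
(* The implication gives every pair a successor, so that choice yields a total function [F] that can
   be iterated from the initial corner. *)
pose nxt n (q q' : R * R) := good n q -> good n.+1 q' /\
  (q.1 <= q'.1 /\ q'.1 + LT n.+1 <= q.1 + LT n) /\
  (q.2 <= q'.2 /\ q'.2 + LS n.+1 <= q.2 + LS n).
have step n q : exists q', nxt n q q'.
  have [[h1 h2 h3 h4 h5]|ng] := pselect (good n q); last by exists q => /ng.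
  move: q h1 h2 h3 h4 h5 => [t s] /= h1 h2 h3 h4 h5.
  have lt0 := LT0 n.+1; have ls0 := LS0 n.+1; have lts := LTS n; have lss := LSS n.
  have ett : t + LT n = t + LT n.+1 + LT n.+1 by rewrite lts addrA.
  have ess : s + LS n = s + LS n.+1 + LS n.+1 by rewrite lss addrA.
  have cf' : rect_cont f t (t + LT n.+1 + LT n.+1) s (s + LS n.+1 + LS n.+1).
    rewrite -ett -ess => u v /andP[u1 u2] /andP[v1 v2]; apply: cf.
      by rewrite (le_trans h1 u1) (le_trans u2 h2).
    by rewrite (le_trans h3 v1) (le_trans v2 h4).
  have ek : eta * half_pow n ^+ 2 = 4 * (eta * half_pow n.+1 ^+ 2).
    by rewrite half_powS; field.
  have [u [v [hu hv hk]]] : exists u v, [/\ u = t \/ u = t + LT n.+1,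
      v = s \/ v = s + LS n.+1 & eta * half_pow n.+1 ^+ 2 <=
      cmod (rect_int f u (u + LT n.+1) v (v + LS n.+1))].
    by apply: (rect_quarter lt0 ls0 cf'); rewrite -ett -ess -ek.
  exists (u, v) => _; rewrite /good /=.
  have [t1 t2] : t <= u /\ u + LT n.+1 <= t + LT n.
    by rewrite ett; case: hu => ->; split; rewrite // ?lerD2r lerDl.
  have [s1 s2] : s <= v /\ v + LS n.+1 <= s + LS n.
    by rewrite ess; case: hv => ->; split; rewrite // ?lerD2r lerDl.
  split=> //; split => //.
  - exact: le_trans h1 t1.
  - exact: le_trans t2 h2.
  - exact: le_trans h3 s1.
  - exact: le_trans s2 h4.
have [F HF] := choice (fun p : nat * (R * R) => step p.1 p.2).
pose q := fix q n := if n is m.+1 then F (m, q m) else (T0, S0).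
have gq n : good n (q n).
  elim: n => [|n IH]; last exact: (HF (n, q n) IH).1.
  have E0 : half_pow 0 = 1 by rewrite /half_pow expr0.
  by rewrite /good /= /LT /LS E0 !mulr1 expr1n mulr1 !subrKC !lexx.
have nq n := HF (n, q n) (gq n).
have monot m n : (q m).1 <= (q (m + n)%N).1 /\ (q (m + n)%N).1 + LT (m + n)%N <= (q m).1 + LT m.
  elim: n => [|n [i1 i2]]; first by rewrite addn0.
  have [_ [[j1 j2] _]] := nq (m + n)%N; rewrite addnS; split.
    exact: le_trans i1 j1.
  exact: le_trans j2 i2.
have monos m n : (q m).2 <= (q (m + n)%N).2 /\ (q (m + n)%N).2 + LS (m + n)%N <= (q m).2 + LS m.
  elim: n => [|n [i1 i2]]; first by rewrite addn0.
  have [_ [_ [j1 j2]]] := nq (m + n)%N; rewrite addnS; split.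
    exact: le_trans i1 j1.
  exact: le_trans j2 i2.
(* Nested intervals: the supremum of the left ends lies in all of them. *)
have lim1 (u L : nat -> R) : (forall n, 0 <= L n) -> (forall m n, u m <= u (m + n)%N /\
    u (m + n)%N + L (m + n)%N <= u m + L m) -> exists x, forall n, u n <= x <= u n + L n.
  move=> L0 h.
  have ub m n : u m <= u n + L n.
    have [mn|/ltnW nm] := leqP m n.
      have := (h m (n - m)%N).1; rewrite subnKC// => /le_trans; apply.
      by rewrite lerDl.
    by have := (h n (m - n)%N).2; rewrite subnKC//; have := L0 m; lra.
  have hs : has_sup (range u).
    split; first by exists (u 0%N), 0%N.
    by exists (u 0%N + L 0%N) => _ [m _ <-].
  exists (sup (range u)) => n; apply/andP; split.
    by apply: sup_upper_bound => //; exists n.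
  by apply: ge_sup; [exact: hs.1|move=> _ [m _ <-]].
have [t ht] := lim1 (fun n => (q n).1) LT LT0 monot.
have [s hs] := lim1 (fun n => (q n).2) LS LS0 monos.
have tI : T0 <= t <= T1.
  have [h1 h2 _ _ _] := gq 0%N; have /andP[h3 h4] := ht 0%N.
  by rewrite (le_trans h1 h3) (le_trans h4 h2).
have sI : S0 <= s <= S1.
  have [_ _ h1 h2 _] := gq 0%N; have /andP[h3 h4] := hs 0%N.
  by rewrite (le_trans h1 h3) (le_trans h4 h2).
pose A := cmod b + (`|S0| + `|S1|) * cmod d; pose D := (`|T0| + `|T1|) * cmod d.
have absI x y0 y1 : y0 <= x <= y1 -> `|x| <= `|y0| + `|y1| :> R.
  move=> /andP[y0x xy1].
  have [x0|x0] := ger0P x.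
    have := ler_norm y1; have := normr_ge0 y0; lra.
  have := ler_norm (- y0); rewrite normrN; have := normr_ge0 y1; lra.
have hA s' : S0 <= s' <= S1 -> cmod (b + toC s' * d) <= A.
  move=> /absI h; apply: le_trans (cmodD _ _) _; rewrite lerD2l cmodM cmod_toC.
  by rewrite ler_wpM2r ?cmod_ge0.
have hD t' : T0 <= t' <= T1 -> cmod (toC t' * d) <= D.
  by move=> /absI h; rewrite cmodM cmod_toC ler_wpM2r ?cmod_ge0.
have A0 : 0 <= A by rewrite addr_ge0 ?cmod_ge0// mulr_ge0 ?cmod_ge0 ?addr_ge0.
have D0 : 0 <= D by rewrite mulr_ge0 ?cmod_ge0 ?addr_ge0.
pose K := D * (S1 - S0) + A * (T1 - T0).
have K0 : 0 <= K by rewrite addr_ge0// mulr_ge0 ?subr_ge0.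
(* The final upper bound is 4 e K^2 4^-n. Dividing by 8 (K^2 + 1) makes it smaller than [eta] 4^-n,
   also when [K] is 0. *)
pose e := eta / (8 * (K ^+ 2 + 1)).
have KK0 : 0 < K ^+ 2 + 1 by rewrite ltr_wpDl// sqr_ge0.
have e0 : 0 < e by rewrite divr_gt0// mulr_gt0.
have [dl dl0 hdl] := diffV_eps (df t s tI sI) e0.
have [n hn] : exists n, half_pow n < dl / (K + 1).
  by apply: half_pow_small; rewrite divr_gt0// ltr_wpDl.
have hn0 := half_pow_gt0 n.
have hKn : K * half_pow n < dl.
  move: hn; rewrite ltr_pdivlMr ?ltr_wpDl// mulrC => hn.
  by apply: le_lt_trans hn; rewrite ler_wpM2r ?ltW// ltrDl.
have [g1 g2 g3 g4 g5] := gq n.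
have htn := ht n; have hsn := hs n.
set tn := (q n).1 in g1 g2 g5 htn; set sn := (q n).2 in g3 g4 g5 hsn.
pose z := sect t s.
have near_z t' s' : tn <= t' <= tn + LT n -> sn <= s' <= sn + LS n ->
    cmod (sect t' s' - z) <= K * half_pow n.
  move=> t'I s'I.
  have t't : `|t' - t| <= LT n.
    by rewrite ler_norml; move: t'I htn; clear=> /andP[? ?] /andP[? ?]; apply/andP; split; lra.
  have s's : `|s' - s| <= LS n.
    by rewrite ler_norml; move: s'I hsn; clear=> /andP[? ?] /andP[? ?]; apply/andP; split; lra.
  have s'J : S0 <= s' <= S1 by clear -s'I g3 g4; move: s'I => /andP[? ?]; apply/andP; split; lra.
  apply: le_trans (sect_dist t' s (hA _ s'J) (hD _ tI)) _.
  have u1 : A * `|t' - t| <= A * LT n by rewrite ler_wpM2l.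
  have u2 : D * `|s' - s| <= D * LS n by rewrite ler_wpM2l.
  apply: le_trans (lerD u1 u2) _.
  by rewrite /K /LT /LS; apply/eq_ler; ring.
pose l := 'd f z 1.
have dfE w : 'd f z w = l * w.
  by rewrite /l -[in LHS](mulr1 w) -[w * 1]/(w *: (1 : C)) linearZ /= mulrC.
pose r (w : C) := f w - ((f z - l * z) + l * w).
have tn01 : tn <= tn + LT n by rewrite lerDl.
have sn01 : sn <= sn + LS n by rewrite lerDl.
have cfn : rect_cont f tn (tn + LT n) sn (sn + LS n).
  move=> u v /andP[u1 u2] /andP[v1 v2]; apply: cf; clear -u1 u2 v1 v2 g1 g2 g3 g4; apply/andP; split; lra.
have caff : rect_cont (fun w => (f z - l * z) + l * w) tn (tn + LT n) sn (sn + LS n).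
  by move=> u v _ _; exact: continuous_affine.
have Er : rect_int f tn (tn + LT n) sn (sn + LS n) = rect_int r tn (tn + LT n) sn (sn + LS n).
  by rewrite /r rect_intB// rect_int_affine// subr0.
have rB : cmod (rect_int r tn (tn + LT n) sn (sn + LS n)) <=
    4 * (e * (K * half_pow n)) * (D * (sn + LS n - sn) + A * (tn + LT n - tn)).
  apply: (rect_int_bound tn01 sn01).
  - apply: mulr_ge0; first exact: ltW.
    by apply: mulr_ge0; [exact: K0|exact: ltW].
  - move=> u v uI vI; exact: (cvgB (cfn u v uI vI) (caff u v uI vI)).
  - by move=> v /andP[v1 v2]; apply: hA; clear -v1 v2 g3 g4; apply/andP; split; lra.
  - by move=> u /andP[u1 u2]; apply: hD; clear -u1 u2 g1 g2; apply/andP; split; lra.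
  - move=> u v uI vI; have hz := near_z u v uI vI.
    move: hz; move: (sect u v) => w hz.
    have := hdl (w - z) (le_lt_trans hz hKn).
    rewrite subrKC dfE => h.
    have -> : r w = f w - f z - l * (w - z) by rewrite /r; ring.
    by apply: le_trans h _; apply: ler_wpM2l; [exact: ltW|exact: hz].
move: g5; rewrite Er => /le_trans /(_ rB).
have -> : 4 * (e * (K * half_pow n)) * (D * (sn + LS n - sn) + A * (tn + LT n - tn)) =
    (4 * e * K ^+ 2) * half_pow n ^+ 2 by rewrite /LS /LT /K; ring.
rewrite ler_pM2r ?exprn_gt0//; apply/negP; rewrite -ltNge.
have -> : eta = 8 * (K ^+ 2 + 1) * e by rewrite /e; field; rewrite gt_eqF.
have := sqr_ge0 K; set k2 := K ^+ 2 => k20.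
have -> : 4 * e * k2 = e * (4 * k2) by ring.
rewrite [ltRHS]mulrC ltr_pM2l//; lra.
Qed.

End Goursat.

(** * Contour integrals over squares and Cauchy's formula *)

Section Loop.
Variable R : realType.
Local Notation C := (Cplx R).
Implicit Types (f g : C -> C) (r s t : R) (k : nat).

Definition imI : C := mkC 0 1.

Lemma imI2 : imI ^+ 2 = -1.
Proof. exact: sqr_i. Qed.

Lemma imI4 : imI ^+ 4 = 1.
Proof. by rewrite (exprM imI 2 2) imI2 expr2 mulNr mul1r opprK. Qed.

Lemma cmod_imI : cmod imI = 1.
Proof.
apply/eqP; rewrite -(@eqrXn2 _ 2)// ?cmod_ge0// cmod_sqr /cRe /cIm /=.
by rewrite expr0n add0r.
Qed.

Lemma cmod_imIX k : cmod (imI ^+ k) = 1.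
Proof. by rewrite cmodX cmod_imI expr1n. Qed.

(* The sides of the square with vertices 1+i, -1+i, -1-i, 1-i; side [k] is the
   [k]-th quarter turn of the right one. *)
Definition sq k s : C := imI ^+ k * (1 + imI * toC s).

Lemma cmod_sq2 k s : cmod (sq k s) ^+ 2 = 1 + s ^+ 2.
Proof.
rewrite /sq cmodM cmod_imIX mul1r cmod_sqr cReD cImD cReM cImM /cRe /cIm /toC /=.
by ring.
Qed.

Lemma sqr_le1 s : -1 <= s <= 1 -> s ^+ 2 <= 1.
Proof. by rewrite -ler_norml -[s ^+ 2]real_normK ?num_real// => ?; rewrite exprn_ile1. Qed.

Lemma cmod_sq_ge1 k s : 1 <= cmod (sq k s).
Proof.
by rewrite -(@ler_pXn2r _ 2)// ?nnegrE ?cmod_ge0// cmod_sq2 expr1n lerDl sqr_ge0.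
Qed.

(** The corners have modulus sqrt 2; 3/2 is the rational upper bound used for outer radii from here
    on. *)
Lemma cmod_sq_lt k s : -1 <= s <= 1 -> cmod (sq k s) < 3 / 2.
Proof.
move=> /sqr_le1 s1.
have E : (3 / 2) ^+ 2 = 9 / 4 :> R by field.
have h : cmod (sq k s) ^+ 2 < (3 / 2) ^+ 2 by rewrite cmod_sq2 E; lra.
by move: h; rewrite ltr_pXn2r// ?nnegrE ?cmod_ge0// divr_ge0.
Qed.

(** For positive [r], the square of half-side [r] about 0, counterclockwise. Each side is affine in
    [s], with derivative [toC r * imI ^+ k.+1]. *)
Definition loop f r : C :=
  \sum_(k < 4) cint (fun s => f (toC r * sq k s) * (toC r * imI ^+ k.+1)) (-1) 1.

Lemma loopE f r : loop f r =
  cint (fun s => f (toC r * sq 0 s) * (toC r * imI ^+ 1)) (-1) 1 +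
  (cint (fun s => f (toC r * sq 1 s) * (toC r * imI ^+ 2)) (-1) 1 +
  (cint (fun s => f (toC r * sq 2 s) * (toC r * imI ^+ 3)) (-1) 1 +
  cint (fun s => f (toC r * sq 3 s) * (toC r * imI ^+ 4)) (-1) 1)).
Proof. by rewrite /loop !big_ord_recl big_ord0 addr0. Qed.

Definition loop_cont f r := forall k s, -1 <= s <= 1 ->
  {for toC r * sq k s, continuous f}.

Lemma N1le1 : (-1 : R) <= 1. Proof. lra. Qed.

Lemma ccont_sq k r : ccont (fun s => toC r * sq k s) (-1) 1.
Proof.
refine (eq_ccont _ (@ccont_affine _ (toC r * imI ^+ k) (toC r * imI ^+ k.+1) _ _)) => s _.
by rewrite /sq exprSr; ring.
Qed.

Lemma loop_ccont f r k : loop_cont f r ->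
  ccont (fun s => f (toC r * sq k s) * (toC r * imI ^+ k.+1)) (-1) 1.
Proof.
move=> cf; apply: ccontM; last exact: ccont_cst.
by apply: (@ccont_comp _ f); [exact: ccont_sq|exact: cf].
Qed.

Lemma eq_loop f g r : (forall k s, -1 <= s <= 1 ->
  f (toC r * sq k s) = g (toC r * sq k s)) -> loop f r = loop g r.
Proof. by move=> fg; apply: eq_bigr => k _; apply: eq_cint => s sI; rewrite fg. Qed.

Lemma loopB f g r : loop_cont f r -> loop_cont g r ->
  loop (fun z => f z - g z) r = loop f r - loop g r.
Proof.
move=> cf cg; rewrite /loop -sumrB; apply: eq_bigr => k _.
rewrite -cintB; [|exact: loop_ccont|exact: loop_ccont].
by apply: eq_cint => s _; ring.
Qed.

Lemma loopD f g r : loop_cont f r -> loop_cont g r ->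
  loop (fun z => f z + g z) r = loop f r + loop g r.
Proof.
move=> cf cg; rewrite /loop -big_split /=; apply: eq_bigr => k _.
rewrite -cintD; [|exact: loop_ccont|exact: loop_ccont].
by apply: eq_cint => s _; ring.
Qed.

Lemma loopZ (c : C) f r : loop_cont f r ->
  loop (fun z => c * f z) r = c * loop f r.
Proof.
move=> cf; rewrite /loop mulr_sumr; apply: eq_bigr => k _.
rewrite -cintZ; last exact: loop_ccont.
by apply: eq_cint => s _; ring.
Qed.

Lemma loop_bound f r (B : R) : 0 <= r -> loop_cont f r ->
  (forall k s, -1 <= s <= 1 -> cmod (f (toC r * sq k s)) <= B) ->
  cmod (loop f r) <= 16 * (B * r).
Proof.
move=> r0 cf fB.
have H k : cmod (cint (fun s => f (toC r * sq k s) * (toC r * imI ^+ k.+1)) (-1) 1)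
    <= 4 * (B * r).
  have -> : 4 * (B * r) = 2 * (B * r * (1 - -1)) by ring.
  apply: cint_bound; [exact: N1le1|exact: loop_ccont|move=> s sI].
  rewrite cmodM cmodM cmod_imIX mulr1 cmod_toC (ger0_norm r0).
  by apply: ler_wpM2r => //; exact: fB.
rewrite /loop !big_ord_recl big_ord0 addr0.
have H0 := H 0%N; have H1 := H 1%N; have H2 := H 2%N; have H3 := H 3%N.
have -> : 16 * (B * r) = 4 * (B * r) + (4 * (B * r) + (4 * (B * r) + 4 * (B * r))) by ring.
apply: le_trans (cmodD _ _) _; apply: lerD; first exact: H0.
apply: le_trans (cmodD _ _) _; apply: lerD; first exact: H1.
by apply: le_trans (cmodD _ _) _; apply: lerD.
Qed.

(** The integral over the image of the square under the homothety of centre [a] and ratio [t]: ratio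
    1 gives [loop f r], and ratios tending to 0 contract the contour to [a]. *)
Definition loopt f (a : C) r t : C :=
  \sum_(k < 4) hedge a (toC r * imI ^+ k - a) (toC r * imI ^+ k.+1) f t (-1) 1.

Lemma sect_sq a r t s k :
  sect a (toC r * imI ^+ k - a) (toC r * imI ^+ k.+1) t s =
  a + toC t * (toC r * sq k s - a).
Proof. by rewrite /sect /sq exprS; ring. Qed.

(** Goursat's theorem on each of four sectors. The radial edge ending side [k] begins side [k.+1],
    and [imI ^+ 4 = 1] closes the cycle, so all radial terms cancel. *)
Lemma loopt_const f a r t0 t1 : t0 <= t1 ->
  (forall k s t, -1 <= s <= 1 -> t0 <= t <= t1 ->
     differentiable f (a + toC t * (toC r * sq k s - a))) ->
  loopt f a r t0 = loopt f a r t1.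
Proof.
move=> t01 df; apply/eqP; rewrite eq_sym -subr_eq0 /loopt -sumrB; apply/eqP.
pose V k := vedge a (toC r * imI ^+ k - a) (toC r * imI ^+ k.+1) f (-1) t0 t1.
have E k : hedge a (toC r * imI ^+ k - a) (toC r * imI ^+ k.+1) f t1 (-1) 1 -
    hedge a (toC r * imI ^+ k - a) (toC r * imI ^+ k.+1) f t0 (-1) 1 = V k.+1 - V k.
  have := @goursat _ a (toC r * imI ^+ k - a) (toC r * imI ^+ k.+1) f t0 t1 (-1) 1 t01 N1le1.
  rewrite /rect_int.
  have -> : vedge a (toC r * imI ^+ k - a) (toC r * imI ^+ k.+1) f 1 t0 t1 = V k.+1.
    have e t : sect a (toC r * imI ^+ k - a) (toC r * imI ^+ k.+1) t 1 =
        sect a (toC r * imI ^+ k.+1 - a) (toC r * imI ^+ k.+2) t (-1).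
      rewrite /sect (exprS _ k.+1) (exprS _ k) toCN toC1.
      have -> : imI * (imI * imI ^+ k) = - imI ^+ k by rewrite mulrA -expr2 imI2 mulN1r.
      by ring.
    apply: eq_cint => t _; rewrite e; congr (_ * _).
    rewrite (exprS _ k.+1) (exprS _ k) toCN toC1.
    have -> : imI * (imI * imI ^+ k) = - imI ^+ k by rewrite mulrA -expr2 imI2 mulN1r.
    by ring.
  rewrite -/(V k) => H; apply/eqP; rewrite -subr_eq0; apply/eqP.
  rewrite -[RHS]H; last by move=> t s tI sI; rewrite sect_sq; exact: df.
  by rewrite opprB !addrA addrAC.
have V4 : V 4%N = V 0%N.
  by rewrite /V (exprS _ 4) imI4 !expr0 !mulr1 expr1.
under eq_bigr do rewrite E.
rewrite !big_ord_recl big_ord0 /= addr0 /bump /= !add1n V4.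
by move: (V 0%N) (V 1%N) (V 2%N) (V 3%N) => v0 v1 v2 v3; ring.
Qed.

Lemma loopt1 f a r : loopt f a r 1 = loop f r.
Proof.
apply: eq_bigr => k _; apply: eq_cint => s _.
by rewrite sect_sq toC1 !mul1r subrKC.
Qed.

Lemma loopt0 f r : loopt f 0 1 r = loop f r.
Proof.
apply: eq_bigr => k _; apply: eq_cint => s _.
by rewrite sect_sq toC1 !mul1r subr0 add0r.
Qed.

(** The case of centre 0 and half-side 1, where the ratio becomes the half-side. *)
Lemma loop_const f r0 r1 : r0 <= r1 ->
  (forall k s r, -1 <= s <= 1 -> r0 <= r <= r1 -> differentiable f (toC r * sq k s)) ->
  loop f r0 = loop f r1.
Proof.
move=> r01 df; apply: etrans (esym (loopt0 f r0)) _; apply: etrans (loopt0 f r1).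
apply: (loopt_const r01) => k s t sI tI.
by rewrite toC1 mul1r subr0 add0r; exact: df.
Qed.

Lemma le_small0 (x : R) : (forall e, 0 < e -> x <= e) -> x <= 0.
Proof.
move=> h; rewrite leNgt; apply/negP => x0.
by have := h (x / 2) (divr_gt0 x0 (ltr0n _ 2)); lra.
Qed.

Lemma cmod_small0 (z : C) : (forall e, 0 < e -> cmod z <= e) -> z = 0.
Proof.
move=> /le_small0 h; apply/eqP; rewrite -cmod_eq0; apply/eqP/le_anti.
by rewrite h cmod_ge0.
Qed.

(** This is 2 pi i, kept as an unevaluated constant; the formulas below divide by it, for which
    [loopc_neq0] suffices. *)
Definition loopc : C := loop (fun z => z^-1) 1.

Lemma toC_sq_neq0 r k s : 0 < r -> toC r * sq k s != 0.
Proof.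
move=> r0; rewrite -cmod_gt0 cmodM cmod_toC mulr_gt0 ?normr_gt0 ?gt_eqF//.
exact: lt_le_trans ltr01 (cmod_sq_ge1 _ _).
Qed.

Lemma cmod_rsq_ge r k s : 0 <= r -> r <= cmod (toC r * sq k s).
Proof.
move=> r0; rewrite cmodM cmod_toC ger0_norm// -{1}(mulr1 r).
by apply: ler_wpM2l => //; exact: cmod_sq_ge1.
Qed.

Lemma loop_inv r : 0 < r -> loop (fun z => z^-1) r = loopc.
Proof.
move=> r0; apply: eq_bigr => k _; apply: eq_cint => s _.
have r0' : toC r != 0 by rewrite -toC0 (inj_eq (@toC_inj R)) gt_eqF.
by rewrite toC1 !mul1r invfM mulrACA mulVf// mul1r.
Qed.

(** On every side the integrand has imaginary part 1/(1 + s^2) >= 1/2, so each side contributes at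
    least 1 to the imaginary part. *)
Lemma loopc_neq0 : loopc != 0.
Proof.
have cf : loop_cont (fun z => z^-1) 1.
  move=> k s _; apply: differentiable_continuous.
  by apply: (@dV _ _ (fun z : C => z)); [exact: toC_sq_neq0|exact: did].
apply/negP => /eqP h; have : cIm loopc = 0 by rewrite h.
rewrite /loopc /loop !big_ord_recl big_ord0 !cImD.
have H k : 1 <= cIm (cint (fun s => (toC 1 * sq k s)^-1 * (toC 1 * imI ^+ k.+1)) (-1) 1).
  apply: (@le_trans _ _ (1 / 2 * (1 - -1))); first by lra.
  apply: cint_Im_ge; [exact: N1le1|exact: (loop_ccont k cf)|].
  move=> s sI; have s1 := sqr_le1 sI.
  have -> : (toC 1 * sq k s)^-1 * (toC 1 * imI ^+ k.+1) = mkC (s / (1 + s ^+ 2)) (1 / (1 + s ^+ 2)).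
    have n0 : toC 1 * sq k s != 0 by exact: toC_sq_neq0.
    have p0 : 0 < 1 + s ^+ 2 by rewrite ltr_wpDr// sqr_ge0.
    apply: (mulfI n0); rewrite mulrA mulfV// mul1r toC1 !mul1r /sq -mulrA exprSr.
    congr (_ * _); apply: ReIm_ext; rewrite ?cReM ?cImM ?cReD ?cImD ?cReM ?cImM;
      rewrite /cRe /cIm /toC /=; field; rewrite gt_eqF//.
  rewrite cIm_mk !div1r lef_pV2 ?posrE//; last by rewrite ltr_wpDr// sqr_ge0.
  by rewrite -[X in _ <= X](_ : 1 + 1 = 2)// lerD2l.
have H0 := H 0%N; have H1 := H 1%N; have H2 := H 2%N; have H3 := H 3%N.
have -> : cIm (0 : C) = 0 by [].
by move=> h0; have := lerD H0 (lerD H1 (lerD H2 (lerD H3 (lexx 0)))); rewrite h0; lra.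
Qed.

(** Enlarging the square changes neither integral; (z - a)^-1 - z^-1 decays like the inverse square
    of the half-side, while the contour grows only linearly. *)
Lemma loop_inv_sub r a : cmod a < r -> loop (fun z => (z - a)^-1) r = loopc.
Proof.
move=> ar; have r0 : 0 < r by apply: le_lt_trans ar; exact: cmod_ge0.
have na q k s : r <= q -> toC q * sq k s != a.
  move=> rq; apply/negP => /eqP e; move: (lt_le_trans ar rq); rewrite -e ltNge.
  by rewrite cmod_rsq_ge// (le_trans (ltW r0) rq).
have d1 q k s : r <= q -> differentiable (fun z : C => (z - a)^-1) (toC q * sq k s).
  move=> rq; apply: (@dV _ _ (fun z : C => z - a)); first by rewrite subr_eq0 na.
  by apply: dB; [exact: did|exact: dcst].
have d2 q k s : r <= q -> differentiable (fun z : C => z^-1) (toC q * sq k s).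
  move=> rq; apply: (@dV _ _ (fun z : C => z)); last exact: did.
  by apply: toC_sq_neq0; exact: lt_le_trans rq.
rewrite -(loop_inv r0); apply/eqP; rewrite -subr_eq0; apply/eqP.
apply: cmod_small0 => e e0.
(* Then q - |a| >= 16 |a| / e, which makes the bound 16 q |a| / (q (q - |a|)) at most [e]. *)
pose q := r + cmod a + 16 * cmod a / e.
have h1 := cmod_ge0 a.
have h2 : 0 <= 16 * cmod a / e by rewrite divr_ge0 ?mulr_ge0// ltW.
have rq : r <= q by rewrite /q; lra.
have q0 : 0 < q by exact: lt_le_trans rq.
have E1 : loop (fun z => (z - a)^-1) r = loop (fun z => (z - a)^-1) q.
  by apply: (loop_const rq) => k s t _ /andP[t1 _]; exact: d1.
have E2 : loop (fun z => z^-1) r = loop (fun z : C => z^-1) q.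
  by apply: (loop_const rq) => k s t _ /andP[t1 _]; exact: d2.
rewrite E1 E2.
rewrite -loopB; [|by move=> k s _; exact: (differentiable_continuous (d1 _ _ _ rq))
                 |by move=> k s _; exact: (differentiable_continuous (d2 _ _ _ rq))].
have qa : 0 < q - cmod a by rewrite /q; lra.
have -> : e = 16 * ((e / (16 * q)) * q) by field; rewrite gt_eqF.
apply: loop_bound; first exact: ltW.
  move=> k s _; apply: differentiable_continuous; apply: dB; [exact: d1|exact: d2].
move=> k s _; set z := toC q * sq k s.
have z0 : z != 0 by apply: toC_sq_neq0.
have za : z - a != 0 by rewrite subr_eq0 na.
have -> : (z - a)^-1 - z^-1 = a / (z * (z - a)) by field; rewrite z0 za.
rewrite cmodM cmodV cmodM.
have zq : q <= cmod z by apply: cmod_rsq_ge; exact: ltW.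
have zaq : q - cmod a <= cmod (z - a).
  by apply: le_trans (cmod_sub _ _); rewrite lerD2r.
have p1 : q * (q - cmod a) <= cmod z * cmod (z - a).
  by apply: ler_pM => //; exact: ltW.
have p0 : 0 < q * (q - cmod a) by apply: mulr_gt0.
rewrite ler_pdivrMr; last exact: lt_le_trans p1.
have e1 : 0 <= e / (16 * q) by rewrite divr_ge0 ?mulr_ge0// ltW.
apply: le_trans (ler_wpM2l e1 p1).
have -> : e / (16 * q) * (q * (q - cmod a)) = e * (q - cmod a) / 16.
  by field; rewrite gt_eqF.
have -> : e * (q - cmod a) / 16 = e * r / 16 + cmod a by rewrite /q; field; rewrite gt_eqF.
by rewrite lerDr divr_ge0// mulr_ge0// ltW.
Qed.

(** Contracting the square to 0 stays at distance at least |a| - 3r/2 from [a], so the integrand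
    remains bounded while the length tends to 0. *)
Lemma loop_inv_out r a : 0 < r -> 3 / 2 * r < cmod a -> loop (fun z => (z - a)^-1) r = 0.
Proof.
move=> r0 ra.
have far q k s : 0 <= q -> q <= r -> -1 <= s <= 1 -> cmod a - 3 / 2 * r <= cmod (toC q * sq k s - a).
  move=> q0 qr sI; rewrite cmodB; apply: le_trans (cmod_sub _ _); rewrite lerD2l lerN2.
  rewrite cmodM cmod_toC ger0_norm// mulrC; apply: ler_pM => //; first exact: cmod_ge0.
  by apply: ltW; exact: cmod_sq_lt.
have d1 q k s : 0 <= q -> q <= r -> -1 <= s <= 1 ->
    differentiable (fun z : C => (z - a)^-1) (toC q * sq k s).
  move=> q0 qr sI; apply: (@dV _ _ (fun z : C => z - a)); last first.
    by apply: dB; [exact: did|exact: dcst].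
  rewrite -cmod_gt0; apply: lt_le_trans (far q k s q0 qr sI); lra.
apply: cmod_small0 => e e0.
pose B := (cmod a - 3 / 2 * r)^-1.
have B0 : 0 < B by rewrite invr_gt0; lra.
pose q := Num.min r (e / (16 * B)).
have q0 : 0 < q by rewrite lt_min r0 divr_gt0// mulr_gt0.
have qr : q <= r by rewrite /q ge_min lexx.
have E1 : loop (fun z => (z - a)^-1) q = loop (fun z => (z - a)^-1) r.
  apply: (loop_const qr) => k s t sI /andP[t1 t2].
  by apply: d1; [exact: le_trans (ltW q0) t1|exact: t2|exact: sI].
rewrite -E1.
apply: (@le_trans _ _ (16 * (B * q))).
  apply: loop_bound; first exact: ltW.
    by move=> k s sI; apply: differentiable_continuous; apply: d1 => //; exact: ltW.
  move=> k s sI; rewrite cmodV /B lef_pV2 ?posrE.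
  - by apply: far => //; exact: ltW.
  - apply: lt_le_trans (far q k s (ltW q0) qr sI); lra.
  - lra.
have qe : q <= e / (16 * B) by rewrite /q ge_min lexx orbT.
have -> : 16 * (B * q) = q * (16 * B) by ring.
by rewrite -ler_pdivlMr// mulr_gt0.
Qed.

(* Contracting the square to [a] kills the loop integral of the difference quotient. *)
Lemma cauchy_formula f r a : cmod a < r ->
  (forall z, cmod z <= 2 * r -> differentiable f z) ->
  loop (fun z => f z / (z - a)) r = loopc * f a.
Proof.
move=> ar df; have r0 : 0 < r by apply: le_lt_trans ar; exact: cmod_ge0.
have a0 := cmod_ge0 a.
have na k s : toC r * sq k s != a.
  apply/negP => /eqP e; move: ar; rewrite -e ltNge cmod_rsq_ge//; exact: ltW.
have pt k s t : -1 <= s <= 1 -> 0 <= t <= 1 ->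
    cmod (a + toC t * (toC r * sq k s - a)) <= 2 * r.
  move=> sI /andP[t0 t1].
  have -> : a + toC t * (toC r * sq k s - a) = toC (1 - t) * a + toC t * (toC r * sq k s).
    by rewrite toCB toC1; ring.
  have h : cmod (toC r * sq k s) <= 2 * r.
    rewrite cmodM cmod_toC (gtr0_norm r0) mulrC; apply: ler_wpM2r; first exact: ltW.
    by apply: le_trans (ltW (cmod_sq_lt k sI)) _; lra.
  have -> : 2 * r = (1 - t) * (2 * r) + t * (2 * r) by ring.
  apply: le_trans (cmodD _ _) _; rewrite cmodM cmod_toC [X in _ + X]cmodM cmod_toC.
  have t1' : 0 <= 1 - t by lra.
  rewrite (ger0_norm t0) (ger0_norm t1'); apply: lerD; apply: ler_wpM2l => //.
  by lra.
have da : differentiable f a by apply: df; lra.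
have dq z : z != a -> cmod z <= 2 * r -> differentiable (fun z => (f z - f a) / (z - a)) z.
  move=> za zr; apply: (@dquot _ (fun z => f z - f a)); first exact: za.
  by apply: dB; [exact: df|exact: dcst].
(* Differentiability at [a] with relative error 1 bounds the difference quotient near [a] by |f'(a)|
   + 1. *)
have [dl dl0 hdl] := diffC_eps da ltr01.
pose B := cmod ('d f a 1) + 1.
have B0 : 0 < B by rewrite ltr_wpDl// cmod_ge0.
have qB z : z != a -> cmod (z - a) < dl -> cmod ((f z - f a) / (z - a)) <= B.
  move=> za zdl; have := hdl z zdl; rewrite mul1r => h.
  have h0 : 0 < cmod (z - a) by rewrite cmod_gt0 subr_eq0.
  rewrite cmodM cmodV ler_pdivrMr// -(subrK ((z - a) * 'd f a 1) (f z - f a)).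
  have -> : B * cmod (z - a) = cmod (z - a) + cmod (z - a) * cmod ('d f a 1).
    by rewrite /B; ring.
  by apply: le_trans (cmodD _ _) _; rewrite [cmod (_ * 'd f a 1)]cmodM lerD2r.
have loop0 : loop (fun z => (f z - f a) / (z - a)) r = 0.
  apply: cmod_small0 => e e0; rewrite -(loopt1 _ a).
  (* Points of the contracted square are at distance less than 4 r t from [a], so dl / (4 r) brings
     them within [dl]; e / (32 B r) makes the four sides together contribute at most e / 2. *)
  pose t := Num.min 1 (Num.min (dl / (4 * r)) (e / (32 * B * r))).
  have t0 : 0 < t.
    by rewrite !lt_min ltr01 !divr_gt0// !mulr_gt0.
  have t1 : t <= 1 by rewrite /t ge_min lexx.
  have tdl : t <= dl / (4 * r) by rewrite /t !ge_min lexx !orbT.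
  have te : t <= e / (32 * B * r) by rewrite /t !ge_min lexx !orbT.
  have ptn k s u : 0 < u -> a + toC u * (toC r * sq k s - a) != a.
    move=> u0; rewrite -subr_eq0 addrAC subrr add0r mulf_neq0 ?subr_eq0 ?na//.
    by rewrite -toC0 (inj_eq (@toC_inj R)) gt_eqF.
  have E1 : loopt (fun z => (f z - f a) / (z - a)) a r t =
      loopt (fun z => (f z - f a) / (z - a)) a r 1.
    apply: (loopt_const t1) => k s u sI /andP[u0 u1]; have u0' := lt_le_trans t0 u0.
    by apply: dq; [exact: ptn|apply: pt; [exact: sI|rewrite (ltW u0')]].
  rewrite -E1.
  have tr0 : 0 < 4 * (B * (t * r)) by rewrite !mulr_gt0.
  have H k : cmod (hedge a (toC r * imI ^+ k - a) (toC r * imI ^+ k.+1)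
      (fun z => (f z - f a) / (z - a)) t (-1) 1) <= 4 * (B * (t * r)).
    have -> : 4 * (B * (t * r)) = 2 * (B * (t * r) * (1 - -1)) by ring.
    apply: cint_bound; first exact: N1le1.
      apply: (@hedge_ccont _ a (toC r * imI ^+ k - a) (toC r * imI ^+ k.+1)
        (fun z => (f z - f a) / (z - a))) => s sI; rewrite sect_sq.
      have tI : 0 <= t <= 1 by rewrite (ltW t0).
      exact: (differentiable_continuous (dq _ (ptn k s t t0) (pt k s t sI tI))).
    move=> s sI; rewrite sect_sq cmodM; apply: ler_pM; rewrite ?cmod_ge0//; last first.
      by rewrite !cmodM cmod_imIX mulr1 !cmod_toC !gtr0_norm.
    apply: qB; first exact: (ptn _ _ _ t0).
    rewrite addrAC subrr add0r cmodM cmod_toC gtr0_norm//.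
    have : cmod (toC r * sq k s - a) < 4 * r.
      apply: le_lt_trans (cmodD _ _) _; rewrite cmodN cmodM cmod_toC gtr0_norm//.
      have h := cmod_sq_lt k sI.
      have : r * cmod (sq k s) < r * (3 / 2) by rewrite ltr_pM2l.
      lra.
    move=> h; apply: (@lt_le_trans _ _ (t * (4 * r))); first by rewrite ltr_pM2l.
    by rewrite -ler_pdivlMr// mulr_gt0.
  rewrite /loopt !big_ord_recl big_ord0 addr0.
  have H0 := H 0%N; have H1 := H 1%N; have H2 := H 2%N; have H3 := H 3%N.
  have te' : 4 * (B * (t * r)) + (4 * (B * (t * r)) + (4 * (B * (t * r)) + 4 * (B * (t * r)))) <= e.
    have -> : 4 * (B * (t * r)) + (4 * (B * (t * r)) + (4 * (B * (t * r)) + 4 * (B * (t * r)))) =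
      t * (32 * B * r) / 2 by field.
    have : t * (32 * B * r) <= e by rewrite -ler_pdivlMr// !mulr_gt0.
    by clear -e0; move: (t * _) => x; lra.
  apply: le_trans te'.
  apply: le_trans (cmodD _ _) _; apply: lerD; first exact: H0.
  apply: le_trans (cmodD _ _) _; apply: lerD; first exact: H1.
  by apply: le_trans (cmodD _ _) _; apply: lerD.
have dinv k s : differentiable (fun z : C => (z - a)^-1) (toC r * sq k s).
  apply: (@dV _ _ (fun z : C => z - a)); first by rewrite subr_eq0 na.
  by apply: dB; [exact: did|exact: dcst].
have dfz k s : -1 <= s <= 1 -> differentiable f (toC r * sq k s).
  move=> sI; apply: df; rewrite cmodM cmod_toC (gtr0_norm r0) mulrC.
  apply: ler_wpM2r; first exact: ltW.
  by apply: le_trans (ltW (cmod_sq_lt k sI)) _; lra.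
rewrite -(loop_inv_sub ar) [RHS]mulrC -loopZ; last first.
  by move=> k s _; exact: (differentiable_continuous (dinv k s)).
apply/eqP; rewrite -subr_eq0 -loopB.
- by rewrite -[X in _ == X]loop0; apply/eqP; apply: eq_loop => k s _; rewrite mulrBl.
- move=> k s sI; apply: differentiable_continuous.
  by apply: dM; [exact: dfz|exact: dinv].
- move=> k s sI; apply: differentiable_continuous.
  by apply: dM; [exact: dcst|exact: dinv].
Qed.

End Loop.
Arguments imI {R}.
Global Opaque loop loopt loopc hedge vedge rect_int.

(** * Expansions of holomorphic functions *)

Section Expansion.
Variable R : realType.
Local Notation C := (Cplx R).
Implicit Types (f : C -> C) (r : R).

(* The remainder in the Taylor expansion at 0:
   f(t) = sum_(j < k) (remk f r j 0) t^j + t^k (remk f r k t). *)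
Definition remk f r k (t : C) : C :=
  (loopc R)^-1 * loop (fun z => f z / (z ^+ k * (z - t))) r.

(** Radius 2 r leaves room around the square of half-side [r], whose points have modulus below
    3r/2. *)
Definition hol_on f r := forall z, cmod z <= 2 * r -> differentiable f z.

Lemma rsq_le r k s : 0 <= r -> -1 <= s <= 1 -> cmod (toC r * sq k s) <= 2 * r.
Proof.
move=> r0 sI; rewrite cmodM cmod_toC (ger0_norm r0) mulrC; apply: ler_wpM2r => //.
by apply: le_trans (ltW (cmod_sq_lt k sI)) _; lra.
Qed.

Lemma rsq_neq r (t : C) k s : cmod t < r -> toC r * sq k s != t.
Proof.
move=> tr; have r0 : 0 < r by apply: le_lt_trans tr; exact: cmod_ge0.
by apply/negP => /eqP e; move: tr; rewrite -e ltNge cmod_rsq_ge//; exact: ltW.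
Qed.

Lemma remk_diff f r k (t : C) : cmod t < r -> hol_on f r ->
  forall j s, -1 <= s <= 1 ->
  differentiable (fun z => f z / (z ^+ k * (z - t))) (toC r * sq j s).
Proof.
move=> tr hf j s sI; have r0 : 0 < r by apply: le_lt_trans tr; exact: cmod_ge0.
apply: dM; first by apply: hf; apply: rsq_le => //; exact: ltW.
apply: (@dV _ _ (fun z : C => z ^+ k * (z - t))).
  by rewrite mulf_neq0 ?expf_neq0 ?toC_sq_neq0// subr_eq0 rsq_neq.
apply: dM; first by apply: dX; exact: did.
by apply: dB; [exact: did|exact: dcst].
Qed.

Lemma remk0 f r t : cmod t < r -> hol_on f r -> remk f r 0 t = f t.
Proof.
move=> tr hf; rewrite /remk.
have -> : loop (fun z => f z / (z ^+ 0 * (z - t))) r = loop (fun z => f z / (z - t)) r.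
  by apply: eq_loop => k s _; rewrite expr0 mul1r.
by rewrite cauchy_formula// mulrA mulVf ?loopc_neq0// mul1r.
Qed.

(** Under the integral this is 1/(z^k (z - t)) = 1/z^(k+1) + t/(z^(k+1) (z - t)). *)
Lemma remkS f r k t : cmod t < r -> hol_on f r ->
  remk f r k t = remk f r k 0 + t * remk f r k.+1 t.
Proof.
move=> tr hf; have r0 : 0 < r by apply: le_lt_trans tr; exact: cmod_ge0.
have t0 : cmod 0 < r by rewrite cmod0.
rewrite /remk mulrCA -mulrDr; congr (_ * _).
have c1 : loop_cont (fun z => f z / (z ^+ k.+1 * (z - t))) r.
  by move=> j s sI; apply: differentiable_continuous; exact: remk_diff.
have c2 : loop_cont (fun z => f z / (z ^+ k * (z - 0))) r.
  by move=> j s sI; apply: differentiable_continuous; exact: remk_diff.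
have c3 : loop_cont (fun z => t * (f z / (z ^+ k.+1 * (z - t)))) r.
  move=> j s sI; apply: differentiable_continuous; apply: dM; first exact: dcst.
  exact: (remk_diff k.+1 tr hf).
rewrite -(loopZ t c1) -(loopD c2 c3).
apply: eq_loop => j s sI; set z := toC r * sq j s.
have z0 : z != 0 by exact: toC_sq_neq0.
have zt : z - t != 0 by rewrite subr_eq0 rsq_neq.
by rewrite subr0 exprS; field; rewrite z0 zt expf_neq0.
Qed.

(** 16 is the constant of [loop_bound]; the remaining factor 2 comes from |z - t| >= r/2 on the
    contour when |t| <= r/2. *)
Definition loopk : R := 32 / cmod (loopc R).

Lemma loopk_ge0 : 0 <= loopk.
Proof. by rewrite divr_ge0// cmod_ge0. Qed.

Lemma remk_bound f r k t (B : R) : 0 < r -> cmod t <= r / 2 -> hol_on f r ->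
  (forall z, cmod z <= 2 * r -> cmod (f z) <= B) ->
  cmod (remk f r k t) <= loopk * B / r ^+ k.
Proof.
move=> r0 tr hf fB; have tr' : cmod t < r by apply: le_lt_trans tr _; lra.
have B0 : 0 <= B by apply: le_trans (fB 0 _); rewrite ?cmod_ge0// cmod0 mulr_ge0// ltW.
rewrite /remk cmodM cmodV /loopk.
have -> : 32 / cmod (loopc R) * B / r ^+ k =
   (cmod (loopc R))^-1 * (16 * (B / (r ^+ k * (r / 2)) * r)).
  by field; rewrite expf_neq0 ?gt_eqF// cmod_gt0 loopc_neq0.
apply: ler_wpM2l; first by rewrite invr_ge0 cmod_ge0.
apply: loop_bound; first exact: ltW.
  by move=> j s sI; apply: differentiable_continuous; exact: remk_diff.
move=> j s sI; rewrite cmodM cmodV cmodM cmodX; set z := toC r * sq j s.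
have zr : r <= cmod z by apply: cmod_rsq_ge; exact: ltW.
have h1 : r ^+ k <= cmod z ^+ k.
  by case: (k) => [|n]; [rewrite !expr0|rewrite ler_pXn2r ?nnegrE ?cmod_ge0// ltW].
have h2 : r / 2 <= cmod (z - t) by apply: le_trans (cmod_sub _ _); lra.
have rk0 : 0 < r ^+ k by rewrite exprn_gt0.
have r20 : 0 < r / 2 by rewrite divr_gt0.
apply: ler_pM; rewrite ?cmod_ge0 ?invr_ge0 ?mulr_ge0 ?exprn_ge0 ?cmod_ge0//.
  by apply: fB; apply: rsq_le => //; exact: ltW.
rewrite lef_pV2 ?posrE ?mulr_gt0//.
- by apply: ler_pM => //; exact: ltW.
- exact: lt_le_trans h1.
- exact: lt_le_trans h2.
Qed.

(** A second-order bound that depends on [f] only through a bound of its modulus. The slope [l] is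
    given as a derivative, and is identified with the Cauchy coefficient [remk f r 1 0] by comparing
    both expansions at small real points. *)
Lemma taylor2 f r (t l : C) (B : R) : 0 < r -> cmod t <= r / 2 -> hol_on f r ->
  (forall z, cmod z <= 2 * r -> cmod (f z) <= B) ->
  (forall e, 0 < e -> exists2 d, 0 < d & forall z, cmod z < d ->
     cmod (f z - f 0 - z * l) <= e * cmod z) ->
  cmod (f t - f 0 - t * l) <= loopk * B / r ^+ 2 * cmod t ^+ 2.
Proof.
move=> r0 tr hf fB hl.
have E z : cmod z < r -> f z - f 0 - z * remk f r 1 0 = z ^+ 2 * remk f r 2 z.
  move=> zr; have h0 : cmod 0 < r by rewrite cmod0.
  rewrite -(remk0 zr hf) -(remk0 h0 hf) (remkS 0 zr hf) (remkS 1 zr hf).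
  by rewrite (remkS 0 h0 hf) mul0r addr0; ring.
have M2 z : cmod z <= r / 2 ->
    cmod (f z - f 0 - z * remk f r 1 0) <= loopk * B / r ^+ 2 * cmod z ^+ 2.
  move=> zr; have zr' : cmod z < r by apply: le_lt_trans zr _; lra.
  rewrite E// cmodM cmodX mulrC; apply: ler_wpM2r; first by rewrite sqr_ge0.
  exact: remk_bound.
suff -> : l = remk f r 1 0 by exact: M2.
apply/eqP; rewrite -subr_eq0; apply/eqP; apply: cmod_small0 => e e0.
have e20 : 0 < e / 2 by rewrite divr_gt0.
have [d d0 hd] := hl _ e20.
set M := loopk * B / r ^+ 2 in M2.
pose x := Num.min (d / 2) (Num.min (r / 2) (e / (2 * (`|M| + 1)))).
have M0 : 0 < `|M| + 1 by rewrite ltr_wpDl.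
have x0 : 0 < x by rewrite !lt_min !divr_gt0// mulr_gt0.
have xd : x < d by apply: (@le_lt_trans _ _ (d / 2)); [rewrite /x ge_min lexx|lra].
have xr : x <= r / 2 by rewrite /x !ge_min lexx orbT.
have xe : x * (`|M| + 1) <= e / 2.
  have : x <= e / (2 * (`|M| + 1)) by rewrite /x !ge_min lexx !orbT.
  by rewrite ler_pdivlMr ?mulr_gt0// mulrCA mulrC -ler_pdivlMr.
have cx : cmod (toC x) = x by rewrite cmod_toC gtr0_norm.
have h1 := hd (toC x); rewrite cx in h1; have {}h1 := h1 xd.
have h2 := M2 (toC x); rewrite cx in h2; have {}h2 := h2 xr.
rewrite -(ler_pM2l x0) -{1}cx -cmodM.
have -> : toC x * (l - remk f r 1 0) =
   (f (toC x) - f 0 - toC x * remk f r 1 0) - (f (toC x) - f 0 - toC x * l) by ring.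
apply: le_trans (cmodD _ _) _; rewrite cmodN; apply: le_trans (lerD h2 h1) _.
have h3 : M * x ^+ 2 <= x * (e / 2).
  have hm : M * x <= e / 2.
    apply: le_trans xe; rewrite [x * _]mulrC; apply: ler_wpM2r; first exact: ltW.
    by apply: le_trans (ler_norm _) _; rewrite lerDl.
  have -> : M * x ^+ 2 = M * x * x by ring.
  by rewrite [x * (e / 2)]mulrC; apply: ler_wpM2r; [exact: ltW|exact: hm].
by apply: le_trans (lerD h3 (lexx _)) _; apply/eq_ler; field.
Qed.

End Expansion.

(** * Differentiation under the integral sign *)

Section DUI.
Variable R : realType.
Local Notation C := (Cplx R).

Lemma ccont_unif (f : R -> C) a b :
  (forall e, 0 < e -> exists2 g, ccont g a b &
     forall s, a <= s <= b -> cmod (f s - g s) <= e) -> ccont f a b.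
Proof.
move=> h s sI e e0; have e40 : 0 < e / 4 by rewrite divr_gt0.
have [g cg fg] := h _ e40; have [d d0 hd] := cg s sI _ e40.
exists d => // t tI td; have h1 := fg _ sI; have h2 := fg _ tI; have h3 := hd _ tI td.
have -> : f t - f s = (f t - g t) + (g t - g s) - (f s - g s) by ring.
apply: le_lt_trans (cmodD _ _) _; rewrite cmodN.
have h4 := cmodD (f t - g t) (g t - g s).
move: h1 h2 h3 h4; move: (cmod _) (cmod _) (cmod _) (cmod _) => x y z w; lra.
Qed.

Variable V : normedModType C.

(** Holomorphy along complex lines and the common bound [B] give, by [taylor2], a second-order
    remainder uniform in [s]. The differentials [T s w] are then uniform limits of difference
    quotients, hence continuous in [s], and their integral is the differential sought. *)
Lemma dui (K : R -> V -> C) a b (v0 : V) (rho B : R) : a <= b -> 0 < rho ->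
  (forall s w, a <= s <= b -> vmod w < rho -> differentiable (K s) (v0 + w)) ->
  (forall w, vmod w < rho -> ccont (fun s => K s (v0 + w)) a b) ->
  (forall s w, a <= s <= b -> vmod w < rho -> cmod (K s (v0 + w)) <= B) ->
  differentiable (fun v => cint (fun s => K s v) a b) v0.
Proof.
move=> ab rho0 dK cK BK.
pose T s w := 'd (K s) v0 w.
have dK0 s : a <= s <= b -> differentiable (K s) v0.
  by move=> sI; have := dK s 0 sI; rewrite vmod0 addr0; exact.
have cK0 : ccont (fun s => K s v0) a b.
  by have := cK 0; rewrite vmod0 addr0; exact.
pose M := loopk R * B * 16 / rho ^+ 2.
have main s w : a <= s <= b -> vmod w <= rho / 8 ->
    cmod (K s (v0 + w) - K s v0 - T s w) <= M * vmod w ^+ 2.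
  move=> sI wr; have [->|w0] := eqVneq w 0.
    by rewrite /T linear0 addr0 subrr subrr cmod0 vmod0 expr0n mulr0.
  have vw0 : 0 < vmod w by rewrite lt_def vmod_eq0 w0 vmod_ge0.
  (* On the line z -> v0 + z w the disc of radius 2 r stays within norm rho/2, and
     [vmod w <= rho / 8] gives r >= 2, so z = 1 is in the range of [taylor2]. *)
  pose r := rho / (4 * vmod w).
  have r0 : 0 < r by rewrite divr_gt0// mulr_gt0.
  have rE : 2 * r * vmod w = rho / 2 by rewrite /r; field; rewrite gt_eqF.
  have zr z : cmod z <= 2 * r -> vmod (z *: w) < rho.
    move=> h; rewrite vmodZ; apply: (@le_lt_trans _ _ (2 * r * vmod w)).
      by apply: ler_wpM2r => //; exact: vmod_ge0.
    by rewrite rE; lra.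
  have dline (z : C) : differentiable (fun z : C => v0 + z *: w) z.
    apply: (@differentiableD _ _ _ (cst v0) (fun z : C => z *: w)).
      exact: differentiable_cst.
    apply: (@differentiableZl _ _ _ (fun z : C => z) w); exact: did.
  have := @taylor2 _ (fun z => K s (v0 + z *: w)) r 1 (T s w) B r0.
  rewrite cmod1 scale1r scale0r addr0 !mul1r expr1n mulr1.
  have -> : loopk R * B / r ^+ 2 = M * vmod w ^+ 2.
    by rewrite /M /r; field; rewrite !gt_eqF.
  apply.
  - rewrite /r ler_pdivlMr// ler_pdivlMr ?mulr_gt0//; lra.
  - move=> z /zr h; apply: (@differentiable_comp _ _ _ _ (fun z : C => v0 + z *: w) (K s)).
      exact: dline.
    exact: dK.
  - by move=> z /zr; exact: BK.
  - move=> e e0.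
    have e'0 : 0 < e / vmod w by rewrite divr_gt0.
    have [d d0 hd] := diffV_eps (dK0 s sI) e'0.
    exists (d / vmod w); first by rewrite divr_gt0.
    move=> z zd; have := hd (z *: w); rewrite vmodZ -ltr_pdivlMr// => /(_ zd).
    rewrite linearZ /= mulrCA divfK ?gt_eqF// mulrC; exact.
have M0 : 0 <= M * (rho / 8) ^+ 2 \/ forall s, ~ (a <= s <= b).
  left; rewrite mulr_ge0 ?sqr_ge0// /M divr_ge0 ?sqr_ge0// mulr_ge0// mulr_ge0 ?loopk_ge0//.
  have aI : a <= a <= b by rewrite lexx.
  by have := BK a 0 aI; rewrite vmod0 => /(_ rho0); apply: le_trans; exact: cmod_ge0.
have {}M0 : 0 <= M.
  have aI : a <= a <= b by rewrite lexx.
  case: M0 => [|/(_ a)//]; rewrite pmulr_lge0// exprn_gt0// divr_gt0//.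
have cT w : ccont (fun s => T s w) a b.
  apply: ccont_unif => e e0.
  pose D := M * vmod w ^+ 2 + 1.
  have D0 : 0 < D by rewrite ltr_wpDl// mulr_ge0// sqr_ge0.
  (* The first bound makes the error M t |w|^2 of the difference quotient at most [e]; the second
     keeps t w within norm rho/8. *)
  pose t := Num.min (e / D) (rho / (8 * (vmod w + 1))).
  have vw1 : 0 < vmod w + 1 by rewrite ltr_wpDl// vmod_ge0.
  have t0 : 0 < t by rewrite lt_min !divr_gt0// mulr_gt0.
  have te : t * D <= e by rewrite -ler_pdivlMr// /t ge_min lexx.
  have tr : vmod (toC t *: w) <= rho / 8.
    rewrite vmodZ cmod_toC gtr0_norm//.
    apply: (@le_trans _ _ (t * (vmod w + 1))).
      by apply: ler_wpM2l; [exact: ltW|rewrite lerDl].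
    by rewrite -ler_pdivlMr// /t ge_min -mulrA -invfM lexx orbT.
  have trr : vmod (toC t *: w) < rho by apply: le_lt_trans tr _; lra.
  have t0' : toC t != 0 by rewrite -toC0 (inj_eq (@toC_inj R)) gt_eqF.
  exists (fun s => (toC t)^-1 * (K s (v0 + toC t *: w) - K s v0)).
    by apply: ccontZ; apply: ccontB => //; exact: cK.
  move=> s sI; have := main s _ sI tr.
  rewrite /T linearZ /= -/(T s w).
  set X := K s _ - K s v0.
  rewrite vmodZ cmod_toC gtr0_norm// => h.
  have -> : T s w - (toC t)^-1 * X = - ((toC t)^-1 * (X - toC t * T s w)) by field.
  rewrite cmodN cmodM cmodV cmod_toC gtr0_norm// mulrC ler_pdivrMr//.
  apply: le_trans h _; apply: (@le_trans _ _ (t * D * t)); last first.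
    by apply: ler_wpM2r; [exact: ltW|exact: te].
  rewrite exprMn /D.
  have -> : t * (M * vmod w ^+ 2 + 1) * t = M * (t ^+ 2 * vmod w ^+ 2) + t ^+ 2 by ring.
  by rewrite lerDl sqr_ge0.
pose L w := cint (fun s => T s w) a b.
have linL : linear L.
  move=> c w w'; change (L (c *: w + w') = c * L w + L w').
  rewrite /L -cintZ// -cintD//; last exact: ccontZ.
  by apply: eq_cint => s _; rewrite /T linearP.
pose LL : {linear V -> C} := HB.pack_for {linear V -> C} L (GRing.isLinear.Build C V C _ L linL).
have LLE w : LL w = cint (fun s => T s w) a b by [].
(* A bound for the differentials at vectors of norm rho/8, extended to all vectors by linearity. *)
pose N := (2 * B + M * (rho / 8) ^+ 2) * 8 / rho.
have TN s w : a <= s <= b -> cmod (T s w) <= N * vmod w.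
  move=> sI; have [->|w0] := eqVneq w 0; first by rewrite /T linear0 cmod0 vmod0 mulr0.
  have vw0 : 0 < vmod w by rewrite lt_def vmod_eq0 w0 vmod_ge0.
  pose t := rho / (8 * vmod w).
  have t0 : 0 < t by rewrite divr_gt0// mulr_gt0.
  have tw : vmod (toC t *: w) = rho / 8.
    by rewrite vmodZ cmod_toC gtr0_norm// /t; field; rewrite gt_eqF.
  have twr : vmod (toC t *: w) < rho by rewrite tw; lra.
  have := main s (toC t *: w) sI; rewrite tw lexx => /(_ isT) h1.
  have h2 := BK s _ sI twr; have h3 : cmod (K s v0) <= B.
    by have := BK s 0 sI; rewrite vmod0 addr0; exact.
  have h4 : cmod (T s (toC t *: w)) <= 2 * B + M * (rho / 8) ^+ 2.
    have -> : T s (toC t *: w) = K s (v0 + toC t *: w) - K s v0 -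
      (K s (v0 + toC t *: w) - K s v0 - T s (toC t *: w)) by ring.
    apply: le_trans (cmodD _ _) _; rewrite cmodN; apply: lerD => //.
    apply: le_trans (cmodD _ _) _; rewrite cmodN mulr_natl mulr2n; exact: lerD.
  move: h4; rewrite /T linearZ /= -/(T s w) cmodM cmod_toC gtr0_norm//.
  rewrite -ler_pdivlMl// => /le_trans; apply; apply/eq_ler.
  by rewrite /N /t; field; rewrite !gt_eqF.
apply: (@diffV_of _ _ _ _ LL (2 * (N * (b - a)))).
  move=> w; rewrite LLE.
  have -> : 2 * (N * (b - a)) * vmod w = 2 * (N * vmod w * (b - a)) by ring.
  by apply: cint_bound => // s sI; exact: TN.
move=> e e0.
pose Q := 2 * (M * (b - a)) + 1.
have Q00 : 0 <= 2 * (M * (b - a)).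
  by apply: mulr_ge0 => //; apply: mulr_ge0 => //; rewrite subr_ge0.
have Q0 : 0 < Q by rewrite ltr_wpDl.
exists (Num.min (rho / 8) (e / Q)); first by rewrite lt_min !divr_gt0.
move=> w; rewrite lt_min => /andP[wr we]; rewrite LLE.
have wr' : vmod w < rho by apply: lt_trans wr _; lra.
rewrite -cintB//; last exact: cK.
rewrite -cintB//; last by apply: ccontB => //; exact: cK.
apply: (@le_trans _ _ (2 * (M * vmod w ^+ 2 * (b - a)))).
  apply: cint_bound => //.
    by apply: ccontB => //; apply: ccontB => //; exact: cK.
  by move=> s sI; apply: main => //; exact: ltW.
have -> : 2 * (M * vmod w ^+ 2 * (b - a)) = 2 * (M * (b - a)) * vmod w * vmod w by ring.
apply: ler_wpM2r; first exact: vmod_ge0.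
apply: (@le_trans _ _ (Q * vmod w)); first by apply: ler_wpM2r; [exact: vmod_ge0|rewrite lerDl].
by rewrite mulrC -ler_pdivlMr//; exact: ltW.
Qed.

End DUI.

(** * Contour integrals depending on a parameter *)

Section LoopDiff.
Variable R : realType.
Local Notation C := (Cplx R).

Section Pair.
Variables U V : normedModType C.
Local Notation UV := (U * V)%type.

Lemma vmod_pair (u : U) (v : V) : vmod ((u, v) : UV) = Num.max (vmod u) (vmod v).
Proof.
apply: (@toC_inj R); rewrite -normVE prod_normE /=.
have [h|h] := leP (vmod u) (vmod v).
  by rewrite max_r normVE ?normVE// le_toC.
by rewrite max_l normVE ?normVE// le_toC ltW.
Qed.

Lemma dfst (p : UV) : differentiable (fun q : UV => q.1) p.
Proof.
have linf : linear (fun q : UV => q.1) by [].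
pose L : {linear UV -> U} := HB.pack_for {linear UV -> U} (fun q : UV => q.1)
  (GRing.isLinear.Build C UV U _ _ linf).
apply: (@linear_differentiable _ _ _ L) => x.
exact: cvg_fst.
Qed.

Lemma dsnd (p : UV) : differentiable (fun q : UV => q.2) p.
Proof.
have linf : linear (fun q : UV => q.2) by [].
pose L : {linear UV -> V} := HB.pack_for {linear UV -> V} (fun q : UV => q.2)
  (GRing.isLinear.Build C UV V _ _ linf).
apply: (@linear_differentiable _ _ _ L) => x.
exact: cvg_snd.
Qed.

End Pair.

(** The tube lemma: compactness of the segment turns local conditions in (s, v) into one
    neighbourhood of [v0] and one bound. *)
Lemma near_segment_uniform (V : topologicalType) (a b : R) (v0 : V)
    (P : R -> V -> Prop) (N : R -> V -> R) :
  (forall s, a <= s <= b -> exists B, \forall t \near s & v \near v0, P t v /\ N t v <= B) ->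
  exists B, \forall v \near v0, forall s, a <= s <= b -> P s v /\ N s v <= B.
Proof.
move=> h.
have /compact_near_coveringP cov := @segment_compact R a b.
(* The bound is made a second parameter tending to infinity, so that a single use of compactness
   yields the uniform neighbourhood and the uniform bound together. *)
pose F := filter_prod (nbhs v0) (pinfty_nbhs R).
have := cov (V * R)%type F (fun i s => P s i.1 /\ N s i.1 <= i.2) _.
case.
  move=> s /=; rewrite in_itv /= => /h[B [[A D] /= [sA vD] AD]].
  exists (A, [set i | D i.1 /\ B <= i.2]) => /=.
    split=> //; exists (D, [set x | B <= x]) => //=.
    by split=> //; apply: nbhs_pinfty_ge; exact: num_real.
  move=> [t [v x]] /= [At [Dv Bx]]; have [] := AD (t, v) (conj At Dv) => /= Ptv NB.
  by split=> //; exact: le_trans Bx.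
move=> [D E] /= [vD [M [_ ME]]] DE; exists (M + 1).
apply: filterS vD => v Dv s sI.
have := DE (v, M + 1); apply; first by split=> //; apply: ME; rewrite ltrDl.
by rewrite /= in_itv.
Qed.

(** By compactness, joint holomorphy near the contour provides the uniform domain and bound that
    [dui] asks for, one side at a time. *)
Lemma loop_diff (V : normedModType C) (H : (C * V)%type -> C) (r : R) (v0 : V) :
  (forall k s, -1 <= s <= 1 ->
     \forall p \near ((toC r * sq k s, v0) : (C * V)%type), differentiable H p) ->
  differentiable (fun v => loop (fun z => H (z, v)) r) v0.
Proof.
move=> dH.
have csq k s : {for s, continuous (fun s => toC r * sq k s : C)}.
  apply/cvgrPdist_lt => e e0; have e0' := e0; rewrite lt_def in e0'.
  case/andP: e0' => _ /ger0_real; case/complex_realP => x.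
  rewrite -[(x%:C)%C]/(toC x) => ex.
  have x0 : 0 < x by move: e0; rewrite ex -toC0 lt_toC.
  apply/nearR; exists (x / (`|r| + 1)); first by rewrite divr_gt0// ltr_wpDl.
  move=> t ts; rewrite normCE ex lt_toC.
  have -> : toC r * sq k s - toC r * sq k t = toC r * imI ^+ k.+1 * toC (s - t).
    by rewrite /sq exprSr toCB; ring.
  rewrite !cmodM cmod_imIX !cmod_toC mulr1 distrC.
  apply: (@le_lt_trans _ _ ((`|r| + 1) * `|t - s|)).
    by apply: ler_wpM2r => //; rewrite lerDl.
  by rewrite mulrC -ltr_pdivlMr// ltr_wpDl.
have side k : differentiable (fun v =>
    cint (fun s => H (toC r * sq k s, v) * (toC r * imI ^+ k.+1)) (-1) 1) v0.
  have [|B] := @near_segment_uniform V (-1) 1 v0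
     (fun s v => differentiable H (toC r * sq k s, v))
     (fun s v => cmod (H (toC r * sq k s, v))).
    move=> s sI; exists (cmod (H (toC r * sq k s, v0)) + 1).
    have dp := dH k s sI.
    have cH : {for (toC r * sq k s, v0), continuous H}.
      by apply: differentiable_continuous; exact: nbhs_singleton dp.
    have /contVP /(_ 1 ltr01) /nearV cH1 := cH.
    have [[A D] /= [sA vD] AD] := filterI dp cH1.
    exists ([set t | A (toC r * sq k t)], D) => /=.
      by split=> //; exact: (csq k s).
    move=> [t v] /= [At Dv]; have [d1 d2] := AD (_, _) (conj At Dv); split=> //.
    rewrite -[H (_, v)](subrK (H (toC r * sq k s, v0))) addrC.
    by apply: le_trans (cmodD _ _) _; rewrite lerD2l ltW.
  move=> /nearV[rho rho0 h].
  have h' w s : vmod w < rho -> -1 <= s <= 1 ->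
      differentiable H (toC r * sq k s, v0 + w) /\ cmod (H (toC r * sq k s, v0 + w)) <= B.
    by move=> wr sI; apply: h => //; rewrite addrAC subrr add0r.
  apply: (@dui _ _ (fun s v => H (toC r * sq k s, v) * (toC r * imI ^+ k.+1)) _ _ _ rho
    (B * `|r|) (@N1le1 R) rho0).
  - move=> s w sI wr; have [d1 _] := h' w s wr sI.
    apply: dM; last exact: dcst.
    have dp : differentiable (fun v : V => (toC r * sq k s, v)) (v0 + w).
      by apply: differentiable_pair; [exact: differentiable_cst|exact: ex_diff].
    exact: (differentiable_comp dp d1).
  - move=> w wr; apply: ccontM; last exact: ccont_cst.
    apply: (@ccont_comp _ (fun z => H (z, v0 + w))); first exact: ccont_sq.
    move=> s sI; have [d1 _] := h' w s wr sI.
    apply: differentiable_continuous.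
    have dp : differentiable (fun z : C => (z, v0 + w)) (toC r * sq k s).
      by apply: differentiable_pair; [exact: did|exact: differentiable_cst].
    exact: (differentiable_comp dp d1).
  - move=> s w sI wr; have [_ d2] := h' w s wr sI.
    rewrite !cmodM cmod_imIX mulr1 cmod_toC; exact: ler_wpM2r.
have -> : (fun v => loop (fun z => H (z, v)) r) = (fun v =>
  cint (fun s => H (toC r * sq 0 s, v) * (toC r * imI ^+ 1)) (-1) 1 +
  (cint (fun s => H (toC r * sq 1 s, v) * (toC r * imI ^+ 2)) (-1) 1 +
  (cint (fun s => H (toC r * sq 2 s, v) * (toC r * imI ^+ 3)) (-1) 1 +
  cint (fun s => H (toC r * sq 3 s, v) * (toC r * imI ^+ 4)) (-1) 1))).
  by apply/funext => v; rewrite loopE.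
exact: (dD (side 0%N) (dD (side 1%N) (dD (side 2%N) (side 3%N)))).
Qed.

End LoopDiff.

(** * The identity theorem in one variable *)

Section Identity.
Variable R : realType.
Local Notation C := (Cplx R).

Lemma near_cmod_lt (a : C) (r : R) : cmod a < r -> \forall z \near a, cmod z < r.
Proof.
move=> ar; apply/nearC; exists (r - cmod a); first by rewrite subr_gt0.
move=> w wa; rewrite -(subrK a w); apply: le_lt_trans (cmodD _ _) _.
by rewrite -ltrBrDr.
Qed.

Lemma loop_bounded (f : C -> C) r : loop_cont f r ->
  exists B, forall k s, (k < 4)%N -> -1 <= s <= 1 -> cmod (f (toC r * sq k s)) <= B.
Proof.
move=> cf.
have H k : exists B, forall s, -1 <= s <= 1 -> cmod (f (toC r * sq k s)) <= B.
  have cfk : ccont (fun s => f (toC r * sq k s)) (-1) 1.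
    by apply: (@ccont_comp _ f); [exact: ccont_sq|exact: cf].
  (* Applied with a dummy parameter. The conditional keeps the quantity bounded when [t], close to
     an endpoint, leaves the segment. *)
  have [|B hB] := @near_segment_uniform R C (-1) 1 0 (fun _ _ => True)
    (fun s _ => if -1 <= s <= 1 then cmod (f (toC r * sq k s)) else 0); last first.
    by exists B => s sI; have [_] := nbhs_singleton hB s sI; rewrite sI.
  move=> s sI; exists (cmod (f (toC r * sq k s)) + 1).
  have [d d0 hd] := cfk s sI 1 ltr01.
  exists ([set t | `|t - s| < d], setT) => /=.
    by split; [apply/nearR; exists d|exact: filterT].
  move=> [t v] /= [ts _]; split=> //; case: ifP => tI; last by rewrite addr_ge0// cmod_ge0.
  rewrite -[f (toC r * sq k t)](subrK (f (toC r * sq k s))) addrC.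
  by apply: le_trans (cmodD _ _) _; rewrite lerD2l ltW// hd.
have [B0 h0] := H 0%N; have [B1 h1] := H 1%N; have [B2 h2] := H 2%N; have [B3 h3] := H 3%N.
exists (Num.max (Num.max B0 B1) (Num.max B2 B3)) => -[|[|[|[|//]]]] s _ sI; rewrite !le_max.
- by rewrite h0.
- by rewrite h1 ?orbT.
- by rewrite h2 ?orbT.
- by rewrite h3 ?orbT.
Qed.

Lemma hol_on_loop_cont f r : 0 <= r -> hol_on f r -> @loop_cont R f r.
Proof.
by move=> r0 hf k s sI; apply: differentiable_continuous; apply: hf; exact: rsq_le.
Qed.

(** The constant comes from compactness of the contour and is the same for all [k], which allows [k]
    to tend to infinity in [remk_all0]. *)
Lemma remk_le f r : 0 < r -> hol_on f r -> exists B, 0 <= B /\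
  forall k (t : C), cmod t <= r / 2 -> cmod (remk f r k t) <= B / r ^+ k.
Proof.
move=> r0 hf; have [B0 hB0] := loop_bounded (hol_on_loop_cont (ltW r0) hf).
exists (loopk R * `|B0|); split; first by rewrite mulr_ge0 ?loopk_ge0.
move=> k t tr; have tr' : cmod t < r by apply: le_lt_trans tr _; lra.
rewrite /remk cmodM cmodV /loopk.
have -> : 32 / cmod (loopc R) * `|B0| / r ^+ k =
   (cmod (loopc R))^-1 * (16 * (`|B0| / (r ^+ k * (r / 2)) * r)).
  by field; rewrite expf_neq0 ?gt_eqF// cmod_gt0 loopc_neq0.
apply: ler_wpM2l; first by rewrite invr_ge0 cmod_ge0.
have h4 j : (j < 4)%N -> cmod (cint (fun s => (fun z => f z / (z ^+ k * (z - t))) (toC r * sq j s) *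
    (toC r * imI ^+ j.+1)) (-1) 1) <= 4 * (`|B0| / (r ^+ k * (r / 2)) * r).
  move=> j4.
  have -> : 4 * (`|B0| / (r ^+ k * (r / 2)) * r) =
    2 * ((`|B0| / (r ^+ k * (r / 2)) * r) * (1 - -1)) by ring.
  apply: cint_bound; first exact: N1le1.
    apply: (loop_ccont (f := fun z => f z / (z ^+ k * (z - t)))) => i s sI.
    by apply: differentiable_continuous; exact: remk_diff.
  move=> s sI; rewrite /= cmodM [cmod (toC r * imI ^+ _)]cmodM cmod_imIX mulr1 cmod_toC (gtr0_norm r0).
  apply: ler_wpM2r; first exact: ltW.
  rewrite cmodM cmodV cmodM cmodX; set z := toC r * sq j s.
  have zr : r <= cmod z by apply: cmod_rsq_ge; exact: ltW.
  have h1 : r ^+ k <= cmod z ^+ k.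
    by case: (k) => [|n]; [rewrite !expr0|rewrite ler_pXn2r ?nnegrE ?cmod_ge0// ltW].
  have h2 : r / 2 <= cmod (z - t) by apply: le_trans (cmod_sub _ _); lra.
  have rk0 : 0 < r ^+ k by rewrite exprn_gt0.
  have r20 : 0 < r / 2 by rewrite divr_gt0.
  apply: ler_pM; rewrite ?cmod_ge0 ?invr_ge0 ?mulr_ge0 ?exprn_ge0 ?cmod_ge0//.
    by apply: le_trans (ler_norm _); apply: hB0.
  rewrite lef_pV2 ?posrE ?mulr_gt0//.
  - by apply: ler_pM => //; exact: ltW.
  - exact: lt_le_trans h1.
  - exact: lt_le_trans h2.
rewrite loopE.
have -> : 16 * (`|B0| / (r ^+ k * (r / 2)) * r) = 4 * (`|B0| / (r ^+ k * (r / 2)) * r) +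
   (4 * (`|B0| / (r ^+ k * (r / 2)) * r) + (4 * (`|B0| / (r ^+ k * (r / 2)) * r) +
    4 * (`|B0| / (r ^+ k * (r / 2)) * r))) by ring.
apply: le_trans (cmodD _ _) _; apply: lerD; first exact: (h4 0%N isT).
apply: le_trans (cmodD _ _) _; apply: lerD; first exact: (h4 1%N isT).
apply: le_trans (cmodD _ _) _; apply: lerD; [exact: (h4 2%N isT)|exact: (h4 3%N isT)].
Qed.

Lemma remk_expand f r k (t : C) : cmod t < r -> hol_on f r ->
  (forall j, (j < k)%N -> remk f r j 0 = 0) -> f t = t ^+ k * remk f r k t.
Proof.
move=> tr hf; elim: k => [|k IH] h; first by rewrite expr0 mul1r remk0.
rewrite IH; last by move=> j jk; apply: h; exact: ltnW.
by rewrite remkS// h// add0r exprSr mulrA.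
Qed.

(** For every n, f(t) is t^n times the n-th remainder, so |f(t)| <= B / 2^n when |t| <= r/2. *)
Lemma remk_all0 f r : 0 < r -> hol_on f r -> (forall j, remk f r j 0 = 0) ->
  forall t : C, cmod t <= r / 2 -> f t = 0.
Proof.
move=> r0 hf h t tr; have tr' : cmod t < r by apply: le_lt_trans tr _; lra.
have [B [B0 hB]] := remk_le r0 hf.
apply: cmod_small0 => e e0.
have [n hn] : exists n, half_pow R n < e / (B + 1).
  by apply: half_pow_small; rewrite divr_gt0// ltr_wpDl.
rewrite (@remk_expand f r n t tr' hf)// cmodM cmodX.
apply: (@le_trans _ _ ((r / 2) ^+ n * (B / r ^+ n))).
  apply: ler_pM; rewrite ?exprn_ge0 ?cmod_ge0//; last exact: hB.
  by case: (n) => [|m]; [rewrite !expr0|rewrite ler_pXn2r ?nnegrE ?cmod_ge0// divr_ge0// ltW].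
have -> : (r / 2) ^+ n * (B / r ^+ n) = half_pow R n * B.
  rewrite /half_pow !exprMn !exprVn expr1n; field.
  by rewrite !expf_neq0// gt_eqF.
move: hn; rewrite ltr_pdivlMr ?ltr_wpDl// => /ltW; apply: le_trans.
by apply: ler_wpM2l; [exact: ltW (half_pow_gt0 _ _)|rewrite lerDl].
Qed.

(** The Cauchy kernel is holomorphic in [t] as long as [t] stays off the contour, so [loop_diff]
    applies. *)
Lemma remk_differentiable f r k (t : C) : cmod t < r -> hol_on f r ->
  differentiable (remk f r k) t.
Proof.
move=> tr hf; have r0 : 0 < r by apply: le_lt_trans tr; exact: cmod_ge0.
rewrite /remk; apply: dM; first exact: dcst.
apply: (@loop_diff R C (fun p : (C * C)%type => f p.1 / (p.1 ^+ k * (p.1 - p.2)))) => j s sI.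
set z := toC r * sq j s.
have z0 : z ^+ k * (z - t) != 0.
  by rewrite mulf_neq0 ?expf_neq0 ?toC_sq_neq0// subr_eq0 rsq_neq.
have dden (p : (C * C)%type) :
    differentiable (fun p : (C * C)%type => p.1 ^+ k * (p.1 - p.2)) p.
  by apply: dM; [apply: dX; exact: dfst|apply: dB; [exact: dfst|exact: dsnd]].
have zr : cmod z < 2 * r.
  rewrite cmodM cmod_toC (gtr0_norm r0) mulrC ltr_pM2r//.
  by apply: lt_trans (cmod_sq_lt j sI) _; lra.
have n1 : \forall p \near ((z, t) : (C * C)%type), cmod p.1 < 2 * r.
  exact: (@cvg_fst _ _ (nbhs z) (nbhs t)) (near_cmod_lt zr).
have n2 : \forall p \near ((z, t) : (C * C)%type), p.1 ^+ k * (p.1 - p.2) != 0.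
  have := differentiable_continuous (dden (z, t)).
  by move=> /cvgr_neq0; apply.
near=> p; apply: dM.
  apply: dcomp; first exact: dfst.
  by apply: hf; apply: ltW; near: p.
apply: dV; last exact: dden.
by near: p.
Unshelve. all: by end_near. Qed.

(** With [k] the index of the first nonzero Taylor coefficient, f(t) is t^k times a function
    continuous and nonzero at 0. *)
Lemma identity_dichotomy f r : 0 < r -> hol_on f r ->
  (forall t : C, cmod t <= r / 2 -> f t = 0) \/
  (exists2 d, 0 < d & forall t : C, 0 < cmod t < d -> f t != 0).
Proof.
move=> r0 hf; have [h|h] := pselect (forall j, remk f r j 0 = 0).
  by left; exact: remk_all0.
right; have /existsNP[j0 /eqP hj0] := h.
have ex : exists j, remk f r j 0 != 0 by exists j0.
have [k hk kmin] := ex_minnP ex.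
have c0 : cmod 0 < r by rewrite cmod0.
have /contVP /(_ (cmod (remk f r k 0))) := differentiable_continuous (remk_differentiable k c0 hf).
rewrite cmod_gt0 => /(_ hk)[d d0 hd].
exists (Num.min d r); first by rewrite lt_min d0.
move=> t /andP[t0]; rewrite lt_min => /andP[td tr].
rewrite (@remk_expand f r k t tr hf); last first.
  by move=> j jk; apply/eqP/negPn/negP => /kmin; rewrite leqNgt jk.
apply: mulf_neq0; first by rewrite expf_neq0// -cmod_gt0.
apply/negP => /eqP e; have := hd t; rewrite subr0 vmodCE => /(_ td).
by rewrite e sub0r cmodN ltxx.
Qed.

End Identity.

(** * Factoring a power of w out of a holomorphic function of two variables *)

Section Weierstrass.
Variable R : realType.
Local Notation C := (Cplx R).
Local Notation CC := (C * C)%type.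
Variables (F : CC -> C) (rho r : R).
Hypotheses (rho0 : 0 < rho) (r0 : 0 < r).
Hypothesis dF : forall x w, cmod x <= 2 * rho -> cmod w <= 2 * r -> differentiable F (x, w).

Definition fiber_rem k (p : CC) : C := remk (fun w => F (p.1, w)) r k p.2.

Lemma fiber_hol x : cmod x <= 2 * rho -> hol_on (fun w => F (x, w)) r.
Proof.
move=> xr w wr; have dp : differentiable (fun w : C => (x, w)) w.
  by apply: differentiable_pair; [exact: differentiable_cst|exact: did].
exact: (differentiable_comp dp (dF xr wr)).
Qed.

Lemma fiber_rem_diff k x w : cmod x < 2 * rho -> cmod w < r ->
  differentiable (fiber_rem k) (x, w).
Proof.
move=> xr wr; rewrite /fiber_rem /remk; apply: dM; first exact: dcst.
apply: (@loop_diff R CC (fun q : (C * CC)%type =>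
  F (q.2.1, q.1) / (q.1 ^+ k * (q.1 - q.2.2)))) => j s sI.
set z := toC r * sq j s; set q0 : (C * CC)%type := (z, (x, w)).
have zw : z ^+ k * (z - w) != 0.
  by rewrite mulf_neq0 ?expf_neq0 ?toC_sq_neq0// subr_eq0 rsq_neq.
have d1 (q : (C * CC)%type) : differentiable (fun q : (C * CC)%type => q.1) q by exact: dfst.
have d2 (q : (C * CC)%type) : differentiable (fun q : (C * CC)%type => q.2.1) q.
  exact: (differentiable_comp (dsnd q) (dfst q.2)).
have d3 (q : (C * CC)%type) : differentiable (fun q : (C * CC)%type => q.2.2) q.
  exact: (differentiable_comp (dsnd q) (dsnd q.2)).
have dden (q : (C * CC)%type) :
    differentiable (fun q : (C * CC)%type => q.1 ^+ k * (q.1 - q.2.2)) q.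
  by apply: dM; [apply: dX; exact: d1|apply: dB; [exact: d1|exact: d3]].
have zr : cmod z < 2 * r.
  rewrite cmodM cmod_toC (gtr0_norm r0) mulrC ltr_pM2r//.
  by apply: lt_trans (cmod_sq_lt j sI) _; lra.
have n1 : \forall q \near q0, cmod q.1 < 2 * r.
  exact: (differentiable_continuous (d1 q0)) (near_cmod_lt zr).
have n2 : \forall q \near q0, cmod q.2.1 < 2 * rho.
  exact: (differentiable_continuous (d2 q0)) (near_cmod_lt xr).
have n3 : \forall q \near q0, q.1 ^+ k * (q.1 - q.2.2) != 0.
  by have := differentiable_continuous (dden q0); move=> /cvgr_neq0; apply.
near=> q; apply: dM; last first.
  by apply: dV; [near: q|exact: dden].
have dp : differentiable (fun q : (C * CC)%type => (q.2.1, q.1)) q.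
  by apply: differentiable_pair.
apply: (differentiable_comp dp); apply: dF; apply: ltW; near: q; [exact: n2|exact: n1].
Unshelve. all: by end_near. Qed.

Definition fiber_coef k x : C := fiber_rem k (x, 0).

Lemma fiber_coef_hol k : hol_on (fiber_coef k) (rho / 2).
Proof.
move=> x; have -> : 2 * (rho / 2) = rho by field.
move=> xr; have dp : differentiable (fun x : C => (x, 0 : C)) x.
  by apply: differentiable_pair; [exact: did|exact: differentiable_cst].
apply: (differentiable_comp dp); apply: fiber_rem_diff; last by rewrite cmod0.
apply: le_lt_trans xr _. by rewrite ltr_pMl// ltr1n.
Qed.

(** [k] is the least index whose Taylor coefficient in w, as a function of [x], does not vanish
    identically near 0; by [identity_dichotomy] that coefficient has no zero close to 0 except
    possibly 0 itself. The cofactor [G] may vanish at the origin, where another component of the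
    zero set can cross w = 0. *)
Lemma weierstrass_dichotomy :
  (forall x w, cmod x <= rho / 4 -> cmod w <= r / 2 -> F (x, w) = 0) \/
  exists k d (G : CC -> C), [/\ 0 < d,
    forall x w, cmod x < d -> cmod w < d -> F (x, w) = w ^+ k * G (x, w),
    forall x, 0 < cmod x < d -> G (x, 0) != 0 &
    forall x w, cmod x < d -> cmod w < d -> {for (x, w), continuous G}].
Proof.
have rho20 : 0 < rho / 2 by rewrite divr_gt0.
pose Z k := forall x, cmod x <= rho / 4 -> fiber_coef k x = 0.
have [h|/existsNP[k0 hk0]] := pselect (forall k, Z k).
  left=> x w xr wr; have xr2 : cmod x <= 2 * rho by apply: le_trans xr _; lra.
  have := remk_all0 r0 (fiber_hol xr2) _ wr; apply=> j.
  exact: h.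
right.
have ex : exists k, ~~ `[< Z k >] by exists k0; apply/asboolP.
have [k /asboolP hk kmin] := ex_minnP ex.
have [h|[d d0 hd]] := identity_dichotomy rho20 (fiber_coef_hol k).
  by exfalso; apply: hk => x xr; apply: h; apply: le_trans xr _; lra.
exists k, (Num.min d (Num.min (rho / 4) r)), (fiber_rem k); split.
- by rewrite !lt_min d0 r0 divr_gt0.
- move=> x w; rewrite !lt_min => /andP[_ /andP[xr _]] /andP[_ /andP[_ wr]].
  have xr2 : cmod x <= 2 * rho by apply: le_trans (ltW xr) _; lra.
  rewrite (remk_expand (k := k) wr (fiber_hol xr2))// => j jk.
  have /asboolP : `[< Z j >] by apply/negPn/negP => /kmin; rewrite leqNgt jk.
  by apply; exact: ltW.
- by move=> x /andP[x0]; rewrite lt_min => /andP[xd _]; apply: hd; rewrite x0.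
- move=> x w; rewrite !lt_min => /andP[_ /andP[xr _]] /andP[_ /andP[_ wr]].
  apply: differentiable_continuous; apply: fiber_rem_diff => //.
  by apply: lt_trans xr _; lra.
Qed.

End Weierstrass.

(** * Exponential and logarithm *)

Section ComplexExp.
Variable R : realType.
Local Notation C := (Cplx R).

Definition cexp (z : C) : C := mkC (expR (cRe z) * cos (cIm z)) (expR (cRe z) * sin (cIm z)).

Lemma cexpD z w : cexp (z + w) = cexp z * cexp w.
Proof.
apply: ReIm_ext; rewrite ?cReM ?cImM /cexp !cRe_mk !cIm_mk cReD cImD expRD ?cosD ?sinD; ring.
Qed.

Lemma cexp0 : cexp 0 = 1.
Proof.
by apply: ReIm_ext; rewrite /cexp ?cRe_mk ?cIm_mk /cRe /cIm /= expR0 ?cos0 ?sin0 ?mulr1 ?mulr0.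
Qed.

Lemma cmod_cexp z : cmod (cexp z) = expR (cRe z).
Proof.
apply/eqP; rewrite -(@eqrXn2 _ 2)// ?cmod_ge0 ?expR_ge0// cmod_sqr cRe_mk cIm_mk.
by rewrite !exprMn -mulrDr cos2Dsin2 mulr1.
Qed.

Lemma cexp_neq0 z : cexp z != 0.
Proof. by rewrite -cmod_gt0 cmod_cexp expR_gt0. Qed.

Lemma cexpN z : cexp (- z) = (cexp z)^-1.
Proof.
by apply: (mulfI (cexp_neq0 z)); rewrite -cexpD subrr cexp0 mulfV ?cexp_neq0.
Qed.

Lemma is_derive_eps (g : R -> R) (l : R) : is_derive (0 : R) 1 g l ->
  forall e, 0 < e -> exists2 d, 0 < d & forall x, `|x| < d -> `|g x - g 0 - l * x| <= e * `|x|.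
Proof.
move=> [dg gl] e e0; move: dg; rewrite /derivable => /cvg_ex[/= l' gl'].
have ll' : l = l' by rewrite -gl /derive; exact: cvg_lim.
have /cvgrPdist_le /(_ e e0) := gl'.
move=> /nbhs_ballP[d /= d0 hd]; exists d => // x xd.
have [->|x0] := eqVneq x 0; first by rewrite subrr mulr0 subrr normr0 mulr0.
have := hd x; rewrite /ball /= sub0r normrN => /(_ xd x0).
rewrite addr0 /GRing.scale /= mulr1 => h.
have -> : g x - g 0 - l * x = - (x * (l - x^-1 * (g x - g 0))) by field.
by rewrite normrN normrM mulrC ll'; apply: ler_wpM2r.
Qed.

(** Assembled from the derivatives at 0 of the real functions [expR], [cos] and [sin]. *)
Lemma cexp_near0 (e : R) : 0 < e -> exists2 d, 0 < d & forall h : C, cmod h < d ->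
  cmod (cexp h - 1 - h) <= e * cmod h.
Proof.
(* The real and the imaginary part each have error at most 3 k |h|, in total 6 k |h|; [k <= 1]
   serves to bound [expR a] by 2. *)
move=> e0; pose k := Num.min 1 (e / 8).
have k0 : 0 < k by rewrite lt_min ltr01 divr_gt0.
have k1 : k <= 1 by rewrite /k ge_min lexx.
have ke : k * 8 <= e by rewrite -ler_pdivlMr// /k ge_min lexx orbT.
have dexp : is_derive (0 : R) 1 (@expR R) 1.
  by have := is_derive_expR (0 : R); rewrite expR0.
have dcos : is_derive (0 : R) 1 (@cos R) 0.
  by have := is_derive_cos (0 : R); rewrite sin0 oppr0.
have dsin : is_derive (0 : R) 1 (@sin R) 1.
  by have := is_derive_sin (0 : R); rewrite cos0.
have [d1 d10 h1] := is_derive_eps dexp k0.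
have [d2 d20 h2] := is_derive_eps dcos k0.
have [d3 d30 h3] := is_derive_eps dsin k0.
exists (Num.min (Num.min d1 d2) (Num.min d3 (k / 2))).
  by rewrite !lt_min d10 d20 d30 divr_gt0.
move=> h; rewrite !lt_min => /andP[/andP[hd1 hd2] /andP[hd3 hk]].
pose a := cRe h; pose b := cIm h.
have ah : `|a| <= cmod h := cRe_le h.
have bh : `|b| <= cmod h := cIm_le h.
have {}h1 := h1 a (le_lt_trans ah hd1).
have {}h2 := h2 b (le_lt_trans bh hd2).
have {}h3 := h3 b (le_lt_trans bh hd3).
rewrite expR0 mul1r in h1; rewrite cos0 mul0r subr0 in h2; rewrite sin0 mul1r subr0 in h3.
have m0 := cmod_ge0 h; set m := cmod h in ah bh hk m0 *.
set E := expR a in h1; set c := cos b in h2; set s := sin b in h3.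
have kam : k * `|a| <= k * m by apply: ler_wpM2l => //; exact: ltW.
have kbm : k * `|b| <= k * m by apply: ler_wpM2l => //; exact: ltW.
have km : k * m <= m by rewrite -{2}(mul1r m); apply: ler_wpM2r.
have E1 : `|E - 1| <= k.
  have -> : E - 1 = (E - 1 - a) + a by ring.
  by apply: le_trans (ler_normD _ _) _; lra.
have E2 : `|E| <= 2.
  have -> : E = (E - 1) + 1 by ring.
  by apply: le_trans (ler_normD _ _) _; rewrite normr1; lra.
have re : `|cRe (cexp h - 1 - h)| <= 3 * (k * m).
  have -> : cRe (cexp h - 1 - h) = E * (c - 1) + (E - 1 - a).
    rewrite !cReD !cReN cRe_mk -/a -/b -/E -/c.
    by have -> : cRe (1 : C) = 1 by []; ring.
  apply: le_trans (ler_normD _ _) _; rewrite normrM.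
  have : `|E| * `|c - 1| <= 2 * (k * m).
    by apply: ler_pM => //; exact: le_trans h2 _.
  lra.
have im : `|cIm (cexp h - 1 - h)| <= 3 * (k * m).
  have -> : cIm (cexp h - 1 - h) = E * (s - b) + (E - 1) * b.
    rewrite !cImD !cImN cIm_mk -/a -/b -/E -/s.
    by have -> : cIm (1 : C) = 0 by []; ring.
  apply: le_trans (ler_normD _ _) _; rewrite !normrM.
  have : `|E| * `|s - b| <= 2 * (k * m).
    by apply: ler_pM => //; exact: le_trans h3 _.
  have : `|E - 1| * `|b| <= k * m by apply: ler_pM.
  lra.
apply: le_trans (cmod_le_ReIm _) _.
have : k * 8 * m <= e * m by apply: ler_wpM2r.
have k0m : 0 <= k * m by apply: mulr_ge0 => //; exact: ltW.
rewrite [k * 8]mulrC -mulrA; lra.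
Qed.

Lemma diffC_of (f : C -> C) (a l : C) :
  (forall e : R, 0 < e -> exists2 d : R, 0 < d & forall z, cmod (z - a) < d ->
    cmod (f z - f a - (z - a) * l) <= e * cmod (z - a)) -> differentiable f a.
Proof.
move=> h.
have linl : linear (fun z : C => z * l).
  by move=> c z w; rewrite mulrDl; change (c * z * l + w * l = c * (z * l) + w * l); rewrite mulrA.
pose L : {linear C -> C} := HB.pack_for {linear C -> C} (fun z : C => z * l)
  (GRing.isLinear.Build C C C _ _ linl).
apply: (@diffV_of _ _ f a L (cmod l)).
  by move=> w; rewrite vmodCE /L /= cmodM mulrC.
move=> e e0; have [d d0 hd] := h e e0; exists d => // w; rewrite vmodCE => wd.
have := hd (a + w); rewrite addrAC subrr add0r => /(_ wd); exact.
Qed.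

(** The functional equation reduces this to the expansion at 0. *)
Lemma cexp_eps z (e : R) : 0 < e -> exists2 d : R, 0 < d & forall w, cmod (w - z) < d ->
  cmod (cexp w - cexp z - (w - z) * cexp z) <= e * cmod (w - z).
Proof.
move=> e0.
have z0 : 0 < cmod (cexp z) by rewrite cmod_gt0 cexp_neq0.
have [d d0 hd] := cexp_near0 (divr_gt0 e0 z0).
exists d => // w wd; have -> : cexp w - cexp z - (w - z) * cexp z =
    cexp z * (cexp (w - z) - 1 - (w - z)).
  by rewrite -{1}(subrK z w) cexpD; ring.
rewrite cmodM mulrC; have := hd _ wd; rewrite -ler_pdivlMr// => h.
by apply: le_trans h _; apply/eq_ler; field; rewrite gt_eqF.
Qed.

Lemma dcexp z : differentiable cexp z.
Proof. by apply: (@diffC_of _ _ (cexp z)) => e; exact: cexp_eps. Qed.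

Lemma sin_atan (x : R) : sin (atan x) = x / Num.sqrt (1 + x ^+ 2).
Proof.
have c0 : cos (atan x) != 0.
  by rewrite cos_atan invr_neq0// gt_eqF// sqrtr_gt0 ltr_wpDr// sqr_ge0.
by rewrite -cos_atan -{2}(atanK x) /tan divfK.
Qed.

(** The principal branch in a form valid on the right half-plane, where the argument is the
    arctangent of the slope. *)
Definition clog (z : C) : C := mkC (ln (cmod z)) (atan (cIm z / cRe z)).

Lemma clogK z : 0 < cRe z -> cexp (clog z) = z.
Proof.
move=> x0; have z0 : 0 < cmod z.
  by rewrite cmod_gt0; apply/negP => /eqP e; move: x0; rewrite e /cRe /= ltxx.
set x := cRe z in x0 *; set y := cIm z.
have zE : cmod z = x * Num.sqrt (1 + (y / x) ^+ 2).
  apply/eqP; rewrite -(@eqrXn2 _ 2)// ?cmod_ge0 ?mulr_ge0 ?sqrtr_ge0 ?(ltW x0)//.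
  rewrite exprMn sqr_sqrtr; last by rewrite addr_ge0// sqr_ge0.
  by apply/eqP; rewrite cmod_sqr -/x -/y; field; rewrite gt_eqF.
have s0 : Num.sqrt (1 + (y / x) ^+ 2) != 0.
  by rewrite gt_eqF// sqrtr_gt0 ltr_wpDr// sqr_ge0.
apply: ReIm_ext; rewrite /cexp /clog cRe_mk cIm_mk ?cRe_mk ?cIm_mk lnK ?posrE// zE -/x -/y.
  by rewrite cos_atan; field.
by rewrite sin_atan; field; rewrite s0 gt_eqF.
Qed.

Lemma continuous_clog (z : C) : 0 < cRe z -> {for z, continuous clog}.
Proof.
move=> x0; have z0 : 0 < cmod z.
  by rewrite cmod_gt0; apply/negP => /eqP e; move: x0; rewrite e /cRe /= ltxx.
have cR (T : C -> R) : (forall z w, `|T z - T w| <= cmod (z - w)) -> {for z, continuous T}.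
  move=> hT; apply/(@cvgrPdist_lt R R C (nbhs z) (nbhs_filter z)) => e e0; apply/(@nearC R); exists e => // w wz.
  by rewrite distrC; apply: le_lt_trans (hT _ _) wz.
have cmodl : {for z, continuous (@cmod R)}.
  apply: cR => u v; rewrite ler_norml; have := cmod_sub v u; have := cmod_sub u v.
  by rewrite (cmodB v u) => h1 h2; apply/andP; split; lra.
have cRe1 : {for z, continuous (@cRe R)} by apply: cR; exact: cRe_lip.
have cIm1 : {for z, continuous (@cIm R)} by apply: cR; exact: cIm_lip.
have c1 : {for z, continuous (fun w => ln (cmod w))}.
  by apply: (@continuous_comp _ _ _ (@cmod R) (@ln R)) => //; exact: continuous_ln.
have c2 : {for z, continuous (fun w => atan (cIm w / cRe w))}.
  apply: (@continuous_comp _ _ _ (fun w => cIm w / cRe w) (@atan R)); last exact: continuous_atan.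
  by apply: (cvgM cIm1); apply: cvgV; [rewrite gt_eqF|exact: cRe1].
apply/contVP => e e0; have e20 : 0 < e / 2 by rewrite divr_gt0.
have /cvgrPdist_lt /(_ _ e20) n1 := c1; have /cvgrPdist_lt /(_ _ e20) n2 := c2.
apply/(@nearV R C) ; apply: filterS2 n1 n2 => w h1 h2.
apply: le_lt_trans (cmod_le_ReIm _) _; rewrite cReD cReN cImD cImN !cRe_mk !cIm_mk.
by rewrite (splitr e) distrC [X in _ + X]distrC; exact: ltrD.
Qed.

(** The derivative of an inverse function: the expansion of [cexp] at [clog z] is read backwards,
    and continuity of [clog] brings [clog w] into its range. *)
Lemma dclog z : 0 < cRe z -> differentiable clog z.
Proof.
move=> x0; have z0 : 0 < cmod z.
  by rewrite cmod_gt0; apply/negP => /eqP e; move: x0; rewrite e /cRe /= ltxx.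
have z0' : z != 0 by rewrite -cmod_gt0.
apply: (@diffC_of _ _ z^-1) => e e0.
(* The first bound yields |clog w - clog z| |z| / 2 <= |w - z|; the second then turns the error of
   [cexp] into [e * cmod (w - z)]. *)
pose k := Num.min (cmod z / 2) (e * cmod z ^+ 2 / 2).
have k0 : 0 < k by rewrite lt_min !divr_gt0// mulr_gt0// exprn_gt0.
have kz : k <= cmod z / 2 by rewrite /k ge_min lexx.
have ke : k <= e * cmod z ^+ 2 / 2 by rewrite /k ge_min lexx orbT.
have [d d0 hd] := cexp_eps (clog z) k0.
have /contVP /(_ d d0)[d' d'0 hd'] := continuous_clog x0.
exists (Num.min d' (cRe z)); first by rewrite lt_min d'0.
move=> w; rewrite lt_min => /andP[wd wx].
have xw : 0 < cRe w.
  have := cRe_le (w - z); rewrite cReD cReN => h.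
  have := ler_norm (- (cRe w - cRe z)); rewrite normrN; lra.
have := hd' w; rewrite vmodCE => /(_ wd) /hd.
rewrite !clogK// => h.
set u := clog w - clog z in h.
have h2 : cmod u * (cmod z / 2) <= cmod (w - z).
  have : cmod (u * z) - cmod (w - z) <= cmod (u * z - (w - z)) by exact: cmod_sub.
  rewrite (cmodB (u * z)) cmodM.
  have : k * cmod u <= cmod z / 2 * cmod u by apply: ler_wpM2r => //; exact: cmod_ge0.
  lra.
have -> : u - (w - z) / z = - ((w - z - u * z) / z) by field.
rewrite cmodN cmodM cmodV ler_pdivrMr//; apply: le_trans h _.
apply: (@le_trans _ _ (e * cmod z ^+ 2 / 2 * cmod u)).
  by apply: ler_wpM2r => //; exact: cmod_ge0.
have -> : e * cmod z ^+ 2 / 2 * cmod u = e * cmod z * (cmod u * (cmod z / 2)) by field.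
rewrite [leRHS]mulrAC; apply: ler_wpM2l => //.
by apply: mulr_ge0; exact: ltW.
Qed.

End ComplexExp.

(** * The Wiener-Hopf factorisation *)

Section LaurentSplit.
Variable R : realType.
Local Notation C := (Cplx R).

Lemma diff_near_eq (f g : C -> C) (a : C) : (\forall z \near a, f z = g z) ->
  differentiable f a -> differentiable g a.
Proof.
move=> fg df; apply: (@diffC_of _ _ _ ('d f a 1)) => e e0.
have [d d0 hd] := diffC_eps df e0.
have /nearC[d' d'0 hd'] := fg.
exists (Num.min d d'); first by rewrite lt_min d0.
move=> z; rewrite lt_min => /andP[zd zd'].
rewrite -(hd' z zd') -(hd' a); last by rewrite subrr cmod0.
exact: hd.
Qed.

(** The value filling the removable singularity is the Cauchy coefficient [remk g r 1 0]. *)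
Lemma diff_quotient (f : C -> C) (a : C) : (\forall z \near a, differentiable f z) ->
  exists q : C -> C, (forall z, z != a -> q z = (f z - f a) / (z - a)) /\ differentiable q a.
Proof.
move=> /nearC[d d0 hd].
pose r := d / 4; have r0 : 0 < r by rewrite divr_gt0.
pose g t := f (a + t).
have hg : hol_on g r.
  move=> t tr; rewrite /g; apply: (@dcomp _ _ f (fun t => a + t)).
    by apply: dD; [exact: dcst|exact: did].
  apply: hd; rewrite addrAC subrr add0r; apply: le_lt_trans tr _.
  by rewrite /r; lra.
have c0 : cmod 0 < r by rewrite cmod0.
exists (fun z => if z == a then remk g r 1 0 else (f z - f a) / (z - a)); split.
  by move=> z /negPf ->.
apply: (@diff_near_eq (fun z => remk g r 1 (z - a))); last first.
  apply: (@dcomp _ _ (remk g r 1) (fun z => z - a)).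
    by apply: dB; [exact: did|exact: dcst].
  by apply: remk_differentiable => //; rewrite subrr cmod0.
apply/nearC; exists r => // z zr; case: eqVneq => [->|za]; first by rewrite subrr.
have za0 : z - a != 0 by rewrite subr_eq0.
have := remkS 0 zr hg; rewrite (remk0 zr hg) (remk0 c0 hg) /g addr0 subrKC => ->.
by field.
Qed.

Lemma sq_range r k s : -1 <= s <= 1 -> 1 <= r <= 2 -> 1 <= cmod (toC r * @sq R k s) <= 3.
Proof.
move=> sI /andP[r1 r2]; have r0 : 0 <= r by lra.
apply/andP; split; first exact: le_trans r1 (cmod_rsq_ge _ _ r0).
rewrite cmodM cmod_toC (ger0_norm r0); apply: (@le_trans _ _ (2 * (3 / 2))); last by lra.
by apply: ler_pM; rewrite ?cmod_ge0// ltW// cmod_sq_lt.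
Qed.

(** The difference quotient [q] of [L] at [x] extends across [x], so its integrals over both squares
    agree. The point [x] is inside the larger square, where (z - x)^-1 integrates to [loopc R], and
    outside the smaller one, where it integrates to 0. *)
Lemma laurent_split (L : C -> C) (x : C) :
  (forall z, 1 <= cmod z <= 3 -> differentiable L z) ->
  (forall z, 1 <= cmod z <= 3 -> \forall w \near z, differentiable L w) ->
  3 / 2 < cmod x < 2 ->
  loop (fun z => L z / (z - x)) 2 - loop (fun z => L z / (z - x)) 1 = loopc R * L x.
Proof.
move=> dL nL /andP[x1 x2].
have xI : 1 <= cmod x <= 3 by apply/andP; split; lra.
have [q [qE dq]] := diff_quotient (nL x xI).
have ptI k s r := @sq_range r k s.
have nx1 k s : -1 <= s <= 1 -> toC 1 * sq k s != x.
  move=> sI; apply/negP => /eqP e; move: x1; rewrite -e toC1 mul1r ltNge.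
  by rewrite ltW// cmod_sq_lt.
have nx2 k s : toC 2 * sq k s != x.
  apply/negP => /eqP e; move: x2; rewrite -e ltNge cmod_rsq_ge//.
have dqz z : 1 <= cmod z <= 3 -> differentiable q z.
  move=> zI; have [->|zx] := eqVneq z x; first exact: dq.
  apply: (@diff_near_eq (fun z => (L z - L x) / (z - x))); last first.
    apply: (@dquot _ (fun z => L z - L x)); first exact: zx.
    by apply: dB; [exact: dL|exact: dcst].
  have zx0 : 0 < cmod (z - x) by rewrite cmod_gt0 subr_eq0.
  apply/nearC; exists (cmod (z - x)) => // w wz; rewrite qE//.
  by apply/negP => /eqP e; move: wz; rewrite e cmodB ltxx.
have E : loop q 1 = loop q 2.
  apply: loop_const; first by lra.
  by move=> k s r sI rI; apply: dqz; exact: ptI.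
have one : 1 <= (1 : R) <= 2 by rewrite lexx ler1n.
have two : 1 <= (2 : R) <= 2 by rewrite lexx andbT ler1n.
have split r : 1 <= r <= 2 -> (forall k s, -1 <= s <= 1 -> toC r * sq k s != x) ->
    loop q r = loop (fun z => L z / (z - x)) r - L x * loop (fun z => (z - x)^-1) r.
  move=> rI nx.
  have dinv k s : -1 <= s <= 1 -> differentiable (fun z : C => (z - x)^-1) (toC r * sq k s).
    move=> sI; apply: (@dV _ _ (fun z : C => z - x)); first by rewrite subr_eq0 nx.
    by apply: dB; [exact: did|exact: dcst].
  have c1 : loop_cont (fun z => (z - x)^-1) r.
    by move=> k s sI; apply: differentiable_continuous; exact: dinv.
  have c2 : loop_cont (fun z => L z / (z - x)) r.
    move=> k s sI; apply: differentiable_continuous; apply: dM; last exact: dinv.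
    by apply: dL; exact: ptI.
  have c3 : loop_cont (fun z => L x * (z - x)^-1) r.
    move=> k s sI; apply: differentiable_continuous; apply: dM; last exact: dinv.
    exact: dcst.
  rewrite -(loopZ (L x) c1) -(loopB c2 c3); apply: eq_loop => k s sI.
  by rewrite qE ?nx// mulrBl.
have s1 := split 1 one nx1.
have s2 := split 2 two (fun k s _ => nx2 k s).
rewrite loop_inv_out ?mulr0 ?subr0 in s1; [|by []|by rewrite mulr1].
rewrite loop_inv_sub// in s2.
by rewrite -s1 E s2; ring.
Qed.

End LaurentSplit.

(** * The function h and the factorisation of y - h(x) *)

Section Splitting.
Variable R : realType.
Local Notation C := (Cplx R).

(** The exponent is invariant under z -> 8 - z, which exchanges the two singularities, and 8 is far
    from the annulus containing the contours. *)
Definition hfun (z : C) : C := cexp ((z * (z - 8))^-1).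

Lemma dhfun (z : C) : z != 0 -> z != 8 -> differentiable hfun z.
Proof.
move=> z0 z8; apply: dcomp; last exact: dcexp.
apply: (@dV _ _ (fun z : C => z * (z - 8))); first by rewrite mulf_neq0// subr_eq0.
by apply: dM; [exact: did|apply: dB; [exact: did|exact: dcst]].
Qed.

Lemma cmod_nat n : cmod (n%:R : C) = n%:R.
Proof. by rewrite -toC_nat cmod_toC normr_nat. Qed.

Lemma hfun_dom (z : C) : 1 <= cmod z <= 3 -> z != 0 /\ z != 8.
Proof.
move=> /andP[z1 z3]; split; first by rewrite -cmod_gt0; apply: lt_le_trans z1.
apply/negP => /eqP e; move: z3; rewrite e cmod_nat; lra.
Qed.

(** On the annulus |z| and |z - 8| are at least 1, so the exponent has modulus at most 1. This is
    the origin of the condition |y| > e. *)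
Lemma hfun_bound (z : C) : 1 <= cmod z <= 3 -> cmod (hfun z) <= expR 1.
Proof.
move=> zI; have [z0 z8] := hfun_dom zI; move: zI => /andP[z1 z3].
rewrite cmod_cexp ler_expR; apply: le_trans (ler_norm _) _; apply: le_trans (cRe_le _) _.
have h8 : 1 <= cmod (z - 8).
  rewrite cmodB; apply: le_trans (cmod_sub _ _); rewrite cmod_nat; lra.
rewrite cmodV invf_le1; last by rewrite cmod_gt0 mulf_neq0// subr_eq0.
by rewrite cmodM -[X in X <= _]mulr1; apply: ler_pM.
Qed.

Definition vX (v : 'rV[C]_3) : C := v 0 (@Ordinal 3 0 isT).
Definition vY (v : 'rV[C]_3) : C := v 0 (@Ordinal 3 1 isT).
Definition vZ (v : 'rV[C]_3) : C := v 0 (@Ordinal 3 2 isT).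

(* In the affine coordinates x = X/Z, y = Y/Z this is log(1 - h(z)/y) / (z - x);
   writing it with homogeneous coordinates covers the points with Z = 0. *)
Definition kern (p : (C * 'rV[C]_3)%type) : C :=
  clog (1 - hfun p.1 * (vZ p.2 / vY p.2)) * (vZ p.2 / (p.1 * vZ p.2 - vX p.2)).

Definition Gint (r : R) (v : 'rV[C]_3) : C := loop (fun z => kern (z, v)) r.

Lemma kern_near (z : C) (v : 'rV[C]_3) : z != 0 -> z != 8 -> vY v != 0 ->
  z * vZ v - vX v != 0 -> 0 < cRe (1 - hfun z * (vZ v / vY v)) ->
  \forall p \near ((z, v) : (C * 'rV[C]_3)%type), differentiable kern p.
Proof.
move=> z0 z8 Y0 zX re0.
pose p0 : (C * 'rV[C]_3)%type := (z, v).
have d1 (p : (C * 'rV[C]_3)%type) : differentiable (fun p : (C * 'rV[C]_3)%type => p.1) p.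
  exact: dfst.
have dc j (p : (C * 'rV[C]_3)%type) : differentiable (fun p : (C * 'rV[C]_3)%type => p.2 0 j : C) p.
  exact: (differentiable_comp (dsnd p) (differentiable_coord p.2 0 j)).
have dX' p : differentiable (fun p : (C * 'rV[C]_3)%type => vX p.2) p by exact: dc.
have dY' p : differentiable (fun p : (C * 'rV[C]_3)%type => vY p.2) p by exact: dc.
have dZ' p : differentiable (fun p : (C * 'rV[C]_3)%type => vZ p.2) p by exact: dc.
have dden p : differentiable (fun p : (C * 'rV[C]_3)%type => p.1 * vZ p.2 - vX p.2) p.
  by apply: dB; [apply: dM; [exact: d1|exact: dZ']|exact: dX'].
have dq (p : (C * 'rV[C]_3)%type) : p.1 != 0 -> p.1 != 8 -> vY p.2 != 0 ->
    differentiable (fun p : (C * 'rV[C]_3)%type => 1 - hfun p.1 * (vZ p.2 / vY p.2)) p.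
  move=> a1 a2 a3; apply: dB; first exact: dcst.
  apply: dM; first by apply: (@dcomp _ _ hfun (fun p => p.1)); [exact: d1|exact: dhfun].
  by apply: dM; [exact: dZ'|apply: dV; [exact: a3|exact: dY']].
have n1 : \forall p \near p0, p.1 != 0.
  by have := differentiable_continuous (d1 p0); move=> /cvgr_neq0; apply.
have n8 : \forall p \near p0, p.1 != 8.
  have d8 : differentiable (fun p : (C * 'rV[C]_3)%type => p.1 - 8) p0.
    by apply: dB; [exact: d1|exact: dcst].
  have := differentiable_continuous d8; move=> /cvgr_neq0; rewrite subr_eq0 => /(_ z8).
  by apply: filterS => p; rewrite subr_eq0.
have nY : \forall p \near p0, vY p.2 != 0.
  by have := differentiable_continuous (dY' p0); move=> /cvgr_neq0; apply.
have nd : \forall p \near p0, p.1 * vZ p.2 - vX p.2 != 0.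
  by have := differentiable_continuous (dden p0); move=> /cvgr_neq0; apply.
have nr : \forall p \near p0, 0 < cRe (1 - hfun p.1 * (vZ p.2 / vY p.2)).
  have /contVP /(_ _ re0) /nearV := differentiable_continuous (dq p0 z0 z8 Y0).
  apply: filterS => p /=; set u := 1 - hfun p.1 * _; set w := 1 - hfun z * _ => h.
  have := cRe_le (u - w); rewrite cReD cReN => h1.
  have := ler_norm (- (cRe u - cRe w)); rewrite normrN; lra.
near=> p.
have a1 : p.1 != 0 by near: p.
have a8 : p.1 != 8 by near: p.
have aY : vY p.2 != 0 by near: p.
apply: dM.
  apply: (@dcomp _ _ (@clog R)); first exact: dq.
  by apply: dclog; near: p.
apply: dM; first exact: dZ'.
by apply: dV; [near: p|exact: dden].
Unshelve. all: by end_near. Qed.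

(** |h(z) Z/Y| < 1 keeps the argument of the logarithm in the right half-plane, the domain of
    [clog]. *)
Lemma re_log_pos (z Y Z : C) : 1 <= cmod z <= 3 -> expR 1 * cmod Z < cmod Y ->
  0 < cRe (1 - hfun z * (Z / Y)).
Proof.
move=> zI YZ; have Y0 : 0 < cmod Y.
  by apply: le_lt_trans YZ; rewrite mulr_ge0 ?cmod_ge0 ?expR_ge0.
have h : cmod (hfun z * (Z / Y)) < 1.
  rewrite !cmodM cmodV mulrA ltr_pdivrMr// mul1r; apply: le_lt_trans YZ.
  by apply: ler_wpM2r; [exact: cmod_ge0|exact: hfun_bound].
have := cRe_le (hfun z * (Z / Y)); rewrite cReD cReN => h1.
have := ler_norm (cRe (hfun z * (Z / Y))).
have -> : cRe (1 : C) = 1 by [].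
lra.
Qed.

Lemma Gint_diff r v : 1 <= r <= 2 -> expR 1 * cmod (vZ v) < cmod (vY v) ->
  (forall k s, -1 <= s <= 1 -> toC r * sq k s * vZ v - vX v != 0) ->
  differentiable (Gint r) v.
Proof.
move=> rI YZ nX; apply: (@loop_diff R 'rV[C]_3 kern) => k s sI.
have zI := sq_range k sI rI; have [z0 z8] := hfun_dom zI.
apply: kern_near => //; last exact: re_log_pos.
  rewrite -cmod_gt0; apply: le_lt_trans YZ.
  by rewrite mulr_ge0 ?cmod_ge0 ?expR_ge0.
exact: nX.
Qed.

(** The pole X/Z of the kernel is outside the square of half-side 1, or at infinity when Z = 0, so
    this integral is holomorphic over the whole intersection of V1 and V0. *)
Lemma Gint1_diff v : expR 1 * cmod (vZ v) < cmod (vY v) -> 3 / 2 * cmod (vZ v) < cmod (vX v) ->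
  differentiable (Gint 1) v.
Proof.
move=> YZ XZ; apply: Gint_diff => //; first by rewrite lexx ler1n.
move=> k s sI; rewrite toC1 mul1r subr_eq0; apply/negP => /eqP e; move: XZ; rewrite -e cmodM.
apply/negP; rewrite -leNgt; apply: ler_wpM2r; first exact: cmod_ge0.
by apply: ltW; exact: cmod_sq_lt.
Qed.

(** Here the pole lies inside the square of half-side 2, off the contour. *)
Lemma Gint2_diff v : expR 1 * cmod (vZ v) < cmod (vY v) -> cmod (vX v) < 2 * cmod (vZ v) ->
  differentiable (Gint 2) v.
Proof.
move=> YZ XZ; apply: Gint_diff => //; first by rewrite lexx andbT ler1n.
move=> k s sI; rewrite subr_eq0; apply/negP => /eqP e; move: XZ; rewrite -e cmodM.
apply/negP; rewrite -leNgt; apply: ler_wpM2r; first exact: cmod_ge0.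
exact: cmod_rsq_ge.
Qed.

(** Homogeneity of degree 0 lets the integrals descend to the projective plane. *)
Lemma GintZ r (c : C) v : c != 0 -> Gint r (c *: v) = Gint r v.
Proof.
move=> c0; apply: eq_loop => k s _; rewrite /kern /=.
have q (a b : C) : c * a / (c * b) = a / b by rewrite invfM mulrACA mulfV// mul1r.
have eX : vX (c *: v) = c * vX v by rewrite /vX mxE.
have eY : vY (c *: v) = c * vY v by rewrite /vY mxE.
have eZ : vZ (c *: v) = c * vZ v by rewrite /vZ mxE.
rewrite eX eY eZ q; congr (_ * _).
by rewrite -[RHS]q; congr (_ / _); ring.
Qed.

(** y - h(x) = y exp(L(x)) with L(z) = log(1 - h(z)/y), and [laurent_split] writes L(x) as the
    difference of the integrals over the two squares, divided by [loopc R]. *)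
Lemma wiener_hopf v : expR 1 * cmod (vZ v) < cmod (vY v) ->
  3 / 2 * cmod (vZ v) < cmod (vX v) < 2 * cmod (vZ v) ->
  vY v / vZ v - hfun (vX v / vZ v) =
  cexp (- (Gint 1 v / loopc R)) * (vY v / vZ v * cexp (Gint 2 v / loopc R)).
Proof.
move=> YZ /andP[X1 X2].
have Z0 : 0 < cmod (vZ v).
  rewrite lt_def cmod_ge0 andbT; apply/negP => /eqP e; move: X2; rewrite e mulr0 ltNge.
  by rewrite cmod_ge0.
have Z0' : vZ v != 0 by rewrite -cmod_gt0.
have Y0 : vY v != 0.
  by rewrite -cmod_gt0; apply: le_lt_trans YZ; rewrite mulr_ge0 ?cmod_ge0 ?expR_ge0.
set x := vX v / vZ v.
have xI : 3 / 2 < cmod x < 2.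
  by rewrite cmodM cmodV ltr_pdivlMr// ltr_pdivrMr// X1.
pose L z := clog (1 - hfun z * (vZ v / vY v)).
have dL z : 1 <= cmod z <= 3 -> differentiable L z.
  move=> zI; have [z0 z8] := hfun_dom zI.
  apply: (@dcomp _ _ (@clog R)); last by apply: dclog; exact: re_log_pos.
  by apply: dB; [exact: dcst|apply: dM; [exact: dhfun|exact: dcst]].
have nL z : 1 <= cmod z <= 3 -> \forall w \near z, differentiable L w.
  move=> zI; have [z0 z8] := hfun_dom zI.
  have n0 : \forall w \near z, w != 0.
    by apply/nearC; exists (cmod z); rewrite ?cmod_gt0// => w wz; apply/negP => /eqP e;
      move: wz; rewrite e sub0r cmodN ltxx.
  have n8 : \forall w \near z, w != 8.
    by apply/nearC; exists (cmod (z - 8)); rewrite ?cmod_gt0 ?subr_eq0// => w wz; apply/negP => /eqP e;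
      move: wz; rewrite e cmodB ltxx.
  have dq (w : C) : w != 0 -> w != 8 -> differentiable (fun w => 1 - hfun w * (vZ v / vY v)) w.
    by move=> w0 w8; apply: dB; [exact: dcst|apply: dM; [exact: dhfun|exact: dcst]].
  have re0 := re_log_pos zI YZ.
  have /contVP /(_ _ re0) /nearV nr := differentiable_continuous (dq z z0 z8).
  near=> w; apply: (@dcomp _ _ (@clog R)); first by apply: dq; near: w.
  apply: dclog; near: w; apply: filterS nr => w.
  set u := 1 - hfun w * _; set u' := 1 - hfun z * _ => h.
  have := cRe_le (u - u'); rewrite cReD cReN => h1.
  have := ler_norm (- (cRe u - cRe u')); rewrite normrN; lra.
have GE r : Gint r v = loop (fun z => L z / (z - x)) r.
  apply: eq_loop => k s _; rewrite /kern /=; congr (_ * _).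
  rewrite -[X in X * vZ v - vX v](mulfK Z0').
  have -> : toC r * sq k s * vZ v / vZ v * vZ v - vX v = vZ v * (toC r * sq k s - x).
    by rewrite /x; field.
  by rewrite invfM mulrA mulfV// mul1r.
have S := laurent_split dL nL xI.
have E : L x = Gint 2 v / loopc R - Gint 1 v / loopc R.
  by rewrite !GE -mulrBl S mulrC mulKf// loopc_neq0.
have xI' : 1 <= cmod x <= 3 by move: xI => /andP[? ?]; apply/andP; split; lra.
have : cexp (L x) = 1 - hfun x * (vZ v / vY v) by apply: clogK; exact: re_log_pos.
rewrite E cexpD => e.
rewrite mulrCA [cexp _ * cexp _]mulrC e; field.
by rewrite Z0' Y0.
Unshelve. all: by end_near. Qed.

End Splitting.

(** * Solutions of h(x) = y near the essential singularities *)

Section Roots.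
Variable R : realType.
Local Notation C := (Cplx R).

Lemma complex_sqrt (z : C) : exists2 s : C, s ^+ 2 = z & 0 <= cRe s.
Proof.
have e := sqr_sqrtc z.
have [h|h] := leP 0 (cRe (sqrtc z)); first by exists (sqrtc z).
by exists (- sqrtc z); [rewrite sqrrN|rewrite cReN oppr_ge0 ltW].
Qed.

Lemma cRe_cmod (z : C) : cRe z <= cmod z.
Proof. exact: le_trans (ler_norm _) (cRe_le z). Qed.

(** The quadratic has the root 4 - s with s^2 = 16 + 1/w. Taking Re s >= 0 selects the root near 0:
    then |x - 8| = |4 + s| >= 1, whence |x| <= 1/|w|. Moreover 2 (Re s)(Im s) = Im(1/w) has the sign
    opposite to Im w, so Im x = -Im s has the sign of Im w. *)
Lemma inv_root (w : C) : cIm w != 0 -> exists x : C,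
  [/\ x * (x - 8) = w^-1, x != 0, x != 8, cmod x <= (cmod w)^-1 & 0 < cIm x * cIm w].
Proof.
move=> w0; have w0' : w != 0.
  by apply/negP => /eqP e; move: w0; rewrite e eqxx.
have [s se s0] := complex_sqrt (16 + w^-1).
pose x := 4 - s; have xe : x * (x - 8) = w^-1.
  have -> : x * (x - 8) = s ^+ 2 - 16 by rewrite /x; ring.
  by rewrite se; ring.
have wi0 : w^-1 != 0 by rewrite invr_neq0.
exists x; split => //.
- by apply/negP => /eqP e; move: wi0; rewrite -xe e mul0r eqxx.
- by apply/negP => /eqP e; move: wi0; rewrite -xe e subrr mulr0 eqxx.
- have h : 1 <= cmod (x - 8).
    rewrite cmodB; apply: le_trans (cRe_cmod _).
    have -> : 8 - x = toC 4 + s by rewrite /x toC_nat; ring.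
    by rewrite cReD toCK; lra.
  rewrite -cmodV -xe cmodM -{1}(mulr1 (cmod x)); apply: ler_wpM2l => //.
  exact: cmod_ge0.
- have e1 : cIm (s ^+ 2) = 2 * (cRe s * cIm s) by rewrite expr2 cImM; ring.
  have e2 : cIm (w^-1) * (cmod w ^+ 2) = - cIm w.
    have : cIm (w^-1 * w) = 0 by rewrite mulVf.
    have : cRe (w^-1 * w) = 1 by rewrite mulVf.
    rewrite cReM cImM cmod_sqr => h1 h2.
    have -> : - cIm w = - (cRe w^-1 * cRe w - cIm w^-1 * cIm w) * cIm w by rewrite h1; ring.
    have -> : cIm w^-1 * (cRe w ^+ 2 + cIm w ^+ 2) =
      - (cRe w^-1 * cRe w - cIm w^-1 * cIm w) * cIm w +
      (cRe w^-1 * cIm w + cIm w^-1 * cRe w) * cRe w by ring.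
    by rewrite h2 mul0r addr0.
  have e3 : cIm (s ^+ 2) = cIm w^-1.
    rewrite se cImD -(toC_nat R 16); have -> : cIm (toC 16%:R : C) = 0 by [].
    by rewrite add0r.
  have xI : cIm x = - cIm s.
    rewrite /x cImD cImN -(toC_nat R 4); have -> : cIm (toC 4%:R : C) = 0 by [].
    by rewrite add0r.
  have m0 : 0 < cmod w ^+ 2 by rewrite exprn_gt0// cmod_gt0.
  have wI0 : 0 < cIm w ^+ 2 by rewrite lt_def sqrf_eq0 w0 sqr_ge0.
  have key : cIm w ^+ 2 = cRe s * (2 * (cIm x * cIm w) * cmod w ^+ 2).
    have -> : cIm w ^+ 2 = - (cIm w^-1 * cmod w ^+ 2) * cIm w by rewrite e2; ring.
    by rewrite -e3 e1 xI; ring.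
  rewrite ltNge; apply/negP => hn.
  have : cIm w ^+ 2 <= 0; last by rewrite leNgt wI0.
  rewrite key; apply: mulr_ge0_le0 => //; apply: mulr_le0_ge0; last exact: ltW.
  by rewrite pmulr_rle0.
Qed.

Lemma cexp_period n : cexp (mkC 0 (2 * pi * n%:R)) = 1 :> C.
Proof.
have p1 : cexp (mkC 0 (2 * pi)) = 1 :> C.
  apply: ReIm_ext; rewrite /cexp !(cRe_mk, cIm_mk) expR0 mul1r mulr_natl.
    by rewrite cos2pi.
  by rewrite sin2pi.
elim: n => [|n IH].
  have -> : mkC 0 (2 * pi * 0%:R) = 0 :> C by apply: ReIm_ext; rewrite // cIm_mk mulr0.
  exact: cexp0.
have -> : mkC 0 (2 * pi * n.+1%:R) = mkC 0 (2 * pi * n%:R) + mkC 0 (2 * pi) :> C.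
  apply: ReIm_ext; rewrite ?cReD ?cImD ?cRe_mk ?cIm_mk ?addr0//.
  by rewrite -natr1; ring.
by rewrite cexpD IH p1 mul1r.
Qed.

(* [b] selects the half-plane of the root. *)
Lemma hfun_root (b : bool) (y : C) (e : R) : 0 < cRe y -> 0 < e -> exists x : C,
  [/\ hfun x = y, 0 < cmod x < e, x != 8 & 0 < (-1) ^+ b * cIm x].
Proof.
move=> y0 e0; pose a := clog y.
have pi0 : 0 < 2 * pi :> R by rewrite mulr_gt0// pi_gt0.
(* Shifting the logarithm of [y] by a large period pushes |Im w| beyond 1/e; the root, of modulus at
   most 1/|w|, is then smaller than [e]. *)
have [n hn] : exists n, `|cIm a| + e^-1 < 2 * pi * n%:R.
  exists (Num.truncn ((`|cIm a| + e^-1) / (2 * pi))).+1.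
  by rewrite mulrC -ltr_pdivrMr// truncnS_gt.
(* The direction of the shift decides the sign of Im w, which [inv_root] passes on to the root. *)
pose w := a + (if b then - mkC 0 (2 * pi * n%:R) else mkC 0 (2 * pi * n%:R)).
have we : cexp w = y.
  by rewrite /w cexpD clogK//; case: (b); rewrite ?cexpN cexp_period ?invr1 mulr1.
have einv : 0 < e^-1 by rewrite invr_gt0.
have wI : e^-1 < (-1) ^+ b * cIm w.
  rewrite /w cImD; have := ler_norm (cIm a); have := ler_norm (- cIm a); rewrite normrN.
  case: (b) => /= h1 h2; rewrite ?expr1 ?expr0 ?cImN ?cIm_mk; lra.
have wI0 : cIm w != 0.
  by apply/negP => /eqP h; move: wI; rewrite h mulr0 => /(lt_trans einv); rewrite ltxx.
have [x [xe x0 x8 xw xI]] := inv_root wI0.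
exists x; split => //.
- by rewrite /hfun xe invrK.
- rewrite cmod_gt0 x0 /=; apply: le_lt_trans xw _.
  rewrite -[e]invrK ltf_pV2 ?posrE//; last by rewrite cmod_gt0; apply/negP => /eqP h; move: wI0; rewrite h eqxx.
  apply: lt_le_trans wI _; apply: le_trans (cIm_le w).
  by apply: le_trans (ler_norm _) _; rewrite normrM normrX normrN1 expr1n mul1r.
- have : 0 < ((-1) ^+ b * cIm x) * ((-1) ^+ b * cIm w).
    by rewrite mulrACA -expr2 sqrr_sign mul1r.
  by rewrite pmulr_lgt0//; apply: lt_trans wI.
Qed.

(** Transports the roots near 0 to the singularity 8. *)
Lemma hfun_sym (x : C) : hfun (8 - x) = hfun x.
Proof. by rewrite /hfun; congr (cexp _^-1); ring. Qed.

End Roots.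

(** * Locally constant properties on a segment *)

Section SegmentInduction.
Variable R : realType.

(** Connectedness of the unit interval through the supremum of the points up to which [Q] holds
    throughout: local constancy carries [Q] to that supremum and, unless it is 1, past it. *)
Lemma segment_locally_constant (Q : R -> Prop) : Q 0 ->
  (forall t, 0 <= t <= 1 -> exists2 d, 0 < d & forall s, 0 <= s <= 1 -> `|s - t| < d -> (Q s <-> Q t)) ->
  Q 1.
Proof.
move=> Q0 h.
pose T := [set t : R | 0 <= t <= 1 /\ forall s, 0 <= s <= t -> Q s].
have T0 : T 0.
  split; first by rewrite lexx ler01.
  by move=> s /andP[s0 s0']; rewrite (_ : s = 0)//; apply/le_anti; rewrite s0'.
have Tub : ubound T 1 by move=> t [/andP[]].
have hs : has_sup T by split; [exists 0|exists 1].
pose t := sup T.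
have t0 : 0 <= t by apply: sup_upper_bound.
have t1 : t <= 1 by apply: ge_sup; [exists 0|].
have [|d d0 hd] := h t; first by rewrite t0.
have [u [uI Qu] ut] : exists2 u, T u & t - d < u.
  by have [u Tu tu] := sup_adherent d0 hs; exists u.
have ult : u <= t by apply: sup_upper_bound.
have Qt : Q t.
  have [u0 u1] := andP uI.
  apply/(hd u uI); last by apply: Qu; rewrite u0 lexx.
  by rewrite ltr_norml; apply/andP; split; lra.
pose v := Num.min 1 (t + d / 2).
have v1 : v <= 1 by rewrite /v ge_min lexx.
have vtd : v <= t + d / 2 by rewrite /v ge_min lexx orbT.
have Tv : T v.
  split; first by rewrite v1 andbT /v le_min ler01; lra.
  move=> s /andP[s0 sv].
  have sI : 0 <= s <= 1 by rewrite s0 (le_trans sv v1).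
  have [su|us] := leP s u; first by apply: Qu; rewrite s0.
  apply/(hd s sI) => //; rewrite ltr_norml; apply/andP; split; lra.
have vt : v <= t by apply: sup_upper_bound.
move: vt; rewrite /v ge_min => /orP[t1'|]; last by move=> ?; exfalso; lra.
by have -> : 1 = t :> R by apply/le_anti; rewrite t1' t1.
Qed.

End SegmentInduction.

(** * Cocycles given by functions *)

Section FunctionCocycle.
Variables (R : realType) (X : topologicalType) (n : nat).
Variable A : holo_atlas R n X.
Local Notation C := (Cplx R).
Local Notation M := (mero_units A).
Local Open Scope quotient_scope.

(** Total in [f]: where [f] is not regular the germ defaults to 0, which in additive notation is the
    constant function 1. *)
Definition mgerm (f : X -> C) (z : X) : stalk M z :=
  match pselect (regular_at A f z) with
  | left rf => \pi_(mero_germ A z) (Fraction rf (regular_at1 A z))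
  | right _ => 0
  end.

Lemma mgermE f z (rf : regular_at A f z) :
  mgerm f z = \pi_(mero_germ A z) (Fraction rf (regular_at1 A z)).
Proof.
rewrite /mgerm; case: pselect => [rf'|//].
by rewrite (Prop_irrelevance rf' rf).
Qed.

Lemma mgerm_sec f z : (\forall y \near z, regular_at A f y) -> sec_at z (mgerm f : forall y, stalk M y).
Proof.
move=> rf; exists f, 1; apply: filterS rf => y rfy.
by exists (Fraction rfy (regular_at1 A y)); split => //; exact: mgermE.
Qed.

Lemma mgermM f g z : regular_at A f z -> regular_at A g z ->
  mgerm f z + mgerm g z = mgerm (f * g) z.
Proof.
move=> rf rg; rewrite !mgermE; first exact: regular_atM.
move=> rfg; apply: etrans (mero_germME _ _) _.
apply/eqP/mero_germ_eqP; rewrite /=; apply: nearW => y.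
change (f y * g y * 1 = f y * g y * (1 * 1)); by rewrite !mulr1.
Qed.

Lemma mgerm1 z : mgerm 1 z = 0.
Proof.
by rewrite (mgermE (regular_at1 A z)); apply/eqP/mero_germ_eqP; apply: nearW.
Qed.

Lemma mgerm_eq f g z : regular_at A f z -> regular_at A g z ->
  (\forall y \near z, f y = g y) -> mgerm f z = mgerm g z.
Proof.
move=> rf rg e; rewrite !mgermE; apply/eqP/mero_germ_eqP.
by apply: filterS e => y e; congr (_ * _).
Qed.

Variables (T : Type) (V : T -> set X) (F : T -> T -> X -> C) (lab : X -> T).
Hypothesis Vopen : forall a, open (V a).
Hypothesis labP : forall x, V (lab x) x.
Hypothesis Freg : forall a b z, V a z -> V b z -> regular_at A (F a b) z.
Hypothesis Fmul : forall a b c z, V a z -> V b z -> V c z ->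
  F a b z * F b c z * F c a z = F b a z * F c b z * F a c z.

Lemma near_V a z : V a z -> \forall y \near z, V a y.
Proof. by move=> Vz; exact: (open_nbhs_nbhs (conj (Vopen a) Vz)). Qed.

(** The quotient of [F a b] by [F b a], in additive notation. Separate numerators and denominators
    keep the data holomorphic, and [Fmul] is the cocycle relation cleared of denominators. *)
Definition transition a b z : stalk M z := mgerm (F a b) z - mgerm (F b a) z.

Lemma transition_trans a b c z : V a z -> V b z -> V c z ->
  transition a b z + transition b c z = transition a c z.
Proof.
move=> Va Vb Vc.
have rM a' b' c' a'' b'' c'' : V a' z -> V b' z -> V c' z -> V a'' z -> V b'' z -> V c'' z ->
    regular_at A (F a' a'' * F b' b'' * F c' c'') z.
  by move=> *; apply: regular_atM; [apply: regular_atM|]; exact: Freg.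
have e : mgerm (F a b * F b c * F c a) z = mgerm (F b a * F c b * F a c) z.
  apply: mgerm_eq; [exact: rM|exact: rM|].
  near=> y; apply: Fmul; near: y; exact: near_V.
have mM a' b' c' a'' b'' c'' : V a' z -> V b' z -> V c' z -> V a'' z -> V b'' z -> V c'' z ->
    mgerm (F a' a'' * F b' b'' * F c' c'') z = mgerm (F a' a'') z + mgerm (F b' b'') z + mgerm (F c' c'') z.
  move=> *; rewrite -mgermM; [|apply: regular_atM; exact: Freg|exact: Freg].
  by rewrite -mgermM//; exact: Freg.
move: e; rewrite !mM// /transition => e; apply/eqP; rewrite -subr_eq0 opprB.
by rewrite [X in X + (_ - _)]addrACA -opprD addrACA -opprD e subrr.
Unshelve. all: by end_near. Qed.

Lemma transition_sec a b z : V a z -> V b z ->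
  sec_at z (transition a b : forall y, stalk M y).
Proof.
move=> Va Vb; apply: sec_atB; apply: mgerm_sec; near=> y; apply: Freg; near: y; exact: near_V.
Unshelve. all: by end_near. Qed.

(** The cover indexed by [T] becomes one indexed by points by attaching to each point the set that
    [lab] chooses for it. *)
Definition fun_cocycle : cocycle1 M.
Proof.
apply: (@Cocycle1 X M (fun i => V (lab i)) (fun i j => transition (lab i) (lab j))).
- by move=> x; split; [exact: Vopen|exact: labP].
- by move=> i j z; exact: transition_sec.
- by move=> i j k z; exact: transition_trans.
Defined.

(** Triviality in the direct limit is given only on a refinement [W]. The local splittings are
    corrected by the transition from [a] to the label of the centre; by the coboundary relation the
    result does not depend on the centre used, so it is a section over all of [V a]. *)
Lemma fun_cocycle_trivial : \pi_(H1 M) fun_cocycle = 0 ->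
  exists beta : T -> forall z : X, stalk M z,
    (forall a z, V a z -> sec_at z (beta a)) /\
    (forall a b z, V a z -> V b z -> beta a z - beta b z = transition a b z).
Proof.
move=> /H1_eq0P[W [b [hW sW hb e]]].
exists (fun a z => b z z + transition a (lab z) z); split; last first.
  move=> a c z Va Vc; rewrite opprD addrACA subrr add0r.
  by rewrite -(transition_trans Va Vc (labP z)) addrK.
move=> a z Va.
have Wz : W z z by have [] := hW z.
have nW : \forall y \near z, W z y by have [oW _] := hW z; exact: open_nbhs_nbhs.
have Vz := labP z.
(* Near [z] the moving centre [y] is replaced by the fixed centre [z], for which the expression is a
   section; the coboundary relation [E] identifies the two. *)
apply: (@sec_at_near _ M z (fun y => b z y + transition a (lab z) y)); last first.
  by apply: sec_atD; [exact: hb|exact: transition_sec].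
near=> y.
have Wzy : W z y by near: y.
have Vay : V a y by near: y; exact: near_V.
have Vzy : V (lab z) y by near: y; exact: near_V.
have Wyy : W y y by have [] := hW y.
have := e z y y Wzy Wyy; rewrite /= => E.
rewrite -(transition_trans Vay Vzy (labP y)) E.
by rewrite [RHS]addrCA [b y y + _]addrC subrK addrC.
Unshelve. all: by end_near. Qed.

End FunctionCocycle.

(** * Multiplicities along the graph *)

Section PowUnique.
Variable R : realType.
Local Notation C := (Cplx R).
Local Notation CC := (C * C)%type.

Lemma nearCC (Q : set CC) : (\forall p \near ((0, 0) : CC), Q p) <->
  exists2 d : R, 0 < d & forall x w, cmod x < d -> cmod w < d -> Q (x, w).
Proof.
split=> [/nearV[d d0 hd]|[d d0 hd]].
  exists d => //; move=> x w xd wd; apply: hd; rewrite -[(x, w) - (0, 0)]/(x - 0, w - 0) !subr0 vmod_pair !vmodCE.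
  by rewrite gt_max xd.
apply/nearV; exists d => // => -[x w]; rewrite -[(x, w) - (0, 0)]/(x - 0, w - 0) !subr0.
by rewrite vmod_pair !vmodCE gt_max => /andP[xd wd]; exact: hd.
Qed.

(** On the line x = 0, if a < b, cancelling w^a leaves U = w^(b-a) W, which tends to 0 with w,
    against U(0, 0) nonzero. *)
Lemma pow_unique_le (a b : nat) (U W : CC -> C) :
  {for (0, 0), continuous U} -> {for (0, 0), continuous W} -> U (0, 0) != 0 ->
  (\forall p \near ((0, 0) : CC), p.2 ^+ a * U p = p.2 ^+ b * W p) -> (b <= a)%N.
Proof.
move=> cU cW U0 /nearCC[d d0 hd]; rewrite leqNgt; apply/negP => ab.
have hU0 : 0 < cmod (U (0, 0)) / 2 by rewrite divr_gt0// cmod_gt0.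
have /contVP /(_ _ hU0) /nearV /nearCC[d1 d10 h1] := cU.
have /contVP /(_ _ ltr01) /nearV /nearCC[d2 d20 h2] := cW.
pose K := cmod (W (0, 0)) + 1.
have K0 : 0 < K by rewrite ltr_wpDl// cmod_ge0.
pose t := Num.min (Num.min (d / 2) (d1 / 2)) (Num.min (Num.min (d2 / 2) 1) (cmod (U (0, 0)) / 2 / K)).
have t0 : 0 < t by rewrite !lt_min ltr01 !divr_gt0// cmod_gt0.
have td : t <= d / 2 by rewrite /t !ge_min lexx.
have td1 : t <= d1 / 2 by rewrite /t !ge_min lexx !orbT.
have td2 : t <= d2 / 2 by rewrite /t !ge_min lexx !orbT.
have t1 : t <= 1 by rewrite /t !ge_min lexx !orbT.
have tK : t * K <= cmod (U (0, 0)) / 2.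
  by rewrite -ler_pdivlMr// /t !ge_min lexx !orbT.
pose w : C := toC t.
have wt : cmod w = t by rewrite cmod_toC gtr0_norm.
have w0 : w != 0 by rewrite -cmod_gt0 wt.
have c0 (e : R) : 0 < e -> cmod (0 : C) < e by rewrite cmod0.
have wd : cmod w < d by rewrite wt; lra.
have wd1 : cmod w < d1 by rewrite wt; lra.
have wd2 : cmod w < d2 by rewrite wt; lra.
have := hd 0 w (c0 d d0) wd; have := h1 0 w (c0 d1 d10) wd1; have := h2 0 w (c0 d2 d20) wd2.
move=> hW hU /=; rewrite -(subnKC (ltnW ab)) exprD -mulrA => /(mulfI (expf_neq0 a w0)) e.
have [c ec] : exists c, (b - a)%N = c.+1 by exists (b - a).-1; rewrite prednK// subn_gt0.
have hU' : cmod (U (0, 0)) / 2 < cmod (U (0, w)).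
  have := cmod_sub (U (0, 0)) (U (0, w)); rewrite (cmodB (U (0, 0))) => h; lra.
have hW' : cmod (W (0, w)) <= K.
  have := cmod_sub (W (0, w)) (W (0, 0)); rewrite /K => h; lra.
move: hU'; rewrite e ec cmodM cmodX wt exprS ltNge => /negP; apply.
apply: le_trans tK; rewrite -mulrA; apply: ler_wpM2l; first exact: ltW.
rewrite -[leRHS]mul1r; apply: ler_pM; rewrite ?cmod_ge0 ?exprn_ge0 ?(ltW t0)//.
by rewrite exprn_ile1 ?(ltW t0).
Qed.

Lemma pow_unique (a b : nat) (U W : CC -> C) :
  {for (0, 0), continuous U} -> {for (0, 0), continuous W} ->
  U (0, 0) != 0 -> W (0, 0) != 0 ->
  (\forall p \near ((0, 0) : CC), p.2 ^+ a * U p = p.2 ^+ b * W p) -> a = b.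
Proof.
move=> cU cW U0 W0 h; apply/eqP; rewrite eqn_leq (pow_unique_le cU cW U0 h) andbT.
by apply: (pow_unique_le cW cU W0); apply: filterS h => p ->.
Qed.

End PowUnique.

Section Multiplicity.
Variables (R : realType) (X : topologicalType).
Variable A : holo_atlas R 2 X.
Variable i : chart_idx A.
Local Notation C := (Cplx R).
Local Notation CC := (C * C)%type.
Local Notation M := (mero_units A).
Local Open Scope quotient_scope.
Hypothesis chart_full : chart A i @` dom A i = setT.

Definition pt (x y : C) : 'rV[C]_2 := \row_j (if j == 0 then x else y).

Lemma ptE x y : pt x y = x *: delta_mx 0 0 + y *: delta_mx 0 1.
Proof.
apply/rowP => j; rewrite !mxE /=.
by case: j => -[|[|//]] jp /=; rewrite ?mulr1 ?mulr0 ?addr0 ?add0r.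
Qed.

Lemma pt0 x y : pt x y 0 0 = x. Proof. by rewrite mxE. Qed.
Lemma pt1 x y : pt x y 0 1 = y. Proof. by rewrite mxE. Qed.

Lemma pt_coord (w : 'rV[C]_2) : pt (w 0 0) (w 0 1) = w.
Proof.
apply/rowP => j; rewrite !mxE /=; case: j => -[|[|//]] jp /=.
  by congr (w 0 _); exact: val_inj.
by congr (w 0 _); exact: val_inj.
Qed.

Lemma dpt (V : normedModType C) (f g : V -> C) v :
  differentiable f v -> differentiable g v -> differentiable (fun v => pt (f v) (g v)) v.
Proof.
move=> df dg.
have -> : (fun v => pt (f v) (g v)) = (fun v => f v *: delta_mx 0 0) + (fun v => g v *: delta_mx 0 1).
  by apply/funext => u; rewrite ptE.
by apply: differentiableD; exact: differentiableZl.
Qed.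

Local Notation P := (param A i).

Lemma param_dom w : dom A i (P w).
Proof.
have : (chart A i @` dom A i) w by rewrite chart_full.
by move=> [x xd <-]; rewrite chartK.
Qed.

Lemma paramK w : chart A i (P w) = w.
Proof.
have : (chart A i @` dom A i) w by rewrite chart_full.
by move=> [x xd <-]; rewrite chartK.
Qed.

Lemma param_cont w : {for w, continuous P}.
Proof. by apply: param_continuous; rewrite chart_full. Qed.

Lemma near_param (Q : set X) w : (\forall z \near P w, Q z) -> \forall w' \near w, Q (P w').
Proof. exact: param_cont. Qed.

(** The chart domain is open and [param] inverts the chart there, so [param] is an open map. *)
Lemma near_param_inv (Q : set X) w : (\forall w' \near w, Q (P w')) -> \forall z \near P w, Q z.
Proof.
move=> h.
have n1 : \forall z \near P w, dom A i z.
  by apply: open_nbhs_nbhs; split; [exact: dom_open|exact: param_dom].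
have n2 : \forall z \near P w, Q (P (chart A i z)).
  have h' : \forall w' \near chart A i (P w), Q (P w') by rewrite paramK.
  exact: (chart_continuous (param_dom w) h').
by apply: filterS2 n1 n2 => z dz; rewrite chartK.
Qed.

Lemma holo_param f w : holo_at A f (P w) -> differentiable (f \o P) w.
Proof.
by move=> /(_ i (param_dom w)); rewrite paramK => /nbhs_singleton.
Qed.

Lemma regular_neq0 f z : regular_at A f z -> ~ (\forall y \near z, f y = 0).
Proof.
move=> [_ rf] f0; have [h1 _] := regular_at1 A z.
have := rf 1 h1; rewrite mulr1 => /(_ f0).
by move=> /nbhs_singleton /eqP; rewrite oner_eq0.
Qed.

(** The condition inside [mero_at], with the two functions fixed so that it can be transported
    between nearby points. *)
Definition repr_at (beta : forall z, stalk M z) (f g : X -> C) (z : X) : Prop :=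
  exists p : fraction_at A z, [/\ Defs.num p = f, Defs.den p = g & beta z = \pi_(mero_germ A z) p].

Lemma repr_at_eq beta f g f' g' z : repr_at beta f g z -> repr_at beta f' g' z ->
  f z * g' z = f' z * g z.
Proof.
move=> [p [<- <- e]] [q [<- <- e']]; have : \pi_(mero_germ A z) p = \pi_(mero_germ A z) q by rewrite -e.
by move=> /eqP/mero_germ_eqP/nbhs_singleton.
Qed.

Lemma repr_at_regular beta f g z : repr_at beta f g z -> regular_at A f z /\ regular_at A g z.
Proof. by move=> [p [<- <- _]]; split; [exact: num_regular|exact: den_regular]. Qed.

Definition graph_pt (x : C) : 'rV[C]_2 := pt x (hfun x).
(** The shear straightening the graph of h to w = 0, centred at the graph point over [x]. *)
Definition graph_coord (x : C) (p : CC) : 'rV[C]_2 := pt (x + p.1) (hfun (x + p.1) + p.2).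
Definition pullback (f : X -> C) (x : C) (p : CC) : C := f (P (graph_coord x p)).
Definition off_poles (x : C) : Prop := x != 0 /\ x != 8.

Lemma graph_coord0 x : graph_coord x (0, 0) = graph_pt x.
Proof. by rewrite /graph_coord /graph_pt !addr0. Qed.

Lemma graph_coord_shift x x0 p : graph_coord x p = graph_coord x0 (x - x0 + p.1, p.2).
Proof. by rewrite /graph_coord /= addrA subrKC. Qed.

Lemma dgraph_coord x (p : CC) : off_poles (x + p.1) -> differentiable (graph_coord x) p.
Proof.
move=> [g0 g8]; have d1 : differentiable (fun p : CC => x + p.1) p.
  by apply: dD; [exact: dcst|exact: dfst].
apply: dpt; first exact: d1.
apply: dD; last exact: dsnd.
exact: (dcomp d1 (dhfun g0 g8)).
Qed.

Lemma cgraph_coord x : off_poles x -> {for (0, 0), continuous (graph_coord x)}.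
Proof.
by move=> gx; apply: differentiable_continuous; apply: dgraph_coord; rewrite addr0.
Qed.

Lemma dgraph_pt x : off_poles x -> differentiable graph_pt x.
Proof. by move=> [x0 x8]; apply: dpt; [exact: did|exact: dhfun]. Qed.

Lemma near_off_poles x : off_poles x -> \forall y \near x, off_poles y.
Proof.
move=> [x0 x8]; apply/nearC; exists (Num.min (cmod x) (cmod (x - 8))).
  by rewrite lt_min !cmod_gt0 x0 subr_eq0.
move=> y; rewrite lt_min => /andP[y1 y2]; split; apply/negP => /eqP e.
  by move: y1; rewrite e sub0r cmodN ltxx.
by move: y2; rewrite e cmodB ltxx.
Qed.

Lemma near_graph_coord (Q : set X) x : off_poles x -> (\forall z \near P (graph_pt x), Q z) ->
  \forall p \near ((0, 0) : CC), Q (P (graph_coord x p)).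
Proof. by move=> gx /near_param h; rewrite -(graph_coord0 x) in h; exact: (cgraph_coord gx h). Qed.

Lemma near_graph_pt (Q : set X) x : off_poles x -> (\forall z \near P (graph_pt x), Q z) ->
  \forall y \near x, Q (P (graph_pt y)).
Proof.
move=> gx /near_param h; have c : {for x, continuous graph_pt} := differentiable_continuous (dgraph_pt gx).
exact: c h.
Qed.

Lemma dpullback f x (p : CC) : off_poles (x + p.1) -> holo_at A f (P (graph_coord x p)) ->
  differentiable (pullback f x) p.
Proof. by move=> gp /holo_param df; exact: (differentiable_comp (dgraph_coord gp) df). Qed.

(* In the coordinates (x, w = y - h(x)), [m] is the order of f/g along w = 0.
   The cofactors [u] and [v] may vanish at isolated points of w = 0, where no [m] qualifies;
   [GMult] therefore only looks at a punctured neighbourhood. *)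
Definition Mult (beta : forall z, stalk M z) (x : C) (m : int) : Prop :=
  exists f g (k l : nat) (u v : CC -> C), [/\
    (\forall z \near P (graph_pt x), repr_at beta f g z),
    m = k%:Z - l%:Z,
    {for (0, 0), continuous u} /\ {for (0, 0), continuous v},
    u (0, 0) != 0 /\ v (0, 0) != 0 &
    \forall p \near ((0, 0) : CC), pullback f x p = p.2 ^+ k * u p /\ pullback g x p = p.2 ^+ l * v p].

Lemma continuousCM (U : topologicalType) (f g : U -> C) (x : U) :
  {for x, continuous f} -> {for x, continuous g} -> {for x, continuous (fun y => f y * g y)}.
Proof. by move=> cf cg; exact: (cvgM cf cg). Qed.

(** Two representing fractions agree after cross-multiplication, and [pow_unique] compares the
    powers of w, giving k + l' = k' + l. *)
Lemma Mult_unique beta x m m' : off_poles x -> Mult beta x m -> Mult beta x m' -> m = m'.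
Proof.
move=> gx [f [g [k [l [u [v [r e [cu cv] [u0 v0] h]]]]]]].
move=> [f' [g' [k' [l' [u' [v' [r' e' [cu' cv'] [u0' v0'] h']]]]]]].
have r2 : \forall z \near P (graph_pt x), f z * g' z = f' z * g z.
  by apply: filterS2 r r' => z; exact: repr_at_eq.
have E : (k + l' = k' + l)%N.
  apply: (@pow_unique R _ _ (fun p => u p * v' p) (fun p => u' p * v p)).
  - exact: (continuousCM cu cv').
  - exact: (continuousCM cu' cv).
  - exact: (mulf_neq0 u0 v0').
  - exact: (mulf_neq0 u0' v0).
  - apply: filterS3 (near_graph_coord gx r2) h h' => p; rewrite -!/(pullback _ _ _) => e1 [e2 e3] [e4 e5].
    by move: e1; rewrite e2 e3 e4 e5 !exprD => e1; rewrite mulrACA e1; ring.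
rewrite e e'; apply/eqP; rewrite subr_eq addrAC eq_sym subr_eq eq_sym.
by rewrite -!PoszD E.
Qed.

(** In graph coordinates [F] is w itself, so passing from [beta2] to [beta1] puts one more factor w
    into the numerator. *)
Lemma Mult_shift beta1 beta2 F x m : off_poles x ->
  (\forall z \near P (graph_pt x), regular_at A F z) ->
  (\forall z \near P (graph_pt x), beta1 z - beta2 z = mgerm A F z) ->
  (\forall p \near ((0, 0) : CC), pullback F x p = p.2) ->
  Mult beta2 x m -> Mult beta1 x (m + 1).
Proof.
move=> gx rF b12 lF [f [g [k [l [u [v [r e [cu cv] [u0 v0] h]]]]]]].
exists (f * F), (g * 1), k.+1, l, u, v; split => //.
- apply: filterS3 r rF b12 => z [p [pf pg pe]] rFz bz.
  exists (fractionM p (Fraction rFz (regular_at1 A z))); split; rewrite /= ?pf ?pg//.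
  rewrite -[LHS](subrK (beta2 z)) bz (mgermE rFz) pe addrC.
  exact: mero_germ_addE.
- by rewrite e -addn1 PoszD; ring.
- apply: filterS2 lF h => p e1 [e2 e3]; split.
    rewrite -[LHS]/(pullback f x p * pullback F x p) e1 e2 exprSr; ring.
  by rewrite -[LHS]/(pullback g x p * 1) mulr1.
Qed.

Definition GMult beta x0 m := exists2 d, 0 < d & forall x, 0 < cmod (x - x0) < d -> Mult beta x m.

(** A punctured disc about [x0] contains a punctured disc about each of its points. *)
Lemma GMult_near beta x0 m : GMult beta x0 m ->
  \forall x \near x0, GMult beta x m.
Proof.
move=> [d d0 hd]; apply/nearC; exists d => // x xd.
have [->|xx0] := eqVneq x x0; first by exists d.
have h0 : 0 < cmod (x - x0) by rewrite cmod_gt0 subr_eq0.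
exists (Num.min (cmod (x - x0)) (d - cmod (x - x0))); first by rewrite lt_min h0 subr_gt0.
move=> y; rewrite lt_min => /andP[y0 /andP[y1 y2]]; apply: hd.
rewrite cmod_gt0 subr_eq0; apply/andP; split.
  by apply/negP => /eqP e; move: y1; rewrite e cmodB ltxx.
have -> : y - x0 = (y - x) + (x - x0) by ring.
by apply: le_lt_trans (cmodD _ _) _; rewrite -ltrBrDr.
Qed.

(** Both multiplicities hold at a common point of the two punctured discs. *)
Lemma GMult_unique beta x0 m m' : off_poles x0 -> GMult beta x0 m -> GMult beta x0 m' -> m = m'.
Proof.
move=> gx [d d0 hd] [d' d'0 hd'].
have /nearC[c c0 hc] := near_off_poles gx.
pose t := Num.min (Num.min d d') c / 2.
have t0 : 0 < t by rewrite divr_gt0// !lt_min d0 d'0.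
have tlt : t < Num.min (Num.min d d') c by rewrite /t; move: t0; rewrite /t; lra.
have [td [td' tc]] : t < d /\ t < d' /\ t < c.
  by move: tlt; rewrite !lt_min => /andP[/andP[? ?] ?].
have e : cmod (x0 + toC t - x0) = t by rewrite addrAC subrr add0r cmod_toC gtr0_norm.
apply: (@Mult_unique beta (x0 + toC t)).
- by apply: hc; rewrite e.
- by apply: hd; rewrite e t0.
- by apply: hd'; rewrite e t0.
Qed.

Lemma near_dpullback f x : off_poles x -> (\forall z \near P (graph_pt x), holo_at A f z) ->
  \forall p \near ((0, 0) : CC), differentiable (pullback f x) p.
Proof.
move=> gx hf; have n1 := near_graph_coord gx hf.
have n2 : \forall p \near ((0, 0) : CC), off_poles (x + p.1).
  have c : {for ((0, 0) : CC), continuous (fun p : CC => x + p.1)}.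
    by apply: differentiable_continuous; apply: dD; [exact: dcst|exact: dfst].
  by apply: c; rewrite addr0; exact: near_off_poles.
by apply: filterS2 n1 n2 => p h g; exact: dpullback.
Qed.

(** The shear has the continuous inverse [q], so vanishing in graph coordinates means vanishing near
    the point, which a regular germ excludes. *)
Lemma pullback_neq0 f x : off_poles x -> regular_at A f (P (graph_pt x)) ->
  ~ (\forall p \near ((0, 0) : CC), pullback f x p = 0).
Proof.
move=> gx rf h; apply: (regular_neq0 rf); apply: near_param_inv.
pose q (w : 'rV[C]_2) : CC := (w 0 0 - x, w 0 1 - hfun (w 0 0)).
have [x0 x8] := gx.
have d0 (w : 'rV[C]_2) j : differentiable (fun w : 'rV[C]_2 => w 0 j : C) w by exact: differentiable_coord.
have dq : differentiable q (graph_pt x).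
  apply: (@differentiable_pair _ _ _ _ (fun w : 'rV[C]_2 => w 0 0 - x)
    (fun w : 'rV[C]_2 => w 0 1 - hfun (w 0 0))).
    by apply: dB; [exact: d0|exact: dcst].
  apply: dB; first exact: d0.
  have dh : differentiable (@hfun R) (graph_pt x 0 0) by rewrite /graph_pt pt0; exact: dhfun.
  exact: (dcomp (d0 (graph_pt x) 0) dh).
have q0 : q (graph_pt x) = (0, 0) by rewrite /q /graph_pt pt0 pt1 !subrr.
have : \forall w \near graph_pt x, pullback f x (q w) = 0.
  rewrite -q0 in h; have c : {for graph_pt x, continuous q} := differentiable_continuous dq.
  exact: (c _ h).
apply: filterS => w; rewrite /pullback /graph_coord /q /= !subrKC.
by rewrite pt_coord.
Qed.

Lemma near_repr_near beta f g x : (\forall z \near P (graph_pt x), repr_at beta f g z) ->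
  \forall z \near P (graph_pt x), \forall z' \near z, repr_at beta f g z'.
Proof. by move=> h; exact: (nbhs_interior h). Qed.

(** [weierstrass_dichotomy] for numerator and denominator, whose first alternative contradicts
    regularity. At points of w = 0 close to the centre and different from it both cofactors are
    nonzero, so the order is the difference of the exponents. *)
Lemma GMult_exists beta x0 : off_poles x0 -> sec_at (P (graph_pt x0)) beta -> exists m, GMult beta x0 m.
Proof.
move=> gx [f [g rep]].
have rep' : \forall z \near P (graph_pt x0), repr_at beta f g z by exact: rep.
have hf : \forall z \near P (graph_pt x0), holo_at A f z.
  by apply: filterS rep' => z /repr_at_regular[[]].
have hg : \forall z \near P (graph_pt x0), holo_at A g z.
  by apply: filterS rep' => z /repr_at_regular[_ []].
have [rf rg] := repr_at_regular (nbhs_singleton rep').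
have W F : (\forall z \near P (graph_pt x0), holo_at A F z) -> regular_at A F (P (graph_pt x0)) ->
   exists k d (G : CC -> C), [/\ 0 < d,
    forall x w, cmod x < d -> cmod w < d -> pullback F x0 (x, w) = w ^+ k * G (x, w),
    forall x, 0 < cmod x < d -> G (x, 0) != 0 &
    forall x w, cmod x < d -> cmod w < d -> {for (x, w), continuous G}].
  move=> hF rF; have /nearCC[d d0 hd] := near_dpullback gx hF.
  have r0 : 0 < d / 4 by rewrite divr_gt0.
  have dF x w : cmod x <= 2 * (d / 4) -> cmod w <= 2 * (d / 4) -> differentiable (pullback F x0) (x, w).
    have lt : 2 * (d / 4) < d by move: r0; lra.
    by move=> xd wd; apply: hd; [exact: le_lt_trans xd lt|exact: le_lt_trans wd lt].
  have [h|h] := weierstrass_dichotomy r0 r0 dF; last exact: h.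
  exfalso; apply: (pullback_neq0 gx rF); apply/nearCC; exists (d / 4 / 4); first by rewrite !divr_gt0.
  by move=> x w xd wd; apply: h; [exact: ltW|apply: le_trans (ltW wd) _; lra].
have [k [d1 [G1 [d10 E1 N1 C1]]]] := W f hf rf.
have [l [d2 [G2 [d20 E2 N2 C2]]]] := W g hg rg.
have /nearC[d3 d30 h3] := near_graph_pt gx (near_repr_near rep').
exists (k%:Z - l%:Z); exists (Num.min (Num.min d1 d2) d3); first by rewrite !lt_min d10 d20.
move=> x; rewrite !lt_min => /andP[xx0 /andP[/andP[xd1 xd2] xd3]].
(* The cofactors found at [x0], translated to the centre [x]. *)
exists f, g, k, l, (fun p => G1 (x - x0 + p.1, p.2)), (fun p => G2 (x - x0 + p.1, p.2)).
have tr (q : CC) : differentiable (fun p : CC => (x - x0 + p.1, p.2)) q.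
  apply: (@differentiable_pair _ _ _ _ (fun p : CC => x - x0 + p.1) (fun p : CC => p.2)).
    by apply: dD; [exact: dcst|exact: dfst].
  exact: dsnd.
have c0 (d : R) : 0 < d -> cmod (0 : C) < d by rewrite cmod0.
have tc (G : CC -> C) : {for (x - x0, 0), continuous G} ->
    {for (0, 0), continuous (fun p => G (x - x0 + p.1, p.2))}.
  move=> cG; apply: (@continuous_comp _ _ _ (fun p : CC => (x - x0 + p.1, p.2)) G).
    exact: (differentiable_continuous (tr _)).
  by rewrite /= addr0.
split => //.
- exact: h3.
- by split; apply: tc; [apply: C1|apply: C2] => //; exact: c0.
- by rewrite /= !addr0; split; [apply: N1|apply: N2]; rewrite xx0.
- apply/nearCC; exists (Num.min (d1 - cmod (x - x0)) (d2 - cmod (x - x0))).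
    by rewrite lt_min !subr_gt0 xd1.
  move=> y w; rewrite !lt_min => /andP[y1 y2] /andP[w1 w2].
  have p0 := cmod_ge0 (x - x0); have := cmodD (x - x0) y => tri.
  by split; rewrite /pullback (graph_coord_shift x x0) /=; [apply: E1|apply: E2]; lra.
Qed.

(** At each point of the segment a generic order exists, is unique and is shared by nearby points,
    hence is constant along the segment. *)
Lemma GMult_segment beta x y m :
  (forall t, 0 <= t <= 1 -> off_poles (x + toC t * (y - x)) /\ sec_at (P (graph_pt (x + toC t * (y - x)))) beta) ->
  GMult beta x m -> GMult beta y m.
Proof.
move=> h hx; have e1 : y = x + toC 1 * (y - x) by rewrite toC1 mul1r subrKC.
rewrite e1; apply: (@segment_locally_constant R (fun t => GMult beta (x + toC t * (y - x)) m)).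
  by rewrite toC0 mul0r addr0.
move=> t tI; have [gt st] := h t tI; have [mt hmt] := GMult_exists gt st.
have /nearC[d d0 hd] := GMult_near hmt.
have K0 : 0 < cmod (y - x) + 1 by rewrite ltr_wpDl// cmod_ge0.
exists (d / (cmod (y - x) + 1)); first by rewrite divr_gt0.
move=> s sI; rewrite ltr_pdivlMr// => sd; have [gs ss] := h s sI.
have hs : GMult beta (x + toC s * (y - x)) mt.
  apply: hd; have -> : x + toC s * (y - x) - (x + toC t * (y - x)) = toC (s - t) * (y - x).
    by rewrite toCB; ring.
  rewrite cmodM cmod_toC; apply: le_lt_trans sd.
  by apply: ler_wpM2l => //; rewrite lerDl.
split=> hm; first by rewrite (GMult_unique gs hm hs).
by rewrite (GMult_unique gt hm hmt).
Qed.

(** Near [x] neither function vanishes on the graph, so both exponents are 0 and the functions are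
    their own cofactors. *)
Lemma GMult0 beta f g x : off_poles x -> (\forall z \near P (graph_pt x), repr_at beta f g z) ->
  f (P (graph_pt x)) != 0 -> g (P (graph_pt x)) != 0 -> GMult beta x 0.
Proof.
move=> gx rep f0 g0.
have cl F : holo_at A F (P (graph_pt x)) -> {for x, continuous (fun y => F (P (graph_pt y)))}.
  move=> /holo_param dF; apply: differentiable_continuous.
  exact: (differentiable_comp (dgraph_pt gx) dF).
have [[hf _] [hg _]] := repr_at_regular (nbhs_singleton rep).
have n1 : \forall y \near x, f (P (graph_pt y)) != 0 by have := cl f hf; move=> /cvgr_neq0; apply.
have n2 : \forall y \near x, g (P (graph_pt y)) != 0 by have := cl g hg; move=> /cvgr_neq0; apply.
have n3 := near_graph_pt gx (near_repr_near rep).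
have n4 := near_off_poles gx.
have [d d0 hd] : exists2 d, 0 < d & forall y, cmod (y - x) < d ->
   [/\ f (P (graph_pt y)) != 0, g (P (graph_pt y)) != 0, off_poles y &
    \forall z \near P (graph_pt y), repr_at beta f g z].
  by apply/nearC; near=> y; split; near: y.
exists d => // y /andP[_ /hd[fy gy gyy ry]].
have [[hfy _] [hgy _]] := repr_at_regular (nbhs_singleton ry).
have cpullback F : holo_at A F (P (graph_pt y)) -> {for (0, 0), continuous (pullback F y)}.
  by move=> hF; apply: differentiable_continuous; apply: dpullback; rewrite ?addr0// graph_coord0.
exists f, g, 0%N, 0%N, (pullback f y), (pullback g y); split => //.
- by split; exact: cpullback.
- by rewrite /pullback graph_coord0.
- by apply/nearCC; exists 1; [exact: ltr01|move=> x1 w1 _ _; rewrite !expr0 !mul1r].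
Unshelve. all: by end_near. Qed.

(* If no multiplicity near [e] were 0, then fg would vanish at the points (x, h(x)).
   For each y close to 1 these accumulate at (e, y), because h takes the value y
   arbitrarily close to [e], so fg = 0 on a neighbourhood of (e, 1). *)
Lemma bad_end beta (e : C) (Om : C -> Prop) : sec_at (P (pt e 1)) beta ->
  (forall y r, 0 < cRe y -> 0 < r -> exists x, [/\ hfun x = y, 0 < cmod (x - e) < r, off_poles x & Om x]) ->
  exists2 x, Om x & GMult beta x 0.
Proof.
move=> [f [g rep]] root.
have rep1 : \forall z \near P (pt e 1), repr_at beta f g z by exact: rep.
have rep2 : \forall z \near P (pt e 1), \forall z' \near z, repr_at beta f g z'.
  exact: (nbhs_interior rep1).
apply: contrapT => nG.
have [rf rg] := repr_at_regular (nbhs_singleton rep1).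
apply: (regular_neq0 (regular_atM rf rg)); apply: near_param_inv.
pose q (p : CC) := pt (e + p.1) (1 + p.2).
have dq p : differentiable q p.
  by apply: dpt; apply: dD; [exact: dcst|exact: dfst|exact: dcst|exact: dsnd].
have q0 : q (0, 0) = pt e 1 by rewrite /q !addr0.
have nq (Q : set X) : (\forall z \near P (pt e 1), Q z) -> \forall p \near ((0, 0) : CC), Q (P (q p)).
  move=> /near_param h; rewrite -q0 in h; have c : {for (0, 0), continuous q} := differentiable_continuous (dq _).
  exact: (c _ h).
pose H p := (f * g) (P (q p)).
have dH : \forall p \near ((0, 0) : CC), differentiable H p.
  apply: filterS (nq _ rep1) => p /repr_at_regular[rfp rgp].
  have [hfg _] := regular_atM rfp rgp.
  exact: (differentiable_comp (dq p) (holo_param hfg)).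
have /nearCC[d1 d10 h1] := dH; have /nearCC[d2 d20 h2] := nq _ rep2.
pose d := Num.min d1 d2; have d0 : 0 < d by rewrite lt_min d10.
have hd x w : cmod x < d -> cmod w < d ->
    differentiable H (x, w) /\ \forall z' \near P (q (x, w)), repr_at beta f g z'.
  rewrite /d !lt_min => /andP[x1 x2] /andP[w1 w2].
  by split; [exact: (h1 x w)|exact: (h2 x w)].
clearbody d.
(* 2 r < d keeps the slices in the domain of holomorphy, and 2 r < 1 keeps Re(1 + w) positive, as
   [root] requires. *)
pose r := Num.min d 1 / 4.
have m0 : 0 < Num.min d 1 by rewrite lt_min d0 ltr01.
have r0 : 0 < r by rewrite divr_gt0.
have [rd r1] : 2 * r < d /\ 2 * r < 1.
  have : Num.min d 1 <= d by rewrite ge_min lexx.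
  have : Num.min d 1 <= 1 by rewrite ge_min lexx orbT.
  by rewrite /r; lra.
(* The identity theorem on the slice of fixed [w]. If [H] had no zeros at small nonzero [t], the
   root x of h(x) = 1 + w would give a graph point where fg is nonzero, hence multiplicity 0 there,
   against [nG]. *)
have H0 t w : cmod t <= r / 2 -> cmod w < r -> H (t, w) = 0.
  move=> tr wr.
  have wd : cmod w < d by lra.
  have hol : hol_on (fun t => H (t, w)) r.
    move=> s sr; have [dHs _] := hd s w (le_lt_trans sr rd) wd.
    have dp : differentiable (fun t : C => (t, w)) s.
      by apply: differentiable_pair; [exact: did|exact: differentiable_cst].
    exact: (differentiable_comp dp dHs).
  have [h|[c c0 hc]] := identity_dichotomy r0 hol; first exact: h.
  exfalso.
  have y0 : 0 < cRe (1 + w).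
    rewrite cReD; have := cRe_le w; have := ler_norm (- cRe w); rewrite normrN.
    have -> : cRe (1 : C) = 1 by []; lra.
  have cr0 : 0 < Num.min c r by rewrite lt_min c0.
  have [x [hx /andP[xe]]] := root (1 + w) _ y0 cr0.
  rewrite lt_min => /andP[xc xr] gx Ox.
  have := hc (x - e); rewrite xe xc => /(_ isT).
  have Eq : q (x - e, w) = graph_pt x by rewrite /q /= subrKC /graph_pt hx.
  rewrite /H Eq => fg0.
  have [f0 g0] : f (P (graph_pt x)) != 0 /\ g (P (graph_pt x)) != 0.
    by move: fg0; rewrite -[(f * g) _]/(f (P (graph_pt x)) * g (P (graph_pt x))) mulf_eq0 negb_or => /andP.
  have xd : cmod (x - e) < d by lra.
  have [_] := hd (x - e) w xd wd; rewrite Eq => repx.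
  by apply: nG; exists x; [exact: Ox|exact: (GMult0 gx repx)].
have n0 : \forall p \near ((0, 0) : CC), H p = 0.
  apply/nearCC; exists (r / 2); first by rewrite divr_gt0.
  by move=> t w tr wr; apply: H0; [exact: ltW|lra].
pose q' (w : 'rV[C]_2) : CC := (w 0 0 - e, w 0 1 - 1).
have dc (w : 'rV[C]_2) j : differentiable (fun w : 'rV[C]_2 => w 0 j : C) w by exact: differentiable_coord.
have dq' w : differentiable q' w.
  apply: (@differentiable_pair _ _ _ _ (fun w : 'rV[C]_2 => w 0 0 - e) (fun w : 'rV[C]_2 => w 0 1 - 1)).
    by apply: dB; [exact: dc|exact: dcst].
  by apply: dB; [exact: dc|exact: dcst].
have q'0 : q' (pt e 1) = (0, 0) by rewrite /q' pt0 pt1 !subrr.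
have : \forall w \near pt e 1, H (q' w) = 0.
  rewrite -q'0 in n0; have c : {for pt e 1, continuous q'} := differentiable_continuous (dq' _).
  exact: (c _ n0).
by apply: filterS => w; rewrite /H /q /q' /= !subrKC pt_coord.
Qed.

Variables (T : Type) (V : T -> set X) (F : T -> T -> X -> C) (lab : X -> T).
Hypothesis Vopen : forall a, open (V a).
Hypothesis labP : forall x, V (lab x) x.
Hypothesis Freg : forall a b z, V a z -> V b z -> regular_at A (F a b) z.
Hypothesis Fmul : forall a b c z, V a z -> V b z -> V c z ->
  F a b z * F b c z * F c a z = F b a z * F c b z * F a c z.
Variables t1 t2 : T.
Hypothesis V1 : forall x y, 3 / 2 < cmod x -> V t1 (P (pt x y)).
Hypothesis V2 : forall x y, cmod x < 2 -> V t2 (P (pt x y)).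
Hypothesis F12 : forall x y, 3 / 2 < cmod x < 2 -> F t1 t2 (P (pt x y)) = y - hfun x.
Hypothesis F21 : F t2 t1 = 1.

Theorem fun_cocycle_nontrivial :
  \pi_(H1 M) (fun_cocycle Vopen labP Freg Fmul) <> 0.
Proof.
move=> /fun_cocycle_trivial[beta [bsec bdiff]].
(* Both regions are convex and avoid 0 and 8, so segments inside them transport multiplicities;
   [Om2] lies over the second open set and [Om1] over the first. *)
pose Om2 (x : C) := 0 < cIm x /\ cmod x < 2.
pose Om1 (x : C) := 0 < cIm x /\ 3 / 2 < cRe x.
have gIm x : 0 < cIm x -> off_poles x.
  move=> Ix; split; apply/negP => /eqP e; move: Ix; rewrite e.
    by rewrite /cIm /= ltxx.
  by rewrite -(toC_nat R 8) /toC /cIm /= ltxx.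
have [||x2 [Ix2 x2r] G2] := @bad_end (beta t2) 0 Om2.
- by apply: bsec; apply: V2; rewrite cmod0.
- move=> y r y0 r0.
  have m0 : 0 < Num.min r 1 by rewrite lt_min r0 ltr01.
  have [x [hx /andP[x0 xr] x8]] := hfun_root false y0 m0.
  rewrite expr0 mul1r => Ix; exists x; move: xr; rewrite lt_min => /andP[xr x1].
  split; rewrite ?subr0 ?x0//; first exact: gIm.
  by split=> //; apply: lt_trans x1 _; lra.
have [||x1 [Ix1 x1r] G1] := @bad_end (beta t1) 8 Om1.
- by apply: bsec; apply: V1; rewrite cmod_nat; lra.
- move=> y r y0 r0.
  have m0 : 0 < Num.min r 1 by rewrite lt_min r0 ltr01.
  (* The reflection x -> 8 - x reverses the sign of the imaginary part, so the root is taken in the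
     lower half-plane. *)
  have [x [hx /andP[x0 xr] x8]] := hfun_root true y0 m0.
  rewrite expr1 mulN1r => Ix; exists (8 - x); move: xr; rewrite lt_min => /andP[xr xl].
  have I8 : cIm (8 - x) = - cIm x.
    by rewrite cImD cImN -(toC_nat R 8) /toC /= add0r.
  have R8 : cRe (8 - x) = 8 - cRe x by rewrite cReD cReN -(toC_nat R 8) toCK.
  split.
  + by rewrite hfun_sym.
  + by rewrite addrAC subrr add0r cmodN x0.
  + by apply: gIm; rewrite I8.
  + by split; rewrite ?I8// R8; have := cRe_cmod x; lra.
(* A point of both regions: its real part 7/4 exceeds 3/2, and its squared modulus is 50/16 < 4. *)
pose c : C := mkC (7 / 4) (1 / 4).
have cI : cIm c = 1 / 4 by [].
have cR : cRe c = 7 / 4 by [].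
have c2 : cmod c < 2.
  by rewrite -(@ltr_pXn2r _ 2)// ?nnegrE ?cmod_ge0// cmod_sqr cI cR; lra.
have cgt x : 3 / 2 < cRe x -> 3 / 2 < cmod x.
  by move=> h; apply: lt_le_trans h (cRe_cmod x).
have c1 : 3 / 2 < cmod c by apply: cgt; rewrite cR; lra.
have Gc2 : GMult (beta t2) c 0.
  apply: (GMult_segment _ G2) => t /andP[t0 t1']; split.
    apply: gIm; rewrite cImD cImM cImD cImN toCK cI.
    have -> : cIm (toC t : C) = 0 by [].
    rewrite mul0r addr0; have := mulr_ge0 t0 (ltW Ix2).
    have [->|tn0] := eqVneq t 0; first by rewrite !mul0r; lra.
    have t0' : 0 < t by rewrite lt_def tn0.
    have := mulr_ge0 (_ : 0 <= 1 - t) (ltW Ix2); rewrite subr_ge0 => /(_ t1'); lra.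
  apply: bsec; apply: V2.
  have -> : x2 + toC t * (c - x2) = toC (1 - t) * x2 + toC t * c by rewrite toCB toC1; ring.
  have t1'' : 0 <= 1 - t by lra.
  apply: le_lt_trans (cmodD _ _) _; rewrite [cmod (_ * x2)]cmodM [cmod (_ * c)]cmodM !cmod_toC.
  rewrite (ger0_norm t1'') (ger0_norm t0).
  have [->|tn0] := eqVneq t 0; first by rewrite mul0r subr0 mul1r addr0.
  have t0' : 0 < t by rewrite lt_def tn0.
  have h1 : t * cmod c < t * 2 by rewrite ltr_pM2l.
  have h2 : (1 - t) * cmod x2 <= (1 - t) * 2 by apply: ler_wpM2l => //; exact: ltW.
  lra.
have Gc1 : GMult (beta t1) c 0.
  apply: (GMult_segment _ G1) => t /andP[t0 t1'].
  have It : 0 < cIm (x1 + toC t * (c - x1)).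
    rewrite cImD cImM cImD cImN toCK cI.
    have -> : cIm (toC t : C) = 0 by [].
    rewrite mul0r addr0.
    have [->|tn0] := eqVneq t 0; first by rewrite !mul0r; lra.
    have t0' : 0 < t by rewrite lt_def tn0.
    have := mulr_ge0 (_ : 0 <= 1 - t) (ltW Ix1); rewrite subr_ge0 => /(_ t1'); lra.
  split; first exact: gIm.
  apply: bsec; apply: V1; apply: cgt.
  rewrite cReD cReM cReD cReN toCK cR.
  have -> : cIm (toC t : C) = 0 by [].
  rewrite mul0r subr0.
  have [->|tn0] := eqVneq t 0; first by rewrite !mul0r addr0.
  have t0' : 0 < t by rewrite lt_def tn0.
  have := mulr_ge0 (_ : 0 <= 1 - t) (_ : 0 <= cRe x1 - 3 / 2); rewrite !subr_ge0.
  by move=> /(_ t1' (ltW x1r)); lra.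
have [d d0 hd] := Gc2.
have gc : off_poles c by apply: gIm; rewrite cI; lra.
(* Near [c] both sections are defined and their quotient is y - h(x), so the order 0 of [beta t2]
   forces order 1 for [beta t1], against [Gc1]. *)
have Gc1' : GMult (beta t1) c 1.
  have nc : \forall x \near c, [/\ off_poles x, 3 / 2 < cmod x & cmod x < 2].
    near=> x; split.
    - by near: x; exact: near_off_poles.
    - near: x; apply/nearC; exists (cmod c - 3 / 2); first by rewrite subr_gt0.
      move=> x xc; have := cmod_sub c x; rewrite (cmodB c x); lra.
    - by near: x; exact: near_cmod_lt.
  have /nearC[d' d'0 hd'] := nc.
  exists (Num.min d d'); first by rewrite lt_min d0.
  move=> x /andP[x0]; rewrite lt_min => /andP[xd xd'].
  have [gx xl xr] := hd' x xd'.
  have Vx1 : V t1 (P (graph_pt x)) by exact: V1.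
  have Vx2 : V t2 (P (graph_pt x)) by exact: V2.
  have n1 := near_V Vopen Vx1; have n2 := near_V Vopen Vx2.
  have := @Mult_shift (beta t1) (beta t2) (F t1 t2) x 0 gx; rewrite add0r; apply.
  - by apply: filterS2 n1 n2 => z; exact: Freg.
  - by apply: filterS2 n1 n2 => z v1 v2; rewrite bdiff// /transition F21 mgerm1 subr0.
  - apply/nearCC; exists (Num.min (cmod x - 3 / 2) (2 - cmod x)).
      by rewrite lt_min !subr_gt0 xl.
    move=> y w; rewrite lt_min => /andP[y1 y2] _; rewrite /pullback /graph_coord /= F12.
      by rewrite addrAC subrr add0r.
    have h1 := cmodD x y; have := cmod_sub x (- y); rewrite opprK cmodN => h2.
    by apply/andP; split; lra.
  - by apply: hd; rewrite x0.
by have := GMult_unique gc Gc1 Gc1'.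
Unshelve. all: by end_near. Qed.

End Multiplicity.

(** * The affine and the projective plane *)

Section Regularity.
Variables (R : realType) (X : topologicalType) (n : nat).
Variable A : holo_atlas R n X.
Local Notation C := (Cplx R).

Lemma regular_unit (f : X -> C) z : holo_at A f z -> (\forall y \near z, f y != 0) ->
  regular_at A f z.
Proof.
move=> hf f0; split=> // h _ fh0; apply: filterS2 f0 fh0 => y fy /eqP.
by rewrite -[(f * h) y]/(f y * h y) mulf_eq0 (negbTE fy) => /eqP.
Qed.

End Regularity.

Section Graph.
Variables (R : realType) (X : topologicalType).
Variable A : holo_atlas R 2 X.
Variable i : chart_idx A.
Local Notation C := (Cplx R).
Hypothesis chart_full : chart A i @` dom A i = setT.
Local Notation P := (param A i).

(** If f h = 0, then the continuous function h vanishes off the graph of [k], and the complement of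
    a graph is dense. *)
Lemma regular_graph (f : X -> C) (k : C -> C) w : holo_at A f (P w) ->
  (\forall w' \near w, f (P w') = w' 0 1 - k (w' 0 0)) -> regular_at A f (P w).
Proof.
move=> hf fk; split=> // h hh fh0.
have hdom := param_dom chart_full w.
have dh : \forall w' \near w, differentiable (h \o P) w'.
  by have := hh i hdom; rewrite paramK.
have e : \forall w' \near w, f (P w') * h (P w') = 0 by have := near_param chart_full fh0.
apply: (near_param_inv chart_full).
have e' : \forall w' \near w, \forall w'' \near w', f (P w'') * h (P w'') = 0 /\ f (P w'') = w'' 0 1 - k (w'' 0 0).
  by apply: nbhs_interior; apply: filterS2 e fk.
apply: filterS2 e' dh => w' e1 dh; apply/eqP/negP => /negP hw'.
have n1 : \forall w'' \near w', h (P w'') != 0.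
  by have := differentiable_continuous dh; move=> /cvgr_neq0; apply.
(* The complement of a graph is dense: move [w'] vertically. *)
pose q (t : C) : 'rV[C]_2 := pt (w' 0 0) (w' 0 1 + t).
have dq : {for 0, continuous q}.
  apply: differentiable_continuous; apply: dpt; first exact: dcst.
  by apply: dD; [exact: dcst|exact: did].
have q0 : q 0 = w' by rewrite /q addr0 pt_coord.
have n2 : \forall t \near (0 : C), t = k (w' 0 0) - w' 0 1.
  have h1 : \forall w'' \near q 0, (w'' : 'rV[C]_2) 0 1 = k (w'' 0 0).
    rewrite q0; apply: filterS2 n1 e1 => w'' hn [/eqP]; rewrite mulf_eq0 (negbTE hn) orbF => /eqP -> /esym/eqP.
    by rewrite subr_eq0 => /eqP.
  have h2 : \forall t \near (0 : C), q t 0 1 = k (q t 0 0) by exact: dq h1.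
  apply: filterS h2 => t /=; rewrite /q pt0 pt1 => <-.
  by rewrite addrAC subrr add0r.
(* All small [t] would equal one constant, which t = 0 and t = d/2 refute. *)
have /nearC[d d0 hd] := n2.
have h1 := hd 0; rewrite subrr cmod0 d0 in h1; have := h1 isT => {}h1.
have := hd (toC (d / 2)); rewrite -h1 subr0 cmod_toC gtr0_norm ?divr_gt0// => h2.
have /h2/eqP : d / 2 < d by lra.
by rewrite -cmod_eq0 cmod_toC gtr0_norm ?divr_gt0// gt_eqF// divr_gt0.
Qed.

End Graph.

Section ThreeLabels.
Variable C : comNzRingType.

(* [Some true], [Some false] and [None] label the open sets V1, V2 and V0;
   the transition function from [a] to [b] is [transition_table a b / transition_table b a]. *)
Definition transition_table (q12 q10 q02 : C) (a b : option bool) : C :=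
  match a, b with
  | Some true, Some false => q12
  | Some true, None => q10
  | None, Some false => q02
  | _, _ => 1
  end.

(** Unless the three labels are distinct, both sides agree by commutativity; for distinct labels the
    relation is [q12 = q10 * q02]. *)
Lemma transition_table_cocycle (V : option bool -> Prop) q12 q10 q02 a b c : V a -> V b -> V c ->
  (V (Some true) -> V (Some false) -> V None -> q12 = q10 * q02) ->
  transition_table q12 q10 q02 a b * transition_table q12 q10 q02 b c * transition_table q12 q10 q02 c a =
  transition_table q12 q10 q02 b a * transition_table q12 q10 q02 c b * transition_table q12 q10 q02 a c.
Proof.
move=> + + + h; case: a => [[]|]; case: b => [[]|]; case: c => [[]|] Va Vb Vc;
  rewrite /transition_table ?mul1r ?mulr1//; try by [rewrite mulrC|rewrite h//|rewrite h// mulrC].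
Qed.

End ThreeLabels.

(** * The bundle on the affine plane *)

Section Affine.
Variable R : realType.
Local Notation C := (Cplx R).
Local Notation A := (affine_atlas R 2).

Lemma affine_full : chart A tt @` dom A tt = setT.
Proof. by rewrite /= image_id. Qed.

Lemma affine_holo (f : 'rV[C]_2 -> C) (D : set 'rV[C]_2) x : open D -> D x ->
  (forall v, D v -> differentiable f v) -> holo_at A f x.
Proof.
move=> oD Dx df j _; rewrite /=.
by apply: filterS (open_nbhs_nbhs (conj oD Dx)) => v /df.
Qed.

Lemma open_cmod_gt (r : R) : open [set x : C | r < cmod x].
Proof.
rewrite openE => x /= rx; apply/nearC; exists (cmod x - r); first by rewrite subr_gt0.
by move=> y yx; have := cmod_sub x y; rewrite (cmodB x y) /= => h; lra.
Qed.

Lemma open_cmod_lt (r : R) : open [set x : C | cmod x < r].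
Proof. by rewrite openE => x /= rx; exact: near_cmod_lt. Qed.

Lemma continuous_coordC m (j : 'I_m.+1) : continuous (fun v : 'rV[C]_m.+1 => v 0 j).
Proof. by move=> v; apply: differentiable_continuous; exact: differentiable_coord. Qed.

(** The third set is empty, so that the affine case can share the three-label table. *)
Definition affV (a : option bool) : set 'rV[C]_2 := [set w |
  match a with
  | Some true => 3 / 2 < cmod (w 0 0)
  | Some false => cmod (w 0 0) < 2
  | None => False
  end].

Definition affF (a b : option bool) (w : 'rV[C]_2) : C :=
  transition_table (w 0 1 - hfun (w 0 0)) 1 1 a b.

Lemma affV_open a : open (affV a).
Proof.
have /continuousP c := @continuous_coordC 1 0.
case: a => [[]|]; last by rewrite (_ : affV None = set0)//; exact: open0.
  exact: (c _ (@open_cmod_gt (3 / 2))).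
exact: (c _ (@open_cmod_lt 2)).
Qed.

Definition aff_lab (w : 'rV[C]_2) : option bool := Some (3 / 2 < cmod (w 0 0)).

Lemma aff_labP w : affV (aff_lab w) w.
Proof. by rewrite /aff_lab /affV /=; case: ltP => // h; apply: le_lt_trans h _; lra. Qed.

Lemma off_poles_annulus (x : C) : 3 / 2 < cmod x -> cmod x < 2 -> off_poles x.
Proof.
move=> x1 x2; split; apply/negP => /eqP e; move: x1 x2; rewrite e ?cmod0 ?cmod_nat; lra.
Qed.

Lemma affF_regular a b z : affV a z -> affV b z -> regular_at A (affF a b) z.
Proof.
have r1 : regular_at A 1 z by exact: regular_at1.
case: a => [[]|//]; case: b => [[]|//] Va Vb; try exact: r1.
have holo : holo_at A (affF (Some true) (Some false)) z.
  apply: (@affine_holo _ (affV (Some true) `&` affV (Some false)));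
    [by apply: openI; exact: affV_open|by split|].
  move=> v [v1 v2]; have [g0 g8] := off_poles_annulus v1 v2.
  apply: dB; first exact: differentiable_coord.
  have d0 : differentiable (fun w : 'rV[C]_2 => w 0 0) v by exact: differentiable_coord.
  exact: (dcomp d0 (dhfun g0 g8)).
apply: (@regular_graph _ _ A tt affine_full _ (@hfun R) z holo).
exact: (@filterE _ (nbhs (z : 'rV[C]_2)) (nbhs_filter (z : 'rV[C]_2))).
Qed.

Lemma affF_cocycle a b c z : affV a z -> affV b z -> affV c z ->
  affF a b z * affF b c z * affF c a z = affF b a z * affF c b z * affF a c z.
Proof. by move=> Va Vb Vc; exact: (@transition_table_cocycle _ (affV^~ z) _ _ _ _ _ _ Va Vb Vc). Qed.

Lemma affine_nontrivial : exists L : mero_line_bundle A, L <> 0.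
Proof.
eexists; apply: (@fun_cocycle_nontrivial R _ A tt affine_full _ affV affF aff_lab
  affV_open aff_labP affF_regular affF_cocycle (Some true) (Some false)).
- by move=> x y xr; rewrite /affV /= pt0.
- by move=> x y xr; rewrite /affV /= pt0.
- by move=> x y _; rewrite /affF /= pt0 pt1.
- by [].
Qed.

End Affine.

(** * Open sets and functions on projective space given by homogeneous data *)

Section HomogeneousFunctions.
Variables (R : realType) (n : nat).
Local Notation C := (Cplx R).

Definition homog (D : set 'rV[C]_n.+1) : Prop := forall c v, c != 0 -> D (c *: v) <-> D v.

(** [hcoord] chooses representatives without continuity; invariance under scaling allows membership
    to be tested on any representative. *)
Lemma open_homog (D : set 'rV[C]_n.+1) : open D -> homog D ->
  open [set x : proj_space R n | D (hcoord x)].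
Proof.
move=> oD hD; apply: (@Defs.proj_open R n); rewrite openE => u.
have h (v : nzvec R n) : D (hcoord (proj_pt v)) <-> D (set_val v).
  by have [c c0 ->] := hcoord_pi v; exact: hD.
move=> /h Du; have n1 : nbhs u (set_val @^-1` D).
  exact: (@set_val_continuous R n u _ (open_nbhs_nbhs (conj oD Du))).
by apply: (filterS _ n1) => v Dv; apply/h.
Qed.

Lemma homog_holo (D : set 'rV[C]_n.+1) (G : 'rV[C]_n.+1 -> C) (x : proj_space R n) :
  open D -> homog D -> (forall c v, c != 0 -> G (c *: v) = G v) ->
  (forall v, D v -> differentiable G v) -> D (hcoord x) ->
  holo_at (proj_atlas R n) (fun y => G (hcoord y)) x.
Proof.
move=> oD hD hG dG Dx j xj.
have hP w : exists2 c : C, c != 0 & hcoord (proj_param j w) = c *: Defs.hom j w.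
  by have := hcoord_pi (hom_nz j w).
have -> : (fun y => G (hcoord y)) \o param (proj_atlas R n) j = G \o Defs.hom j.
  by apply/funext => w /=; have [c c0 ->] := hP w; rewrite hG.
have Dw : D (Defs.hom j (chart (proj_atlas R n) j x)).
  have [c c0 e] := hP (proj_chart j x).
  by apply/(hD c _ c0); rewrite -e proj_chartK.
have n1 : \forall w \near chart (proj_atlas R n) j x, D (Defs.hom j w).
  set w0 := chart _ j x; have c : {for w0, continuous (Defs.hom j)}.
    exact: differentiable_continuous (differentiable_hom j w0).
  exact: (c _ (open_nbhs_nbhs (conj oD Dw))).
apply: filterS n1 => w Dw'.
by apply: differentiable_comp; [exact: differentiable_hom|exact: dG].
Qed.

End HomogeneousFunctions.

(** * The bundle on the projective plane *)

Section Projective.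
Variable R : realType.
Local Notation C := (Cplx R).
Local Notation A := (proj_atlas R 2).
Local Notation X := (proj_space R 2).

Definition Zindex : 'I_3 := @Ordinal 3 2 isT.

Lemma proj_full : chart A Zindex @` dom A Zindex = setT.
Proof. exact: proj_chart_image. Qed.

Lemma vX_hom w : vX (Defs.hom Zindex w : 'rV[C]_3) = w 0 0.
Proof.
rewrite /vX mxE (_ : Ordinal _ = lift Zindex 0) ?liftK//; exact: val_inj.
Qed.

Lemma vY_hom w : vY (Defs.hom Zindex w : 'rV[C]_3) = w 0 1.
Proof.
rewrite /vY mxE (_ : Ordinal _ = lift Zindex 1) ?liftK//; exact: val_inj.
Qed.

Lemma vZ_hom w : vZ (Defs.hom Zindex w : 'rV[C]_3) = 1.
Proof. exact: hom_i. Qed.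

Lemma vXZ c (v : 'rV[C]_3) : vX (c *: v) = c * vX v. Proof. by rewrite /vX mxE. Qed.
Lemma vYZ c (v : 'rV[C]_3) : vY (c *: v) = c * vY v. Proof. by rewrite /vY mxE. Qed.
Lemma vZZ c (v : 'rV[C]_3) : vZ (c *: v) = c * vZ v. Proof. by rewrite /vZ mxE. Qed.

Lemma quotZ (c a b : C) : c != 0 -> c * a / (c * b) = a / b.
Proof. by move=> c0; rewrite invfM mulrACA mulfV// mul1r. Qed.

Lemma dvX (v : 'rV[C]_3) : differentiable (@vX R) v. Proof. exact: differentiable_coord. Qed.
Lemma dvY (v : 'rV[C]_3) : differentiable (@vY R) v. Proof. exact: differentiable_coord. Qed.
Lemma dvZ (v : 'rV[C]_3) : differentiable (@vZ R) v. Proof. exact: differentiable_coord. Qed.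

(** V1, V2 and V0 with the denominator Z cleared, so that the line Z = 0 is included: V1 contains
    its points with X nonzero, V0 those with Y nonzero. *)
Definition cone (a : option bool) : set 'rV[C]_3 := [set v |
  match a with
  | Some true => 3 / 2 * cmod (vZ v) < cmod (vX v)
  | Some false => cmod (vX v) < 2 * cmod (vZ v)
  | None => expR 1 * cmod (vZ v) < cmod (vY v)
  end].

Lemma cmod_continuous : continuous (@cmod R : C -> R).
Proof.
move=> z; apply/(@cvgrPdist_lt R R C (nbhs z) (nbhs_filter z)) => e e0.
apply/nearC; exists e => // w wz; rewrite ltr_norml.
have := cmod_sub z w; have := cmod_sub w z; rewrite (cmodB z w) => h1 h2.
by apply/andP; split; lra.
Qed.

Lemma open_cmod_cmp (f g : 'rV[C]_3 -> C) (a b : R) :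
  (forall v, differentiable f v) -> (forall v, differentiable g v) ->
  open [set v | a * cmod (f v) < b * cmod (g v)].
Proof.
move=> df dg; have cf k (h : 'rV[C]_3 -> C) : (forall v, differentiable h v) ->
    continuous (fun v => k * cmod (h v)).
  move=> dh v; apply: (@cvgM R _ (nbhs v) _ (cst k) (fun v => cmod (h v))); first exact: cvg_cst.
  exact: (continuous_comp (differentiable_continuous (dh v)) (@cmod_continuous _)).
have /continuousP o : continuous (fun v => b * cmod (g v) - a * cmod (f v)).
  move=> v; have h1 := cf b g dg v; have h2 := cf a f df v.
  exact: (@cvgB R R^o _ (nbhs v) (nbhs_filter v) _ _ _ _ h1 h2).
have -> : [set v | a * cmod (f v) < b * cmod (g v)] =
    (fun v => b * cmod (g v) - a * cmod (f v)) @^-1` [set x | 0 < x].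
  by apply/seteqP; split=> v /=; rewrite subr_gt0.
by apply: o; exact: open_gt.
Qed.

Lemma open_cone a : open (cone a).
Proof.
case: a => [[]|].
- have := @open_cmod_cmp _ _ (3 / 2) 1 dvZ dvX; congr (open _).
  by apply/seteqP; split=> v /=; rewrite mul1r.
- have := @open_cmod_cmp _ _ 1 2 dvX dvZ; congr (open _).
  by apply/seteqP; split=> v /=; rewrite mul1r.
- have := @open_cmod_cmp _ _ (expR 1) 1 dvZ dvY; congr (open _).
  by apply/seteqP; split=> v /=; rewrite mul1r.
Qed.

Lemma homog_cone a : homog (cone a).
Proof.
move=> c v c0; have h : 0 < cmod c by rewrite cmod_gt0.
case: a => [[]|]; rewrite /cone /= ?vXZ ?vYZ ?vZZ !cmodM mulrCA.
- by rewrite ltr_pM2l.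
- by rewrite ltr_pM2l.
- by rewrite ltr_pM2l.
Qed.

Definition projV (a : option bool) : set X := [set x | cone a (hcoord x)].

Lemma projV_open a : open (projV a).
Proof. by apply: open_homog; [exact: open_cone|exact: homog_cone]. Qed.

Definition proj_lab (x : X) : option bool :=
  if 3 / 2 * cmod (vZ (hcoord x)) < cmod (vX (hcoord x)) then Some true
  else if cmod (vX (hcoord x)) < 2 * cmod (vZ (hcoord x)) then Some false else None.

(** A point in neither V1 nor V2 satisfies 2 |Z| <= |X| <= 3/2 |Z|, so X = Z = 0; it is [0 : 1 : 0],
    which lies in V0. *)
Lemma proj_labP x : projV (proj_lab x) x.
Proof.
rewrite /projV /proj_lab /cone /=; case: ltP => // h1; case: ltP => // h2.
have Z0 : cmod (vZ (hcoord x)) = 0.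
  by apply/eqP; rewrite eq_le cmod_ge0 andbT; lra.
have X0 : cmod (vX (hcoord x)) = 0.
  by apply/eqP; rewrite eq_le cmod_ge0 andbT; lra.
rewrite Z0 mulr0 cmod_gt0; apply/negP => /eqP Y0.
have /negP := set_valP (repr x : nzvec R 2); apply; apply/eqP/rowP => k.
rewrite [RHS]mxE -[LHS]/(hcoord x 0 k).
case: k => -[|[|[|//]]] kp.
- by rewrite (bool_irrelevance kp isT); apply/eqP; rewrite -cmod_eq0; apply/eqP.
- by rewrite (bool_irrelevance kp isT).
- by rewrite (bool_irrelevance kp isT); apply/eqP; rewrite -cmod_eq0; apply/eqP.
Qed.

(** y - h(x) and its two factors from [wiener_hopf], in homogeneous coordinates. *)
Definition G12 (v : 'rV[C]_3) : C := vY v / vZ v - hfun (vX v / vZ v).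
Definition G10 (v : 'rV[C]_3) : C := cexp (- (Gint 1 v / loopc R)).
Definition G02 (v : 'rV[C]_3) : C := vY v / vZ v * cexp (Gint 2 v / loopc R).

Definition projF (a b : option bool) (x : X) : C :=
  transition_table (G12 (hcoord x)) (G10 (hcoord x)) (G02 (hcoord x)) a b.

Lemma cone2_Z (v : 'rV[C]_3) : cone (Some false) v -> vZ v != 0.
Proof.
rewrite /cone /= -cmod_gt0 => h; rewrite lt_def cmod_ge0 andbT; apply/negP => /eqP e.
by move: h; rewrite e mulr0 ltNge cmod_ge0.
Qed.

Lemma cone0_Y (v : 'rV[C]_3) : cone None v -> vY v != 0.
Proof.
by rewrite /cone /= -cmod_gt0; apply: le_lt_trans; rewrite mulr_ge0 ?expR_ge0 ?cmod_ge0.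
Qed.

Lemma annulusZ (v : 'rV[C]_3) : cone (Some true) v -> cone (Some false) v ->
  3 / 2 < cmod (vX v / vZ v) /\ cmod (vX v / vZ v) < 2.
Proof.
move=> h1 h2; have Z0 : 0 < cmod (vZ v) by rewrite cmod_gt0; exact: cone2_Z.
by rewrite cmodM cmodV ltr_pdivlMr// ltr_pdivrMr.
Qed.

Lemma dquotZ (f : 'rV[C]_3 -> C) (v : 'rV[C]_3) : vZ v != 0 -> differentiable f v ->
  differentiable (fun v => f v / vZ v) v.
Proof. by move=> Z0 df; apply: dM => //; apply: dV => //; exact: dvZ. Qed.

Lemma dG12 v : cone (Some true) v -> cone (Some false) v -> differentiable G12 v.
Proof.
move=> v1 v2; have Z0 := cone2_Z v2; have [r1 r2] := annulusZ v1 v2.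
have [g0 g8] := off_poles_annulus r1 r2.
apply: dB; first exact: (dquotZ Z0 (dvY v)).
exact: (dcomp (dquotZ Z0 (dvX v)) (dhfun g0 g8)).
Qed.

Lemma dGint_loopc r (v : 'rV[C]_3) : differentiable (Gint r) v ->
  differentiable (fun v => Gint r v / loopc R) v.
Proof. by move=> d; apply: dM; [exact: d|exact: dcst]. Qed.

Lemma dG10 v : cone (Some true) v -> cone None v -> differentiable G10 v.
Proof.
move=> v1 v0; have d := dN (dGint_loopc (Gint1_diff v0 v1)).
exact: (dcomp d (dcexp _)).
Qed.

Lemma dG02 v : cone (Some false) v -> cone None v -> differentiable G02 v.
Proof.
move=> v2 v0; have d := dGint_loopc (Gint2_diff v0 v2).
apply: dM; first exact: (dquotZ (cone2_Z v2) (dvY v)).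
exact: (dcomp d (dcexp _)).
Qed.

Lemma G12Z c v : c != 0 -> G12 (c *: v) = G12 v.
Proof. by move=> c0; rewrite /G12 vXZ vYZ vZZ !quotZ. Qed.

Lemma G10Z c v : c != 0 -> G10 (c *: v) = G10 v.
Proof. by move=> c0; rewrite /G10 GintZ. Qed.

Lemma G02Z c v : c != 0 -> G02 (c *: v) = G02 v.
Proof. by move=> c0; rewrite /G02 vYZ vZZ quotZ// GintZ. Qed.

Lemma near_projV a (x : X) : projV a x -> \forall y \near x, projV a y.
Proof. by move=> h; exact: (open_nbhs_nbhs (conj (@projV_open a) h)). Qed.

Lemma cone_holo a b (G : 'rV[C]_3 -> C) (x : X) :
  (forall c v, c != 0 -> G (c *: v) = G v) ->
  (forall v, cone a v -> cone b v -> differentiable G v) -> projV a x -> projV b x ->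
  holo_at A (fun y => G (hcoord y)) x.
Proof.
move=> hG dG xa xb; apply: (@homog_holo R 2 (cone a `&` cone b)) => //.
- by apply: openI; exact: open_cone.
- by move=> c v c0; split=> -[h1 h2]; split; apply/(homog_cone _ _ c0).
- by move=> v [v1 v2]; exact: dG.
Qed.

Lemma hcoord_param w : exists2 c : C, c != 0 & hcoord (param A Zindex w) = c *: Defs.hom Zindex w.
Proof. by have := hcoord_pi (hom_nz Zindex w). Qed.

Lemma G12_param w : G12 (hcoord (param A Zindex w)) = w 0 1 - hfun (w 0 0).
Proof.
by have [c c0 ->] := hcoord_param w; rewrite G12Z// /G12 vX_hom vY_hom vZ_hom !divr1.
Qed.

(** [G10] and [G02] are holomorphic without zeros on their overlaps. The intersection of V1 and V2
    lies in the chart where Z is nonzero, and there [G12] is the equation of a graph, to which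
    [regular_graph] applies. *)
Lemma projF_regular a b x : projV a x -> projV b x -> regular_at A (projF a b) x.
Proof.
have r1 : regular_at A 1 x by exact: regular_at1.
case: a => [[]|]; case: b => [[]|] Va Vb; try exact: r1.
- have holo : holo_at A (projF (Some true) (Some false)) x.
    exact: (cone_holo G12Z dG12 Va Vb).
  have xZ : proj_dom Zindex x by exact: (cone2_Z Vb).
  rewrite -(proj_chartK xZ) in holo *.
  apply: (@regular_graph _ _ A Zindex proj_full _ (@hfun R) _ holo).
  exact: (@filterE _ (nbhs (_ : 'rV[C]_2)) (nbhs_filter (_ : 'rV[C]_2)) _ G12_param).
- apply: regular_unit; first exact: (cone_holo G10Z dG10 Va Vb).
  by near=> y; exact: cexp_neq0.
- apply: regular_unit.
    by apply: (cone_holo G02Z _ Vb Va) => v; exact: dG02.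
  near=> y; rewrite /projF /= mulf_neq0 ?cexp_neq0// mulf_neq0 ?invr_neq0//.
    by apply: cone0_Y; near: y; exact: near_projV.
  by apply: cone2_Z; near: y; exact: near_projV.
Unshelve. all: by end_near. Qed.

Lemma projF_cocycle a b c x : projV a x -> projV b x -> projV c x ->
  projF a b x * projF b c x * projF c a x = projF b a x * projF c b x * projF a c x.
Proof.
move=> Va Vb Vc; apply: (@transition_table_cocycle _ (projV^~ x) _ _ _ _ _ _ Va Vb Vc) => V1 V2 V0.
by apply: wiener_hopf; [exact: V0|apply/andP; split; [exact: V1|exact: V2]].
Qed.

Lemma cone_param a w : cone a (Defs.hom Zindex w) -> projV a (param A Zindex w).
Proof.
by rewrite /projV /=; have [c c0 e] := hcoord_param w; move: e => /= -> h; apply/homog_cone.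
Qed.

Lemma projective_nontrivial : exists L : mero_line_bundle A, L <> 0.
Proof.
eexists; apply: (@fun_cocycle_nontrivial R _ A Zindex proj_full _ projV projF proj_lab
  projV_open proj_labP projF_regular projF_cocycle (Some true) (Some false)).
- by move=> x y xr; apply: cone_param; rewrite /cone /= vX_hom vZ_hom cmod1 mulr1 pt0.
- by move=> x y xr; apply: cone_param; rewrite /cone /= vX_hom vZ_hom cmod1 mulr1 pt0.
- by move=> x y _; rewrite -[LHS]/(G12 _) G12_param pt0 pt1.
- by [].
Qed.

End Projective.

Theorem mainTheorem5 (R : realType) :
  (exists L : mero_line_bundle (affine_atlas R 2), L <> 0) /\
  (exists L : mero_line_bundle (proj_atlas R 2), L <> 0).
Proof. by split; [exact: affine_nontrivial|exact: projective_nontrivial]. Qed.
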